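(* Assume $\lim_{n\to\infty} N/n = c\in(0,\infty)$ and $$\sum_{n\ge 1} (\log n)^{3\alpha/2}\, n^{-1/2}\,\beta_n<\infty\quad\text{for some }\alpha>1 .$$ Then for every $z\in\mathbb C^+$, $$S_{\mathbf B_n}(z)-\mathbb E\big(S_{\mathbf B_n}(z)\big)\longrightarrow 0 \quad\text{almost surely as } n\to\infty .$$
   Context: Let $(\varepsilon_i)_{i\in\mathbb Z}$ be a strictly stationary sequence of real random variables. For two $\sigma$-algebras $\mathcal A,\mathcal B$, define $$\beta(\mathcal A,\mathcal B)=\tfrac12\sup\sum_{i\in I}\sum_{j\in J}\big|\mathbb P(A_i\cap B_j)-\mathbb P(A_i)\mathbb P(B_j)\big|,$$ where the supremum is over all finite partitions $(A_i)_{i\in I}$ of $\Omega$ into $\mathcal A$-measurable sets and $(B_j)_{j\in J}$ into $\mathcal B$-measurable sets. The $\beta$-mixing coefficients of $(\varepsilon_i)$ are $\beta_0=1$ and, for $n\ge1$, $$\beta_n=\sup_{k\in\mathbb Z}\beta\big(\sigma(\varepsilon_\ell,\ \ell\le k),\ \sigma(\varepsilon_{\ell+n},\ \ell\ge k)\big).$$ Let $g:\mathbb R^{\mathbb Z}\to\mathbb R$ be measurable, and set $X_k=g(\ldots,\varepsilon_{k-1},\varepsilon_k,\varepsilon_{k+1},\ldots)$ for $k\in\mathbb Z$. Assume $\mathbb E X_k=0$ and $\mathbb E X_k^2<\infty$. Let $N=N(n)$ be a sequence of positive integers. Let $\mathcal X_n$ be the $N\times n$ matrix with $(i,j)$ entry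 $X_{(j-1)N+i}$, and let $\mathbf B_n=\frac1n\mathcal X_n\mathcal X_n^T$. For an $N\times N$ real symmetric matrix $A$ and $z\in\mathbb C^+=\{z:\operatorname{Im}z>0\}$, the Stieltjes transform of its empirical spectral measure is $S_A(z)=\frac1N\operatorname{Tr}(A-zI)^{-1}$. *)

(* Defs.v *)
From HB Require Import structures.
From mathcomp Require Import all_boot all_order all_algebra.
From mathcomp Require Import all_classical all_reals all_analysis.
From mathcomp Require Import complex.
Import Order.TTheory GRing.Theory Num.Theory.

Set Implicit Arguments.
Unset Strict Implicit.
Unset Printing Implicit Defensive.

Local Open Scope classical_set_scope.
Local Open Scope ring_scope.

Section defs.
Context {d : measure_display} {T : measurableType d} {R : realType}.
Variable P : probability T R.

(** Strict stationarity of (eps_i)_{i in Z}: each eps_i is a random variable and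
    all finite-dimensional distributions are shift invariant (checked on
    measurable rectangles, which determine the joint laws). *)
Definition strictly_stationary (eps : int -> T -> R) : Prop :=
  (forall i, measurable_fun setT (eps i)) /\
  forall (m : nat) (t : 'I_m -> int) (B : 'I_m -> set R) (h : int),
    (forall i, measurable (B i)) ->
    P (\bigcap_i (eps (t i) @^-1` B i)) =
    P (\bigcap_i (eps (t i + h) @^-1` B i)).

Definition sigma_gen (eps : int -> T -> R) (I : set int) : set (set T) :=
  <<s [set A | exists l, I l /\ exists B : set R, measurable B /\ A = eps l @^-1` B] >>.

Definition finite_partition (F : set (set T)) (m : nat) (A : 'I_m -> set T) : Prop :=
  (forall i, F (A i)) /\ \bigcup_i A i = setT /\
  (forall i j, i != j -> A i `&` A j = set0).

Definition beta_coef (F G : set (set T)) : \bar R :=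
  ((2^-1)%:E * ereal_sup
    [set r | exists (m n : nat) (A : 'I_m -> set T) (B : 'I_n -> set T),
       [/\ finite_partition F A, finite_partition G B &
         r = (\sum_(i < m) \sum_(j < n)
            `| fine (P (A i `&` B j)) - fine (P (A i)) * fine (P (B j)) |)%:E] ])%E.

Definition beta_mixing (eps : int -> T -> R) (n : nat) : \bar R :=
  if n == 0%N then 1%E else
  ereal_sup [set beta_coef (sigma_gen eps [set l | l <= k])
                           (sigma_gen eps [set l | k + n%:Z <= l]) | k in [set: int]].

End defs.

Definition cylinder_sets {R : realType} : set (set (int -> R)) :=
  [set C | exists (l : int) (B : set R), measurable B /\ C = [set f | B (f l)]].

Definition product_measurable {R : realType} (g : (int -> R) -> R) : Prop :=
  forall B : set R, measurable B -> <<s (@cylinder_sets R) >> (g @^-1` B).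

Definition shift_process {T : Type} {R : realType} (g : (int -> R) -> R)
  (eps : int -> T -> R) (k : int) (w : T) : R := g (fun l => eps (k + l) w).

(** the N x n matrix with (i,j) entry X_{(j-1)N+i} (1-based); 0-based i, j *)
Definition data_matrix {T : Type} {R : realType} (X : int -> T -> R) (N n : nat)
  (w : T) : 'M[R]_(N, n) :=
  \matrix_(i < N, j < n) X ((j * N + i + 1)%N%:Z) w.

Definition B_matrix {T : Type} {R : realType} (X : int -> T -> R) (N n : nat)
  (w : T) : 'M[R]_N :=
  (n%:R)^-1 *: (data_matrix X N n w *m (data_matrix X N n w)^T).

Definition stieltjes {R : realType} (N : nat) (A : 'M[R]_N) (z : R[i]) : R[i] :=
  (N%:R)^-1 * \tr (invmx (map_mx (fun x : R => (x%:C)%C) A - z%:M)).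

Definition cexpectation {d : measure_display} {T : measurableType d} {R : realType}
  (P : probability T R) (Y : T -> R[i]) : R[i] :=
  (fine ('E_P[fun w => complex.Re (Y w)])%E +i* fine ('E_P[fun w => complex.Im (Y w)])%E)%C.

(* Main.v *)
Require Import Defs.
From HB Require Import structures.
From mathcomp Require Import all_boot all_order all_algebra.
From mathcomp Require Import all_classical all_reals all_analysis.
From mathcomp Require Import measurable_realfun.
From mathcomp Require Import complex.
From mathcomp Require Import ring lra zify.

Set Implicit Arguments.
Unset Strict Implicit.
Unset Printing Implicit Defensive.

Import Order.TTheory GRing.Theory Num.Theory.
Import numFieldNormedType.Exports.
Local Open Scope classical_set_scope.
Local Open Scope ring_scope.

(** The Stieltjes transform [S] of [X X^T / n] satisfies
    [|S(X) - S(Y)| <= 2 (Im z)^-2 (s |X|^2 + |X - Y|^2 / s) / (N n)] for [0 < s <= 1] in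
    Frobenius norms, because the resolvents have norm at most [1 / Im z]; changing
    only the columns in a set [J] costs at most the squared norm of these columns.

    The first bound allows [g] to be replaced by a function [h] with finitely many
    values that depends on finitely many coordinates: the averages of [X_k^2] and of
    [(X_k - h_k)^2] are controlled uniformly in [n], outside an event of small
    probability, by a maximal inequality for stationary sequences.

    For such an [h], split the columns into about [log n] blocks separated by gaps
    that make up a small fraction of the columns. The blocks take finitely many
    values, so the law of the blocks differs in total variation from the product of
    its marginals by at most twice (number of blocks) x [beta] (gap length), and under the
    product law a bounded difference inequality gives exponential concentration.
    As gaps have length of order [n^2 / log n], the total variation errors are summable
    in [n] (this is where the exponents 3/2 and -1/2 come from), and the Borel-Cantelli
    lemma applies. *)

(** * Resolvents of Gram matrices *)

(** The columns are consecutive stretches of length [N] of one process, so dropping [q] columns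
    opens a time gap of [q * N]; this is why gaps of order [n ^ 2 / log n] are available. The number
    of blocks is a compromise: the concentration exponent is linear in it and must beat [log n],
    while every block costs one more [beta]. Heuristically, in the sum over [n] of
    [log n * beta (n ^ 2 / log n)], put [u = n ^ 2 / log n]; then [n] is of order
    [(u * log u) ^ (1/2)], and the sum becomes that of [(log u) ^ (3/2) * u ^ (- 1/2) * beta u]. The
    function [g] may be unbounded and depend on all coordinates, so neither bounded differences nor
    mixing applies to it directly. Replacing it by [h] must cost little for all [n] at once on
    almost every path. No ergodic theorem is required: a maximal inequality bounds all averages
    outside one event, and the probabilities of these events are made summable along a sequence of
    approximations. Finite values turn blocks into elements of a finite type, so that expectations
    are finite sums, which the finite partitions in the definition of [beta] control directly. *)

Section complex_parts.
Context {R : realType}.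
Implicit Types x y : R[i].

Lemma ReD x y : complex.Re (x + y) = complex.Re x + complex.Re y.
Proof. by case: x; case: y. Qed.
Lemma ImD x y : complex.Im (x + y) = complex.Im x + complex.Im y.
Proof. by case: x; case: y. Qed.
Lemma ReN x : complex.Re (- x) = - complex.Re x.
Proof. by case: x. Qed.
Lemma ImN x : complex.Im (- x) = - complex.Im x.
Proof. by case: x. Qed.
Lemma ReM x y : complex.Re (x * y) =
  complex.Re x * complex.Re y - complex.Im x * complex.Im y.
Proof. by case: x; case: y. Qed.
Lemma ImM x y : complex.Im (x * y) =
  complex.Re x * complex.Im y + complex.Im x * complex.Re y.
Proof. by case: x; case: y. Qed.
Lemma Re_sum (I : Type) (r : seq I) (Q : pred I) (F : I -> R[i]) :
  complex.Re (\sum_(i <- r | Q i) F i) = \sum_(i <- r | Q i) complex.Re (F i).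
Proof. by apply: (big_morph _ ReD). Qed.
Lemma Im_sum (I : Type) (r : seq I) (Q : pred I) (F : I -> R[i]) :
  complex.Im (\sum_(i <- r | Q i) F i) = \sum_(i <- r | Q i) complex.Im (F i).
Proof. by apply: (big_morph _ ImD). Qed.

Lemma ReZ (a : R) x : complex.Re ((a%:C)%C * x) = a * complex.Re x.
Proof. by rewrite ReM /= mul0r subr0. Qed.
Lemma ImZ (a : R) x : complex.Im ((a%:C)%C * x) = a * complex.Im x.
Proof. by rewrite ImM /= mul0r addr0. Qed.

(** Bounding both parts instead of the modulus avoids square roots, and suits the later argument,
    which treats real and imaginary parts separately. *)
Definition cbounded (x : R[i]) (r : R) : Prop :=
  `|complex.Re x| <= r /\ `|complex.Im x| <= r.

Lemma cbounded0 : cbounded 0 0.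
Proof. by split; rewrite /= normr0. Qed.

Lemma cbounded_le x r s : r <= s -> cbounded x r -> cbounded x s.
Proof. by move=> rs [h1 h2]; split; [exact: le_trans h1 _|exact: le_trans h2 _]. Qed.

Lemma cboundedD x y r s : cbounded x r -> cbounded y s -> cbounded (x + y) (r + s).
Proof.
move=> [h1 h2] [h3 h4]; split; rewrite ?ReD ?ImD;
by apply: le_trans (ler_normD _ _) _; apply: lerD.
Qed.

Lemma cboundedN x r : cbounded x r -> cbounded (- x) r.
Proof. by move=> [h1 h2]; split; rewrite ?ReN ?ImN normrN. Qed.

Lemma cboundedB x y r s : cbounded x r -> cbounded y s -> cbounded (x - y) (r + s).
Proof. by move=> hx hy; apply: cboundedD => //; apply: cboundedN. Qed.

Lemma cboundedZ (a : R) x r : 0 <= a -> cbounded x r -> cbounded ((a%:C)%C * x) (a * r).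
Proof.
move=> a0 [h1 h2]; split; rewrite ?ReZ ?ImZ normrM ger0_norm //;
exact: ler_wpM2l.
Qed.

Lemma cbounded_sum (I : Type) (s : seq I) (Q : pred I) (F : I -> R[i]) (B : I -> R) :
  (forall i, Q i -> cbounded (F i) (B i)) ->
  cbounded (\sum_(i <- s | Q i) F i) (\sum_(i <- s | Q i) B i).
Proof.
move=> h; apply: (big_ind2 cbounded) => //; first exact: cbounded0.
by move=> *; apply: cboundedD.
Qed.
End complex_parts.

Section resolvent.
Context {R : realType} {N : nat}.
Implicit Types (A B : 'M[R]_N) (z : R[i]).

Definition cmx {m n} (A : 'M[R]_(m, n)) : 'M[R[i]]_(m, n) :=
  map_mx (fun x : R => (x%:C)%C) A.

Lemma cmxE m n (A : 'M[R]_(m, n)) : cmx A = map_mx (real_complex R) A.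
Proof. by []. Qed.

Definition vnorm2 {m} (w : 'I_m -> R[i]) : R :=
  \sum_i (complex.Re (w i) ^+ 2 + complex.Im (w i) ^+ 2).

Definition resolvent A z := invmx (cmx A - z%:M).

(* Componentwise, [(A - z)^* (A - z) = (A - Re z)^2 + (Im z)^2]. *)
Lemma vnorm2_resolvent A z (w : 'cV[R[i]]_N) : A^T = A ->
  complex.Im z ^+ 2 * vnorm2 (w^~ 0) <= vnorm2 (((cmx A - z%:M) *m w)^~ 0).
Proof.
move=> symA; set x := complex.Re z; set y := complex.Im z.
pose a i := complex.Re (w i 0); pose b i := complex.Im (w i 0).
pose S := A - x%:M.
have symS i j : S i j = S j i.
  by rewrite /S -{1}symA !mxE eq_sym.
pose Sa i := \sum_j S i j * a j; pose Sb i := \sum_j S i j * b j.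
have Eu i : ((cmx A - z%:M) *m w) i 0 = \sum_j ((S i j)%:C%C - (y *i)%C *+ (i == j)) * w j 0.
  rewrite !mxE; apply: eq_bigr => j _; rewrite !mxE; congr (_ * _).
  apply/eqP; rewrite eq_complex; case: (i == j);
  by rewrite ?mulr1n ?mulr0n !ReD !ReN !ImD !ImN /= ?oppr0 ?addr0 ?add0r !eqxx.
have ERe i : complex.Re (((cmx A - z%:M) *m w) i 0) = Sa i + y * b i.
  rewrite Eu Re_sum.
  transitivity (\sum_j (S i j * a j + (y * b j) *+ (i == j))).
    apply: eq_bigr => j _; rewrite ReM /a /b.
    case: (i == j) => /=; case: (w j 0) => p q /=; ring.
  rewrite big_split /=; congr (_ + _).
  rewrite (bigD1 i) //= eqxx mulr1n big1 ?addr0 // => j.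
  by rewrite eq_sym => /negPf ->.
have EIm i : complex.Im (((cmx A - z%:M) *m w) i 0) = Sb i - y * a i.
  rewrite Eu Im_sum.
  transitivity (\sum_j (S i j * b j + (- (y * a j)) *+ (i == j))).
    apply: eq_bigr => j _; rewrite ImM /a /b.
    case: (i == j) => /=; case: (w j 0) => p q /=; ring.
  rewrite big_split /=; congr (_ + _).
  rewrite (bigD1 i) //= eqxx mulr1n big1 ?addr0 // => j.
  by rewrite eq_sym => /negPf ->.
have cross : \sum_i Sa i * b i = \sum_i Sb i * a i.
  rewrite /Sa /Sb; under eq_bigr do rewrite mulr_suml.
  under [RHS]eq_bigr do rewrite mulr_suml.
  rewrite exchange_big /=; apply: eq_bigr => j _; apply: eq_bigr => i _.
  by rewrite symS mulrAC.
rewrite /vnorm2 mulr_sumr -subr_ge0.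
have -> : \sum_i (complex.Re (((cmx A - z%:M) *m w) i 0) ^+ 2 +
    complex.Im (((cmx A - z%:M) *m w) i 0) ^+ 2) =
  \sum_i (Sa i ^+ 2 + Sb i ^+ 2) + \sum_i y ^+ 2 * (a i ^+ 2 + b i ^+ 2)
  + 2 * y * (\sum_i Sa i * b i - \sum_i Sb i * a i).
  rewrite -sumrB mulr_sumr -!big_split /=; apply: eq_bigr => i _.
  rewrite ERe EIm; ring.
rewrite cross subrr mulr0 addr0 addrK; apply: sumr_ge0 => i _.
by rewrite addr_ge0 ?sqr_ge0.
Qed.

Lemma vnorm2_eq0 m (w : 'cV[R[i]]_m) : vnorm2 (w^~ 0) <= 0 -> w = 0.
Proof.
move=> h; apply/colP => i; rewrite mxE.
have p j : 0 <= complex.Re (w j 0) ^+ 2 + complex.Im (w j 0) ^+ 2.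
  by rewrite addr_ge0 ?sqr_ge0.
have : vnorm2 (w^~ 0) == 0.
  by rewrite eq_le h sumr_ge0.
rewrite psumr_eq0 // => /allP /(_ i); rewrite mem_index_enum => /(_ isT).
rewrite paddr_eq0 ?sqr_ge0 // !sqrf_eq0 => hh.
by apply/eqP; rewrite eq_complex.
Qed.

Lemma resolvent_unit A z : A^T = A -> 0 < complex.Im z ->
  cmx A - z%:M \in unitmx.
Proof.
move=> symA y0; rewrite -row_free_unit; apply: inj_row_free => v hv.
have symM : (cmx A - z%:M)^T = cmx A - z%:M.
  by rewrite linearB /= tr_scalar_mx /cmx matrix.map_trmx symA.
have : (cmx A - z%:M) *m v^T = 0 by rewrite -[X in X *m _]symM -trmx_mul hv trmx0.
have := vnorm2_resolvent z v^T symA => /[swap] ->.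
have -> : vnorm2 ((0 : 'cV[R[i]]_N)^~ 0) = 0.
  by rewrite /vnorm2 big1 // => i _; rewrite mxE /= expr0n addr0.
rewrite pmulr_rle0 ?exprn_gt0 // => /vnorm2_eq0 e.
by rewrite -[v]trmxK e trmx0.
Qed.

Lemma vnorm2_resolvent_le A z (u : 'cV[R[i]]_N) : A^T = A -> 0 < complex.Im z ->
  vnorm2 ((resolvent A z *m u)^~ 0) <= complex.Im z ^- 2 * vnorm2 (u^~ 0).
Proof.
move=> symA y0; rewrite -ler_pdivrMl ?invr_gt0 ?exprn_gt0 // invrK.
by have := vnorm2_resolvent z (resolvent A z *m u) symA;
  rewrite mulmxA /resolvent mulmxV ?mul1mx ?resolvent_unit.
Qed.

Lemma vnorm2_cmx m (u : 'cV[R]_m) : vnorm2 ((cmx u)^~ 0) = \sum_i u i 0 ^+ 2.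
Proof. by apply: eq_bigr => i _; rewrite mxE /= expr0n addr0. Qed.

(** Cauchy-Schwarz in its weighted arithmetic-geometric form; the free weight [t] later balances a
    large vector against a small one. *)
Lemma cbounded_dot m (v : 'I_m -> R) (w : 'I_m -> R[i]) (t : R) : 0 < t ->
  cbounded (\sum_i (v i)%:C%C * w i) ((t * \sum_i v i ^+ 2 + t^-1 * vnorm2 w) / 2).
Proof.
move=> t0; rewrite /vnorm2 !mulr_sumr -big_split mulr_suml /=.
have amgm (p q : R) : `|p * q| <= (t * p ^+ 2 + t^-1 * q ^+ 2) / 2.
  have t0' : t != 0 by rewrite gt_eqF.
  have h1 : 0 <= t^-1 * (t * p - q) ^+ 2 by rewrite mulr_ge0 ?sqr_ge0 ?invr_ge0 ?ltW.
  have h2 : 0 <= t^-1 * (t * p + q) ^+ 2 by rewrite mulr_ge0 ?sqr_ge0 ?invr_ge0 ?ltW.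
  have e1 : t^-1 * (t * p - q) ^+ 2 = t * p ^+ 2 + t^-1 * q ^+ 2 - 2 * (p * q).
    by field.
  have e2 : t^-1 * (t * p + q) ^+ 2 = t * p ^+ 2 + t^-1 * q ^+ 2 + 2 * (p * q).
    by field.
  by rewrite ler_norml; apply/andP; split; lra.
apply: cbounded_sum => i _; split; rewrite ?ReZ ?ImZ;
(apply: le_trans (amgm _ _) _; rewrite ler_pM2r ?invr_gt0 // lerD2l ler_pM2l ?invr_gt0 //).
- by rewrite lerDl sqr_ge0.
- by rewrite lerDr sqr_ge0.
Qed.

Lemma cbounded_bilinear A B z (u v : 'cV[R]_N) (s : R) :
  A^T = A -> B^T = B -> 0 < complex.Im z -> 0 < s ->
  cbounded (((cmx v)^T *m (resolvent B z *m (resolvent A z *m cmx u))) 0 0)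
    ((s * \sum_i v i 0 ^+ 2 + s^-1 * \sum_i u i 0 ^+ 2) / (2 * complex.Im z ^+ 2)).
Proof.
move=> symA symB y0 s0; set w := _ *m (_ *m _).
have y2 : 0 < complex.Im z ^+ 2 by rewrite exprn_gt0.
have -> : ((cmx v)^T *m w) 0 0 = \sum_i ((v i 0)%:C)%C * w i 0.
  by rewrite mxE; apply: eq_bigr => i _; congr (_ * _); rewrite !mxE.
(* The two resolvents shrink the squared norm of [u] by [Im z ^ -4]; this weight splits the factor
   evenly, leaving [Im z ^ -2] on both terms. *)
apply: cbounded_le (cbounded_dot (fun i => v i 0) (w^~ 0) (t := s / complex.Im z ^+ 2) _).
  have hw : vnorm2 (w^~ 0) <= complex.Im z ^- 2 * (complex.Im z ^- 2 * \sum_i u i 0 ^+ 2).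
    apply: le_trans (vnorm2_resolvent_le _ symB y0) _.
    rewrite ler_wpM2l ?invr_ge0 ?(ltW y2) // -(vnorm2_cmx u).
    exact: vnorm2_resolvent_le.
  move: hw y2; move: (complex.Im z ^+ 2) (vnorm2 (w^~ 0)) => y W hw y2.
  move: hw; move: (\sum_i v i 0 ^+ 2) (\sum_i u i 0 ^+ 2) => a b hw.
  have yne : y != 0 by rewrite gt_eqF.
  have sne : s != 0 by rewrite gt_eqF.
  have -> : (s * a + s^-1 * b) / (2 * y) = (s / y * a + (s / y)^-1 * (y^-1 * (y^-1 * b))) / 2.
    by field; rewrite yne sne.
  by rewrite ler_pM2r ?invr_gt0 // lerD2l ler_pM2l // invr_gt0 divr_gt0.
by rewrite divr_gt0.
Qed.

Lemma resolvent_diff A B z : A^T = A -> B^T = B -> 0 < complex.Im z ->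
  resolvent A z - resolvent B z = resolvent A z *m (cmx B - cmx A) *m resolvent B z.
Proof.
move=> symA symB y0.
have -> : cmx B - cmx A = (cmx B - z%:M) - (cmx A - z%:M) by rewrite opprB addrA subrK.
rewrite mulmxBr mulmxBl mulVmx ?resolvent_unit // mul1mx -mulmxA mulmxV ?resolvent_unit //.
by rewrite mulmx1.
Qed.

(** Each diagonal entry is at most the norm of its column, which is the resolvent applied to a basis
    vector. *)
Lemma cbounded_mxtrace_resolvent A z : A^T = A -> 0 < complex.Im z ->
  cbounded (\tr (resolvent A z)) (N%:R / complex.Im z).
Proof.
move=> symA y0.
have -> : N%:R / complex.Im z = \sum_(i < N) (complex.Im z)^-1.
  by rewrite sumr_const card_ord mulr_natl.
apply: cbounded_sum => i _.
have : vnorm2 ((resolvent A z *m cmx (delta_mx i 0 : 'cV[R]_N))^~ 0) <= complex.Im z ^- 2.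
  apply: le_trans (vnorm2_resolvent_le _ symA y0) _.
  rewrite vnorm2_cmx (bigD1 i) //= big1 ?mxE ?eqxx ?addr0 ?expr1n ?mulr1 // => j ji.
  by rewrite mxE (negPf ji) expr0n.
have -> : resolvent A z *m cmx (delta_mx i 0 : 'cV[R]_N) = col i (resolvent A z).
  rewrite cmxE map_delta_mx; apply/colP => k; rewrite !mxE (bigD1 i) //= big1.
    by rewrite !mxE !eqxx mulr1 addr0.
  by move=> j ji; rewrite !mxE (negPf ji) mulr0.
rewrite /vnorm2 (bigD1 i) //= !mxE => h.
have {}h : complex.Re (resolvent A z i i) ^+ 2 + complex.Im (resolvent A z i i) ^+ 2
   <= (complex.Im z)^-1 ^+ 2.
  rewrite exprVn; apply: le_trans h; rewrite lerDl.
  by apply: sumr_ge0 => j _; rewrite addr_ge0 ?sqr_ge0.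
split; rewrite -ler_sqr ?nnegrE ?invr_ge0 ?(ltW y0) // real_normK ?num_real //;
apply: le_trans h; by rewrite ?lerDl ?lerDr sqr_ge0.
Qed.
End resolvent.

(** * Perturbation of the Stieltjes transform of a Gram matrix *)

Section stieltjes_gram.
Context {R : realType}.
Implicit Types (z : R[i]).

Definition gram {N n} (X : 'M[R]_(N, n)) : 'M[R]_N := n%:R^-1 *: (X *m X^T).

Lemma gram_sym N n (X : 'M[R]_(N, n)) : (gram X)^T = gram X.
Proof. by rewrite /gram linearZ /= trmx_mul trmxK. Qed.

Lemma natC (n : nat) : n%:R = ((n%:R : R)%:C)%C :> R[i].
Proof. by rewrite -(rmorph_nat (real_complex R)). Qed.

Lemma stieltjes_bounded N n (X : 'M[R]_(N, n)) z : (0 < N)%N -> 0 < complex.Im z ->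
  cbounded (stieltjes (gram X) z) (complex.Im z)^-1.
Proof.
move=> N0 y0; rewrite /stieltjes natC -fmorphV /=.
have := cbounded_mxtrace_resolvent (gram_sym X) y0.
move=> /(@cboundedZ _ (N%:R^-1) _ _); rewrite invr_ge0 ler0n => /(_ isT).
by rewrite mulrA mulVf ?mul1r ?pnatr_eq0 -?lt0n.
Qed.

(** The resolvent identity and cyclicity of the trace reduce the difference to quadratic forms of
    the single columns in one common matrix [Q]. Equal columns cancel exactly, and close columns
    nearly cancel; these are the two bounds drawn from it below. *)
Lemma mxtrace_resolvent_gram_diff N n (X Y : 'M[R]_(N, n)) z : 0 < complex.Im z ->
  let Q := resolvent (gram Y) z *m resolvent (gram X) z in
  \tr (resolvent (gram X) z) - \tr (resolvent (gram Y) z) =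
  ((n%:R^-1 : R)%:C)%C * \sum_j (((cmx (col j Y))^T *m (Q *m cmx (col j Y))) 0 0
                        - ((cmx (col j X))^T *m (Q *m cmx (col j X))) 0 0).
Proof.
move=> y0 Q; rewrite -linearB /= resolvent_diff ?gram_sym //.
rewrite mxtrace_mulC mulmxA.
have -> : cmx (gram Y) - cmx (gram X) =
    ((n%:R^-1 : R)%:C)%C *: (cmx Y *m (cmx Y)^T - cmx X *m (cmx X)^T).
  rewrite !cmxE /gram !map_mxZ !map_mxM -!matrix.map_trmx -scalerBr /=.
  by [].
rewrite -scalemxAr linearZ /= -/Q; congr (_ * _).
rewrite mulmxBr linearB /= !mulmxA.
rewrite (mxtrace_mulC (Q *m cmx Y)) (mxtrace_mulC (Q *m cmx X)).
rewrite /mxtrace -sumrB; apply: eq_bigr => j _.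
have E (Z : 'M[R]_(N, n)) : ((cmx Z)^T *m (Q *m cmx Z)) j j =
   ((cmx (col j Z))^T *m (Q *m cmx (col j Z))) 0 0.
  rewrite [LHS]mxE [RHS]mxE; apply: eq_bigr => i _; congr (_ * _).
    by rewrite !mxE.
  by rewrite !mxE; apply: eq_bigr => k _; rewrite !mxE.
by rewrite !E.
Qed.

Lemma stieltjes_diff_bound N n (X Y : 'M[R]_(N, n)) z (b : 'I_n -> R) :
  0 < complex.Im z ->
  let Q := resolvent (gram Y) z *m resolvent (gram X) z in
  (forall j, cbounded (((cmx (col j Y))^T *m (Q *m cmx (col j Y))) 0 0
                        - ((cmx (col j X))^T *m (Q *m cmx (col j X))) 0 0) (b j)) ->
  cbounded (stieltjes (gram X) z - stieltjes (gram Y) z) ((N%:R * n%:R)^-1 * \sum_j b j).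
Proof.
move=> y0 Q h; rewrite /stieltjes -mulrBr natC -fmorphV /=.
have := mxtrace_resolvent_gram_diff X Y y0 => /= E.
rewrite [X in _ * X]E invfM -mulrA.
apply: cboundedZ; first by rewrite invr_ge0 ler0n.
apply: cboundedZ; first by rewrite invr_ge0 ler0n.
exact: cbounded_sum.
Qed.

Lemma stieltjes_change_columns N n (X Y : 'M[R]_(N, n)) z (J : pred 'I_n) :
  0 < complex.Im z -> (forall i j, ~~ J j -> X i j = Y i j) ->
  cbounded (stieltjes (gram X) z - stieltjes (gram Y) z)
    ((N%:R * n%:R)^-1 * \sum_(j | J j) (\sum_i (X i j ^+ 2 + Y i j ^+ 2)) / complex.Im z ^+ 2).
Proof.
move=> y0 h; rewrite big_mkcond; apply: stieltjes_diff_bound => // j.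
case: ifPn => [_|nJ]; last first.
  have -> : col j X = col j Y by apply/colP => i; rewrite !mxE h.
  by rewrite subrr; exact: cbounded0.
have E (Z : 'M[R]_(N, n)) : cbounded (((cmx (col j Z))^T *m
   (resolvent (gram Y) z *m resolvent (gram X) z *m cmx (col j Z))) 0 0)
   ((\sum_i Z i j ^+ 2) / complex.Im z ^+ 2).
  rewrite -(mulmxA (resolvent _ _)).
  apply: cbounded_le (cbounded_bilinear (col j Z) (col j Z) _ _ y0 ltr01);
    rewrite ?gram_sym //.
  under eq_bigr do rewrite mxE.
  have e (a y : R) : (a + a) / (2 * y) = a / y.
    by rewrite -[a + a]mulr2n -(mulr_natl a 2) invfM mulrACA divff ?pnatr_eq0 // mul1r.
  by rewrite invr1 !mul1r e.
rewrite big_split /= addrC mulrDl.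
by apply: cboundedB; apply: E.
Qed.

Lemma stieltjes_lipschitz N n (X Y : 'M[R]_(N, n)) z (s : R) :
  0 < complex.Im z -> 0 < s <= 1 ->
  cbounded (stieltjes (gram X) z - stieltjes (gram Y) z)
    (2 * complex.Im z ^- 2 * (s * ((N%:R * n%:R)^-1 * \sum_j \sum_i X i j ^+ 2) +
      s^-1 * ((N%:R * n%:R)^-1 * \sum_j \sum_i (X i j - Y i j) ^+ 2))).
Proof.
move=> y0 /andP[s0 s1].
(* The norm of [Y] will be bounded through those of [X] and [X - Y]; this inequality absorbs the
   resulting term in [s |X - Y|^2] into the one in [s^-1 |X - Y|^2]. *)
have sV : s <= s^-1 by rewrite (le_trans s1) // invf_ge1.
set k := (N%:R * n%:R)^-1.
have -> : 2 * complex.Im z ^- 2 * (s * (k * \sum_j \sum_i X i j ^+ 2) +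
      s^-1 * (k * \sum_j \sum_i (X i j - Y i j) ^+ 2)) =
  k * \sum_j (2 * complex.Im z ^- 2 * (s * \sum_i X i j ^+ 2 +
      s^-1 * \sum_i (X i j - Y i j) ^+ 2)).
  rewrite -mulr_sumr big_split /= -!mulr_sumr; ring.
apply: stieltjes_diff_bound => // j.
set x := col j X; set y := col j Y; set Q := resolvent _ _ *m resolvent _ _.
(* Polarization: each bilinear term contains [y - x] once. In both, the weight [s] is put on the
   full column and [s^-1] on the difference. *)
have -> : ((cmx y)^T *m (Q *m cmx y)) 0 0 - ((cmx x)^T *m (Q *m cmx x)) 0 0 =
   ((cmx y)^T *m (Q *m cmx (y - x))) 0 0 + ((cmx (y - x))^T *m (Q *m cmx x)) 0 0.
  have -> : cmx (y - x) = cmx y - cmx x by rewrite !cmxE map_mxB.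
  rewrite [(cmx y - cmx x)^T]linearB /= !mulmxBr mulmxBl.
  move: ((cmx y)^T *m (Q *m cmx y)) ((cmx y)^T *m (Q *m cmx x)) => a b.
  move: ((cmx x)^T *m (Q *m cmx x)) => c.
  rewrite [(a - b) 0 0]mxE [(- b) 0 0]mxE [(b - c) 0 0]mxE [(- c) 0 0]mxE.
  by rewrite addrA subrK.
have := cbounded_bilinear (y - x) y (gram_sym X) (gram_sym Y) y0 s0.
have sV0 : 0 < s^-1 by rewrite invr_gt0.
have := cbounded_bilinear x (y - x) (gram_sym X) (gram_sym Y) y0 sV0.
rewrite invrK !(mulmxA (resolvent (gram Y) z)) -/Q => h1 h2.
apply: cbounded_le (cboundedD h2 h1).
have -> : \sum_i (y - x) i 0 ^+ 2 = \sum_i (X i j - Y i j) ^+ 2.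
  by apply: eq_bigr => i _; rewrite !mxE -sqrrN opprB.
have -> : \sum_i y i 0 ^+ 2 = \sum_i Y i j ^+ 2 by apply: eq_bigr => i _; rewrite mxE.
have -> : \sum_i x i 0 ^+ 2 = \sum_i X i j ^+ 2 by apply: eq_bigr => i _; rewrite mxE.
have hY : \sum_i Y i j ^+ 2 <= 2 * (\sum_i X i j ^+ 2) + 2 * (\sum_i (X i j - Y i j) ^+ 2).
  rewrite !mulr_sumr -big_split /=; apply: ler_sum => i _.
  have := sqr_ge0 (2 * X i j - Y i j); nra.
have hd : 0 <= \sum_i (X i j - Y i j) ^+ 2 by apply: sumr_ge0 => i _; exact: sqr_ge0.
have hx : 0 <= \sum_i (X i j) ^+ 2 by apply: sumr_ge0 => i _; exact: sqr_ge0.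
have y2 : 0 < complex.Im z ^+ 2 by rewrite exprn_gt0.
move: hY hd hx y2 sV s0 sV0; clear.
move: (\sum_i Y i j ^+ 2) (\sum_i X i j ^+ 2) (\sum_i (X i j - Y i j) ^+ 2) => a c b.
move: (complex.Im z ^+ 2) s^-1 => w t hY hd hx w0 st s0 t0.
have h3 : s * a <= s * (2 * c + 2 * b) by rewrite ler_pM2l.
have h4 : s * b <= t * b by rewrite ler_wpM2r.
have h5 : 0 <= s * c by rewrite mulr_ge0 // ltW.
rewrite -mulrDl ler_pdivrMr ?mulr_gt0 //.
have -> : 2 / w * (s * c + t * b) * (2 * w) = 4 * (s * c + t * b).
  by field; rewrite gt_eqF.
lra.
Qed.
End stieltjes_gram.

(** * Concentration for weakly dependent blocks *)

Section mcdiarmid.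
Context {R : realType} {G : finType}.
Variable pi : nat -> G -> R.
Hypothesis pi_ge0 : forall k a, 0 <= pi k a.
Hypothesis pi_sum1 : forall k, \sum_a pi k a = 1.

(* Expectation of [F] under the product law of [k] independent letters. *)
Fixpoint prodmean (k : nat) (F : seq G -> R) : R :=
  if k is k'.+1 then prodmean k' (fun s => \sum_a pi k' a * F (rcons s a))
  else F [::].

Lemma prodmean_le k F F' : (forall s, size s = k -> F s <= F' s) ->
  prodmean k F <= prodmean k F'.
Proof.
elim: k F F' => [|k IH] F F' h /=; first exact: h.
apply: IH => s sk; apply: ler_sum => a _; apply: ler_wpM2l => //.
by apply: h; rewrite size_rcons sk.
Qed.

Lemma eq_prodmean k F F' : (forall s, size s = k -> F s = F' s) ->
  prodmean k F = prodmean k F'.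
Proof.
move=> h; apply/eqP; rewrite eq_le; apply/andP; split;
by apply: prodmean_le => s sk; rewrite h.
Qed.

Lemma prodmeanZ k c F : prodmean k (fun s => c * F s) = c * prodmean k F.
Proof.
elim: k F => [//|k IH] F /=; rewrite -IH; apply: eq_prodmean => s _.
by rewrite mulr_sumr; apply: eq_bigr => a _; rewrite mulrCA.
Qed.

Lemma prodmeanD k F F' :
  prodmean k (fun s => F s + F' s) = prodmean k F + prodmean k F'.
Proof.
elim: k F F' => [//|k IH] F F' /=; rewrite -IH; apply: eq_prodmean => s _.
by rewrite -big_split; apply: eq_bigr => a _; rewrite mulrDr.
Qed.

(** From [1 - x <= expR (- x)] one gets [expR x * (1 - x) <= 1], while the quadratic times [1 - x]
    is [1 + x ^ 2 * (1 - 2 * x)]. *)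
Lemma expR_le_quadratic (x : R) : x <= 2^-1 -> expR x <= 1 + x + 2 * x ^+ 2.
Proof.
move=> hx; have h := expR_ge1Dx (- x).
have x1 : 0 < 1 - x by lra.
have : expR x * (1 - x) <= 1.
  rewrite -[leRHS](expRxMexpNx_1 x) ler_wpM2l ?expR_ge0 //.
move=> h'; rewrite -(ler_pM2r x1); apply: le_trans h' _.
have -> : (1 + x + 2 * x ^+ 2) * (1 - x) = 1 + x ^+ 2 * (1 - 2 * x) by ring.
by rewrite lerDl mulr_ge0 ?sqr_ge0 //; lra.
Qed.

Definition bounded_differences k (F : seq G -> R) (c : R) :=
  forall s1 a b s2, (size s1 + size s2).+1 = k ->
    `|F (s1 ++ a :: s2) - F (s1 ++ b :: s2)| <= c.

(** The martingale argument, revealing letters one at a time. The mean [F'] of [F] over the last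
    letter has the same bounded differences, and given the other letters [F - F'] is centred and at
    most [c] in absolute value, so that it contributes one factor [expR (2 * l ^ 2 * c ^ 2)]. *)
Lemma prodmean_laplace k F (c l : R) : 0 <= l -> 0 <= c -> l * c <= 2^-1 ->
  bounded_differences k F c ->
  prodmean k (fun s => expR (l * (F s - prodmean k F))) <=
  expR (k%:R * (2 * l ^+ 2 * c ^+ 2)).
Proof.
move=> l0 c0 lc; elim: k F => [|k IH] F bF.
  by rewrite /= subrr mulr0 mul0r.
pose F' s := \sum_a pi k a * F (rcons s a).
have bF' : bounded_differences k F' c.
  move=> s1 a b s2 hs; rewrite /F' -sumrB.
  have : `|\sum_x (pi k x * F (rcons (s1 ++ a :: s2) x) -
                    pi k x * F (rcons (s1 ++ b :: s2) x))| <= \sum_x pi k x * c.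
    apply: le_trans (ler_norm_sum _ _ _) _; apply: ler_sum => x _.
    rewrite -mulrBr normrM (ger0_norm (pi_ge0 _ _)); apply: ler_wpM2l => //.
    by rewrite !rcons_cat /=; apply: bF; rewrite size_rcons addnS hs.
  by rewrite -mulr_suml pi_sum1 mul1r.
have inner s : size s = k ->
  \sum_a pi k a * expR (l * (F (rcons s a) - F' s)) <= expR (2 * l ^+ 2 * c ^+ 2).
  move=> sk; apply: (@le_trans _ _ (1 + 2 * l ^+ 2 * c ^+ 2)); last exact: expR_ge1Dx.
  have bd a : `|F (rcons s a) - F' s| <= c.
    have -> : F (rcons s a) - F' s = \sum_x pi k x * (F (rcons s a) - F (rcons s x)).
      under [RHS]eq_bigr do rewrite mulrBr.
      by rewrite sumrB -mulr_suml pi_sum1 mul1r.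
    apply: le_trans (ler_norm_sum _ _ _) _.
    apply: (@le_trans _ _ (\sum_x pi k x * c)); last by rewrite -mulr_suml pi_sum1 mul1r.
    apply: ler_sum => x _; rewrite normrM (ger0_norm (pi_ge0 _ _)).
    apply: ler_wpM2l => //; rewrite -!cats1; apply: bF.
    by rewrite sk addn0.
  have m0 : \sum_a pi k a * (F (rcons s a) - F' s) = 0.
    under eq_bigr do rewrite mulrBr.
    by rewrite sumrB -mulr_suml pi_sum1 mul1r subrr.
  apply: (@le_trans _ _ (\sum_a pi k a * (1 + l * (F (rcons s a) - F' s) + 2 * l ^+ 2 * c ^+ 2))).
    apply: ler_sum => a _; apply: ler_wpM2l => //.
    have b1 : F (rcons s a) - F' s <= c by apply: le_trans (bd a); exact: ler_norm.
    apply: le_trans (expR_le_quadratic _) _.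
      by apply: le_trans lc; apply: ler_wpM2l.
    rewrite lerD2l -mulrA ler_pM2l // exprMn; apply: ler_wpM2l; first exact: sqr_ge0.
    by rewrite -real_normK ?num_real //; apply: lerXn2r; rewrite ?nnegrE.
  have E (p x q : R) : p * (1 + l * x + q) = p + l * (p * x) + p * q by ring.
  under eq_bigr do rewrite E.
  by rewrite !big_split /= -mulr_sumr m0 mulr0 addr0 -mulr_suml pi_sum1 mul1r.
have -> : prodmean k.+1 F = prodmean k F' by [].
rewrite /=.
apply: (@le_trans _ _ (prodmean k (fun s => expR (2 * l ^+ 2 * c ^+ 2) *
   expR (l * (F' s - prodmean k F'))))).
  apply: prodmean_le => s sk.
  have E a : pi k a * expR (l * (F (rcons s a) - prodmean k F')) =
     expR (l * (F' s - prodmean k F')) * (pi k a * expR (l * (F (rcons s a) - F' s))).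
    rewrite mulrCA -expRD; congr (_ * expR _); ring.
  under eq_bigr do rewrite E.
  by rewrite -mulr_sumr mulrC ler_wpM2r ?expR_ge0 // inner.
rewrite prodmeanZ; apply: le_trans (ler_wpM2l (expR_ge0 _) (IH F' bF')) _.
by rewrite -expRD ler_expR -[k.+1%:R]natr1 [(k%:R + 1) * _]mulrDl mul1r addrC.
Qed.

Lemma prodmean_tail k F (c l e : R) : 0 <= l -> 0 <= c -> l * c <= 2^-1 ->
  bounded_differences k F c ->
  prodmean k (fun s => (e <= `|F s - prodmean k F|)%R%:R) <=
  2 * expR (k%:R * (2 * l ^+ 2 * c ^+ 2) - l * e).
Proof.
move=> l0 c0 lc bF.
have h1 := prodmean_laplace l0 c0 lc bF.
have bN : bounded_differences k (fun s => (-1) * F s) c.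
  by move=> s1 a b s2 hs; rewrite -mulrBr normrM normrN normr1 mul1r; exact: bF.
have h2 := prodmean_laplace l0 c0 lc bN.
apply: (@le_trans _ _ (prodmean k (fun s => expR (- (l * e)) *
   (expR (l * (F s - prodmean k F)) +
    expR (l * (-1 * F s - prodmean k (fun s => -1 * F s))))))).
  apply: prodmean_le => s _; rewrite prodmeanZ.
  case: (leP e) => [|_]; last by rewrite mulr_ge0 ?addr_ge0 ?expR_ge0.
  rewrite mulrDr -!expRD ler_normr => /orP[] h.
    apply: (@le_trans _ _ (expR (- (l * e) + l * (F s - prodmean k F)))).
      by rewrite -expR0 ler_expR addrC subr_ge0 ler_wpM2l.
    by rewrite lerDl expR_ge0.
  apply: (@le_trans _ _ (expR (- (l * e) + l * (-1 * F s - -1 * prodmean k F)))).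
    have -> : - (l * e) + l * (-1 * F s - -1 * prodmean k F) = l * (- (F s - prodmean k F) - e).
      by ring.
    by rewrite -expR0 ler_expR mulr_ge0 // subr_ge0.
  by rewrite lerDr expR_ge0.
rewrite prodmeanZ prodmeanD [X in _ <= 2 * expR X]addrC expRD [leRHS]mulrCA.
apply: ler_wpM2l; first exact: expR_ge0.
by have := lerD h1 h2; lra.
Qed.
End mcdiarmid.

(** * Finite-valued maps, decoupling by mixing, and concentration for blocks *)

Section finite_valued.
Context {d : measure_display} {T : measurableType d} {R : realType}.
Variable P : probability T R.

Lemma Rintegral_probability_cst (r : R) : \int[P]_w r = r.
Proof.
rewrite Rintegral_cst //; transitivity (r * 1); last by rewrite mulr1.
congr (_ * _); exact: (congr1 fine (probability_setT P)).
Qed.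

Definition prb (A : set T) : R := fine (P A).

Lemma prb_ge0 A : 0 <= prb A.
Proof. by rewrite fine_ge0. Qed.

Lemma prbK A : measurable A -> (prb A)%:E = P A.
Proof. by move=> mA; rewrite fineK // fin_num_measure. Qed.

Lemma prb_le A B : measurable A -> measurable B -> A `<=` B -> prb A <= prb B.
Proof.
move=> mA mB AB; apply: fine_le; rewrite ?fin_num_measure //.
by apply: le_measure; rewrite ?inE.
Qed.

Lemma integrable_bounded (f : T -> R) (M : R) : measurable_fun setT f ->
  (forall w, `|f w| <= M) -> P.-integrable setT (EFin \o f).
Proof.
move=> mf bf; apply: measurable_bounded_integrable => //.
  by rewrite (le_lt_trans (probability_le1 P _)) // ltry.
exists M; split; first exact: num_real.
by move=> x Mx w _; apply: le_trans (bf w) (ltW Mx).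
Qed.

Lemma integrable_scale (k : R) (f : T -> R) : P.-integrable setT (EFin \o f) ->
  P.-integrable setT (EFin \o (fun w => k * f w)).
Proof.
move=> h; have -> : EFin \o (fun w => k * f w) = (fun w => (k%:E * (EFin \o f) w)%E).
  by apply/funext => w /=; rewrite EFinM.
exact: integrableZl.
Qed.

Lemma integrable_add (f g : T -> R) : P.-integrable setT (EFin \o f) ->
  P.-integrable setT (EFin \o g) -> P.-integrable setT (EFin \o (fun w => f w + g w)).
Proof. by move=> h1 h2; have := integrableD measurableT h1 h2. Qed.

Lemma integrable_bigsum (I : Type) (s : seq I) (f : I -> T -> R) :
  (forall i, P.-integrable setT (EFin \o f i)) ->
  P.-integrable setT (EFin \o (fun w => \sum_(i <- s) f i w)).
Proof.
move=> h; have -> : EFin \o (fun w => \sum_(i <- s) f i w) =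
          (fun w => (\sum_(i <- s) (EFin \o f i) w)%E).
  by apply/funext => w /=; rewrite sumEFin.
exact: integrable_sum.
Qed.

(** Measurability of a map into a finite type, in the form in which the sigma-algebras of past and
    future provide it. *)
Definition fibers_measurable {H : finType} (Z : T -> H) :=
  forall h, measurable (Z @^-1` [set h]).

Lemma finite_valuedE {H : finType} (Z : T -> H) (phi : H -> R) w :
  phi (Z w) = \sum_h phi h * \1_(Z @^-1` [set h]) w.
Proof.
rewrite (bigD1 (Z w)) //= big1.
  by rewrite indicE mem_set // mulr1 addr0.
move=> h hZ; rewrite indicE memNset ?mulr0 //= => e.
by rewrite e eqxx in hZ.
Qed.

Lemma measurable_finite_valued {H : finType} (Z : T -> H) (phi : H -> R) :
  fibers_measurable Z -> measurable_fun setT (fun w => phi (Z w)).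
Proof.
move=> mZ; under eq_fun do rewrite finite_valuedE.
apply: measurable_sum => h; apply: measurable_funM => //.
Qed.

Lemma finite_bounded {H : finType} (phi : H -> R) : exists M, forall h, `|phi h| <= M.
Proof.
exists (\sum_h `|phi h|) => h.
by rewrite (bigD1 h) //= lerDl sumr_ge0.
Qed.

Lemma integrable_finite_valued {H : finType} (Z : T -> H) (phi : H -> R) :
  fibers_measurable Z -> P.-integrable setT (EFin \o (fun w => phi (Z w))).
Proof.
move=> mZ; have [M hM] := finite_bounded phi.
apply: (integrable_bounded (M := M)); first exact: measurable_finite_valued.
by move=> w; apply: hM.
Qed.

Lemma Rintegral_sum (I : Type) (s : seq I) (f : I -> T -> R) :
  (forall i, P.-integrable setT (EFin \o f i)) ->
  \int[P]_w (\sum_(i <- s) f i w) = \sum_(i <- s) \int[P]_w f i w.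
Proof.
move=> h; elim: s => [|i s IH].
  rewrite big_nil; under eq_Rintegral do rewrite big_nil.
  by rewrite Rintegral_probability_cst.
rewrite big_cons; under eq_Rintegral do rewrite big_cons.
rewrite RintegralD // ?IH //; exact: integrable_bigsum.
Qed.

Lemma mean_finite_valued {H : finType} (Z : T -> H) (phi : H -> R) :
  fibers_measurable Z ->
  \int[P]_w phi (Z w) = \sum_h phi h * prb (Z @^-1` [set h]).
Proof.
move=> mZ; under eq_Rintegral do rewrite finite_valuedE.
have ii h : P.-integrable setT (EFin \o \1_(Z @^-1` [set h])).
  exact: integrable_indic.
rewrite Rintegral_sum.
  apply: eq_bigr => h _; rewrite RintegralZl //; congr (_ * _).
  by rewrite /Rintegral integral_indic // setIT.
move=> h; apply: (integrable_bounded (M := `|phi h|)).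
  by apply: measurable_funM.
move=> w; rewrite normrM indicE; case: (_ \in _); rewrite ?normr1 ?normr0 ?mulr1 //.
by rewrite mulr0.
Qed.

Lemma sum_prb_fibers {H : finType} (Z : T -> H) : fibers_measurable Z ->
  \sum_h prb (Z @^-1` [set h]) = 1.
Proof.
move=> mZ; have := mean_finite_valued (fun=> 1) mZ.
rewrite Rintegral_probability_cst => ->.
by apply: eq_bigr => h _; rewrite mul1r.
Qed.

Lemma measurable_finite_event {H : finType} (Z : T -> H) (q : pred H) :
  fibers_measurable Z -> measurable [set w | q (Z w)].
Proof.
move=> mZ; have := measurable_finite_valued (fun h => (q h)%:R) mZ.
move=> /(_ measurableT [set 1]); rewrite setTI.
have -> : (fun x : T => (q (Z x))%:R) @^-1` [set 1 : R] = [set w | q (Z w)].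
  apply/seteqP; split => w /=; case: (q _) => // /eqP.
  by rewrite eq_sym oner_eq0.
by apply.
Qed.

Lemma prb_finite_valued {H : finType} (Z : T -> H) (q : pred H) :
  fibers_measurable Z ->
  prb [set w | q (Z w)] = \int[P]_w (q (Z w))%:R.
Proof.
move=> mZ.
have mq := measurable_finite_event q mZ.
rewrite /prb /Rintegral; congr fine.
transitivity (\int[P]_w (\1_[set w | q (Z w)] w)%:E)%E.
  by rewrite integral_indic // setIT.
by apply: eq_integral => w _; rewrite indicE mem_setE.
Qed.

(* The partitions into fibres turn the [beta] coefficient into a total variation bound. *)
Lemma beta_coef_fibers (F1 F2 : set (set T)) (H G : finType) (Z : T -> H) (Y : T -> G) (b : R) :
  (forall h, F1 (Z @^-1` [set h])) -> (forall a, F2 (Y @^-1` [set a])) ->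
  (beta_coef P F1 F2 <= b%:E)%E ->
  \sum_h \sum_a `|prb (Z @^-1` [set h] `&` Y @^-1` [set a]) -
      prb (Z @^-1` [set h]) * prb (Y @^-1` [set a])| <= 2 * b.
Proof.
move=> hZ hY; rewrite /beta_coef; set S := ereal_sup _ => hb.
have part (K : finType) (X : T -> K) (FF : set (set T)) :
   (forall k, FF (X @^-1` [set k])) ->
   finite_partition FF (fun i : 'I_#|K| => X @^-1` [set enum_val i]).
  move=> h; split; first by move=> i; exact: h.
  split; first by apply/seteqP; split => // w _; exists (enum_rank (X w)); rewrite //= enum_rankK.
  move=> i j ij; apply/seteqP; split => // w [/= e1 e2].
  by move/negP: ij; apply; apply/eqP; apply: enum_val_inj; rewrite -e1 -e2.
set s := \sum_h _.
have sS : (s%:E <= S)%E.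
  apply: ereal_sup_ubound => /=.
  exists #|H|, #|G|, (fun i => Z @^-1` [set enum_val i]), (fun i => Y @^-1` [set enum_val i]).
  split; [exact: part|exact: part|congr EFin].
  rewrite /s (reindex (@enum_val H predT)) /=; last first.
    exact/onW_bij/enum_val_bij.
  rewrite big_mkcond /=; apply: eq_bigr => i _.
  rewrite (reindex (@enum_val G predT)) /=; last exact/onW_bij/enum_val_bij.
  by rewrite big_mkcond.
have : ((2^-1 * s)%:E <= b%:E)%E.
  by apply: le_trans hb; rewrite EFinM lee_wpmul2l // lee_fin invr_ge0.
by rewrite lee_fin; lra.
Qed.

(** Both expectations integrate [Phi], one against the joint law and one against the product of the
    marginals. These laws are at distance at most [2 * b] in total mass, the 2 undoing the factor
    one half in the definition of [beta]. *)
Lemma decoupling (F1 F2 : set (set T)) (H G : finType) (Z : T -> H) (Y : T -> G)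
    (b M : R) (Phi : H -> G -> R) :
  F1 `<=` measurable -> F2 `<=` measurable ->
  (forall h, F1 (Z @^-1` [set h])) -> (forall a, F2 (Y @^-1` [set a])) ->
  (beta_coef P F1 F2 <= b%:E)%E -> (forall h a, `|Phi h a| <= M) -> 0 <= M ->
  `|\int[P]_w Phi (Z w) (Y w) -
    \sum_a prb (Y @^-1` [set a]) * \int[P]_w Phi (Z w) a| <= 2 * b * M.
Proof.
move=> m1 m2 hZ hY hb hM M0.
have mZ : fibers_measurable Z by move=> h; apply: m1.
have mY : fibers_measurable Y by move=> h; apply: m2.
have mZY : fibers_measurable (fun w => (Z w, Y w)).
  move=> [h a]; have -> : (fun w => (Z w, Y w)) @^-1` [set (h, a)] =
    Z @^-1` [set h] `&` Y @^-1` [set a].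
    by apply/seteqP; split => w /= [<- <-].
  exact: measurableI.
rewrite (mean_finite_valued (fun p => Phi p.1 p.2) mZY).
have -> : \sum_p Phi p.1 p.2 * prb ((fun w => (Z w, Y w)) @^-1` [set p]) =
   \sum_h \sum_a Phi h a * prb (Z @^-1` [set h] `&` Y @^-1` [set a]).
  rewrite pair_bigA /=; apply: eq_bigr => -[h a] _ /=; congr (_ * prb _).
  by apply/seteqP; split => w /= [<- <-].
have -> : \sum_a prb (Y @^-1` [set a]) * \int[P]_w Phi (Z w) a =
  \sum_h \sum_a Phi h a * (prb (Z @^-1` [set h]) * prb (Y @^-1` [set a])).
  rewrite exchange_big /=; apply: eq_bigr => a _.
  rewrite (mean_finite_valued (Phi^~ a) mZ) mulr_sumr; apply: eq_bigr => h _.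
  by rewrite mulrC mulrA.
rewrite -sumrB; apply: (@le_trans _ _ (\sum_h \sum_a M * `|prb (Z @^-1` [set h] `&` Y @^-1` [set a]) -
      prb (Z @^-1` [set h]) * prb (Y @^-1` [set a])|)).
  apply: le_trans (ler_norm_sum _ _ _) _; apply: ler_sum => h _.
  rewrite -sumrB; apply: le_trans (ler_norm_sum _ _ _) _; apply: ler_sum => a _.
  by rewrite -mulrBr normrM; apply: ler_wpM2r.
under eq_bigr do rewrite -mulr_sumr.
rewrite -mulr_sumr [leRHS]mulrC; apply: ler_wpM2l => //.
exact: beta_coef_fibers hb.
Qed.

Section blocks.
Context {G : finType}.
Variables (Y : nat -> T -> G) (K : nat) (b : R).
Variables (past : nat -> set (set T)) (future : nat -> set (set T)).
Hypothesis past_measurable : forall k, past k `<=` measurable.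
Hypothesis future_measurable : forall k, future k `<=` measurable.
Hypothesis past_fibers : forall k, (k < K)%N ->
  forall s : k.-tuple G, past k [set w | mkseq (Y^~ w) k = s].
Hypothesis future_fibers : forall k, forall a, future k (Y k @^-1` [set a]).
Hypothesis beta_le : forall k, (k < K)%N ->
  (beta_coef P (past k) (future k) <= b%:E)%E.

Let pi k a := prb (Y k @^-1` [set a]).

Let mY k : fibers_measurable (Y k).
Proof. by move=> a; apply: (future_measurable (k := k)). Qed.

Let pi_ge0 k a : 0 <= pi k a. Proof. exact: prb_ge0. Qed.
Let pi_sum1 k : \sum_a pi k a = 1. Proof. exact: sum_prb_fibers. Qed.

Let hist k w : k.-tuple G := [tuple Y i w | i < k].

Lemma histE k w : hist k w = mkseq (Y^~ w) k :> seq G.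
Proof.
rewrite /mkseq -val_enum_ord -map_comp /hist /=; exact: eq_map.
Qed.

(** Blocks are made independent one at a time, from the last: decoupling block [k] from the earlier
    ones costs [2 * b * M], and averaging [F] over it leaves a function of the earlier blocks with
    the same bound [M]. *)
Lemma mean_blocks (F : seq G -> R) M k : (k <= K)%N -> 0 <= M -> 0 <= b ->
  (forall s, `|F s| <= M) ->
  `|\int[P]_w F (mkseq (Y^~ w) k) - prodmean pi k F| <= k%:R * (2 * b * M).
Proof.
move=> + M0 b0; elim: k F => [|k IH] F kK hF.
  have -> : \int[P]_w F (mkseq (Y^~ w) 0) = F [::] by exact: (Rintegral_probability_cst (F [::])).
  by rewrite /= subrr normr0 mul0r.
pose F' s := \sum_a pi k a * F (rcons s a).
have hF' s : `|F' s| <= M.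
  apply: le_trans (ler_norm_sum _ _ _) _.
  apply: (@le_trans _ _ (\sum_a pi k a * M)).
    by apply: ler_sum => a _; rewrite normrM (ger0_norm (pi_ge0 _ _)) ler_wpM2l.
  by rewrite -mulr_suml pi_sum1 mul1r.
have h1 := IH F' (ltnW kK) hF'.
have pf (s : k.-tuple G) : past k (hist k @^-1` [set s]).
  have -> : hist k @^-1` [set s] = [set w | mkseq (Y^~ w) k = s]; last exact: past_fibers.
  apply/seteqP; split => w /=; first by move=> <-; rewrite histE.
  by move=> e; apply/val_inj; rewrite /= -e histE.
have h2 := decoupling (Phi := fun (s : k.-tuple G) a => F (rcons s a))
  (past_measurable (k := k)) (future_measurable (k := k)) pf (future_fibers k) (beta_le kK)
  (fun _ _ => hF _) M0.
have E1 : \int[P]_w F (rcons (hist k w) (Y k w)) = \int[P]_w F (mkseq (Y^~ w) k.+1).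
  by apply: eq_Rintegral => w _; rewrite histE mkseqS.
have E2 : \sum_a prb (Y k @^-1` [set a]) * \int[P]_w F (rcons (hist k w) a) =
   \int[P]_w F' (mkseq (Y^~ w) k).
  rewrite /F'; under [RHS]eq_Rintegral do rewrite -histE.
  have mh : fibers_measurable (hist k) by move=> s; apply: past_measurable (pf s).
  rewrite Rintegral_sum.
    apply: eq_bigr => a _; rewrite RintegralZl //.
    exact: (integrable_finite_valued (fun s : k.-tuple G => F (rcons s a)) mh).
  move=> a.
  exact: (integrable_finite_valued (fun s : k.-tuple G => pi k a * F (rcons s a)) mh).
rewrite E1 E2 in h2.
rewrite -[X in X - prodmean _ _ _](subrK (\int[P]_w F' (mkseq (Y^~ w) k))) -addrA.
apply: le_trans (ler_normD _ _) _.
rewrite -[k.+1%:R]natr1 [(k%:R + 1) * _]mulrDl mul1r [leRHS]addrC; exact: lerD.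
Qed.

(** The comparison with the product law is used twice. Applied to [F], it brings the true mean
    within [e] of the product mean, which is why the deviation is [2 * e]; applied to the indicator
    of a deviation, with bound 1, it adds [K * (2 * b)] to the product tail. *)
Lemma blocks_concentration (F : seq G -> R) (M c l e : R) :
  0 <= M -> 0 <= b -> 0 <= l -> 0 <= c -> l * c <= 2^-1 ->
  (forall s, `|F s| <= M) -> bounded_differences K F c ->
  K%:R * (2 * b * M) <= e ->
  prb [set w | 2 * e <= `|F (mkseq (Y^~ w) K) - \int[P]_w F (mkseq (Y^~ w) K)|] <=
  2 * expR (K%:R * (2 * l ^+ 2 * c ^+ 2) - l * e) + K%:R * (2 * b).
Proof.
move=> M0 b0 l0 c0 lc hF bF hK.
set m := \int[P]_w _; have h1 := mean_blocks (leqnn K) M0 b0 hF; rewrite -/m in h1.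
set q := prodmean pi K F in h1.
have hi : forall s, `|((e <= `|F s - q|)%R%:R : R)| <= 1.
  by move=> s; case: (e <= _); rewrite ?normr1 ?normr0 ?ler01 ?lexx.
have h2 := mean_blocks (leqnn K) ler01 b0 hi; rewrite mulr1 in h2.
have h3 := prodmean_tail pi_ge0 pi_sum1 e l0 c0 lc bF.
rewrite -/q in h3.
apply: (@le_trans _ _ (\int[P]_w (e <= `|F (mkseq (Y^~ w) K) - q|)%R%:R)); last first.
  move: h2; rewrite ler_norml => /andP[_]; rewrite lerBlDr => h2.
  by apply: le_trans h2 _; rewrite addrC lerD2r.
have mK : fibers_measurable (hist K).
  move=> s; have -> : hist K @^-1` [set s] =
      \bigcap_(i in [set: 'I_K]) (Y i @^-1` [set tnth s i]).
    apply/seteqP; split => w /=; first by move=> <- i _ /=; rewrite tnth_mktuple.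
    by move=> h; apply: eq_from_tnth => i; rewrite tnth_mktuple; exact: (h i).
  by apply: fin_bigcap_measurable => [|i _]; [exact: finite_finset|exact: mY].
under eq_Rintegral do rewrite -histE.
rewrite -(prb_finite_valued (fun s : K.-tuple G => e <= `|F s - q|) mK).
have mset (p : pred (K.-tuple G)) := measurable_finite_event p mK.
have E : [set w | 2 * e <= `|F (hist K w) - m|] =
    [set w | 2 * e <= `|F (mkseq (Y^~ w) K) - m|].
  by apply/funext => w /=; rewrite histE.
apply: prb_le; [|exact: (mset (fun s => e <= `|F s - q|))|].
  by rewrite -E; exact: (mset (fun s => 2 * e <= `|F s - m|)).
move=> w /=; rewrite histE => h.
have : `|F (mkseq (Y^~ w) K) - m| <= `|F (mkseq (Y^~ w) K) - q| + `|m - q|.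
  by rewrite (distrC m); apply: ler_distD.
move: h1 h; lra.
Qed.
End blocks.
End finite_valued.

(** * Stationarity and a maximal inequality *)

Section trajectories.
Context {d : measure_display} {T : measurableType d} {R : realType}.
Variable P : probability T R.
Variable eps : int -> T -> R.
Hypothesis stat : strictly_stationary P eps.

Local Notation S := (g_sigma_algebraType (@cylinder_sets R)).

(** The noise seen from time [k]: [g (traj k w)] is convertible to [shift_process g eps k w]. The
    type [S] equips sequences with the cylinder sigma-algebra. *)
Definition traj (k : int) (w : T) : S := fun l => eps (k + l) w.

Lemma measurable_traj k : measurable_fun setT (traj k).
Proof.
apply: (@measurability _ _ _ S setT _ (@cylinder_sets R) erefl).
move=> _ [_ [l [B [mB ->]]] <-]; rewrite setTI.
have -> : traj k @^-1` [set f | B (f l)] = eps (k + l) @^-1` B by [].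
by rewrite -[X in measurable X]setTI; apply: stat.1.
Qed.

Definition trajm k : {mfun T >-> S} :=
  HB.pack (traj k) (isMeasurableFun.Build _ _ _ _ (traj k) (measurable_traj k)).

(** One-coordinate cylinders are not stable under intersection. These finite intersections are, and
    stationarity is stated on exactly these sets, so uniqueness of measures extends it to all
    measurable sets. *)
Definition rectangles : set (set (int -> R)) :=
  [set C | exists (m : nat) (t : 'I_m -> int) (B : 'I_m -> set R),
     (forall i, measurable (B i)) /\ C = \bigcap_i [set f | B i (f (t i))]].

Lemma rectangles_generate : @measurable _ S = <<s rectangles >>.
Proof.
apply/seteqP; split.
  apply: sub_sigma_algebra2 => _ [l [B [mB ->]]].
  exists 1, (fun=> l), (fun=> B); split => //.
  by apply/seteqP; split => [f h i _ //|f /(_ ord0 I)].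
apply: smallest_sub; first exact: sigma_algebra_measurable.
move=> _ [m [t [B [mB ->]]]].
apply: fin_bigcap_measurable => [|i _]; first exact: finite_finset.
by apply: sub_sigma_algebra; exists (t i), (B i).
Qed.

Lemma rectangles_setI : setI_closed rectangles.
Proof.
move=> _ _ [m1 [t1 [B1 [mB1 ->]]]] [m2 [t2 [B2 [mB2 ->]]]].
exists (m1 + m2)%N, (fun i => match fintype.split i with inl j => t1 j | inr j => t2 j end),
  (fun i => match fintype.split i with inl j => B1 j | inr j => B2 j end); split.
  by move=> i; case: (fintype.split i).
apply/seteqP; split => f.
  by move=> [h1 h2] i _ /=; case: (fintype.split i) => j; [exact: h1|exact: h2].
move=> h; split => j _ /=.
  by have := h (unsplit (inl j)) I; rewrite unsplitK.
by have := h (unsplit (inr j)) I; rewrite unsplitK.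
Qed.

Lemma traj_stationary k (C : set S) : measurable C ->
  P (traj k @^-1` C) = P (traj 0 @^-1` C).
Proof.
move=> mC.
apply: (@measure_unique _ R S rectangles (fun=> setT) rectangles_generate rectangles_setI
  _ _ (pushforward P (trajm k)) (pushforward P (trajm 0))) => //.
- move=> _; exists 0, (fun=> 0), (fun=> setT); split => //.
  by apply/seteqP; split.
- by apply/seteqP; split => // f _; exists 0.
- move=> _ [m [t [B [mB ->]]]].
  have E h : trajm h @^-1` (\bigcap_i [set f : int -> R | B i (f (t i))]) =
     \bigcap_i (eps (t i + h) @^-1` B i).
    by apply/seteqP; split => w hw i _ /=; have := hw i I; rewrite /= /traj addrC.
  transitivity (P (\bigcap_i (eps (t i + k) @^-1` B i))).
    by rewrite -(E k).
  by rewrite -(stat.2 m t B k) // (stat.2 m t B 0) // -(E 0).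
- move=> _; change (P (traj k @^-1` setT) < +oo)%E; rewrite preimage_setT.
  by rewrite (le_lt_trans (probability_le1 P _)) // ltry.
Qed.

Lemma product_measurableP (g : S -> R) : product_measurable g <-> measurable_fun setT g.
Proof.
split=> [mg _ B mB|mg B mB]; first by rewrite setTI; exact: mg.
by rewrite -[_ @^-1` _]setTI; exact: mg.
Qed.

Lemma measurable_traj_comp (g : S -> R) k : measurable_fun setT g ->
  measurable_fun setT (fun w => g (traj k w)).
Proof. by move=> mg; apply: measurableT_comp mg (measurable_traj k). Qed.

Lemma integral_traj (y : S -> R) k : measurable_fun setT y -> (forall f, 0 <= y f) ->
  (\int[P]_w (y (traj k w))%:E = \int[P]_w (y (traj 0 w))%:E)%E.
Proof.
move=> my y0.
have E h : (\int[P]_w (y (traj h w))%:E =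
    \int[pushforward P (trajm h)]_f (y f)%:E)%E.
  have := @ge0_integral_pushforward _ _ T S R (traj h) (measurable_traj h) P setT (EFin \o y).
  rewrite preimage_setT => e; symmetry; apply: e => //; first exact/measurable_EFinP.
  by move=> f _; rewrite /= lee_fin.
rewrite !E; apply: eq_measure_integral => A mA _.
exact: traj_stationary.
Qed.

Lemma integrable_traj (y : S -> R) (V : R) k : measurable_fun setT y ->
  (forall f, 0 <= y f) -> (\int[P]_w (y (traj 0 w))%:E <= V%:E)%E ->
  P.-integrable setT (EFin \o (fun w => y (traj k w))) /\ \int[P]_w y (traj k w) <= V.
Proof.
move=> my y0 yV.
have iy : P.-integrable setT (EFin \o (fun w => y (traj k w))).
  apply/integrableP; split; first exact/measurable_EFinP/measurable_traj_comp.
  have -> : (\int[P]_w `|(EFin \o (fun w => y (traj k w))) w| =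
      \int[P]_w (y (traj k w))%:E)%E.
    by apply: eq_integral => w _ /=; rewrite ger0_norm //; exact: y0.
  by rewrite integral_traj // (le_lt_trans yV) // ltry.
split => //; rewrite -lee_fin /Rintegral fineK; last exact: (integrable_fin_num _ iy).
by rewrite integral_traj.
Qed.

Definition shiftseq (i : int) (f : S) : S := fun l => f (i + l).

Lemma measurable_shiftseq i : measurable_fun setT (shiftseq i).
Proof.
apply: (@measurability _ _ _ S setT _ (@cylinder_sets R) erefl).
move=> _ [_ [l [B [mB ->]]] <-]; rewrite setTI.
by apply: sub_sigma_algebra; exists (i + l), B.
Qed.

Lemma shiftseq_traj i k w : shiftseq i (traj k w) = traj (k + i) w.
Proof. by apply/funext => l; rewrite /shiftseq /traj addrA. Qed.
End trajectories.

Section maximal_inequality.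
Context {R : realType}.

Definition run_above (y : nat -> R) (l : R) (n k : nat) : bool :=
  [exists m : 'I_n, l * m.+1%:R < \sum_(k <= i < k + m.+1) y i].

(* Greedy covering: the starting points of high-average runs are covered by disjoint runs. *)
Lemma run_above_covering (y : nat -> R) (l : R) (n a b : nat) :
  (forall i, 0 <= y i) -> 0 <= l -> (a <= b)%N ->
  l * \sum_(a <= k < b) (run_above y l n k)%:R <= \sum_(a <= i < b + n) y i.
Proof.
(* The induction is on a bound for [b - a], since a high-average run moves the left end by its whole
   length. *)
move=> y0 l0; move: {2}(b - a)%N (leqnn (b - a)) => c.
have cnt a' b' : \sum_(a' <= k < b') (run_above y l n k)%:R <= ((b' - a')%N%:R : R).
  apply: (@le_trans _ _ (\sum_(a' <= k < b') (1 : R))).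
    by apply: ler_sum => k _; case: run_above.
  by rewrite sumr_const_nat.
elim: c a => [|c IH] a hc ab.
  have -> : b = a by move: hc ab; lia.
  by rewrite big_geq // mulr0 sumr_ge0.
have [->|ltab] := eqVneq a b.
  by rewrite big_geq // mulr0 sumr_ge0.
have {ltab} ltab : (a < b)%N by move: ab; rewrite leq_eqVlt (negPf ltab).
have [bad|good] := boolP (run_above y l n a); last first.
  rewrite big_ltn // (negPf good) add0r [leRHS]big_ltn; last by lia.
  apply: le_trans (IH a.+1 _ _) _; [lia|by []|].
  by rewrite lerDr.
have /existsP[m hm] := bad.
have [bm|mb] := leqP b (a + m.+1).
  apply: (@le_trans _ _ (l * m.+1%:R)).
    apply: ler_wpM2l => //; apply: le_trans (cnt a b) _.
    by rewrite ler_nat; lia.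
  apply: le_trans (ltW hm) _.
  rewrite [leRHS](@big_cat_nat _ _ _ (a + m.+1)%N) //=; [|lia|by have := ltn_ord m; lia].
  by rewrite lerDl sumr_ge0.
rewrite (@big_cat_nat _ _ _ (a + m.+1)%N) //=; [|lia|lia].
rewrite [leRHS](@big_cat_nat _ _ _ (a + m.+1)%N) //=; [|lia|lia].
rewrite mulrDr; apply: lerD.
  apply: le_trans (ltW hm); apply: ler_wpM2l => //.
  by apply: le_trans (cnt _ _) _; rewrite ler_nat; lia.
by apply: IH; lia.
Qed.

Context {d : measure_display} {T : measurableType d}.
Variable P : probability T R.
Variable eps : int -> T -> R.
Hypothesis stat : strictly_stationary P eps.
Local Notation S := (g_sigma_algebraType (@cylinder_sets R)).

Variable y : S -> R.
Hypothesis my : measurable_fun setT y.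
Hypothesis y0 : forall f, 0 <= y f.
Variable V : R.
Hypothesis yV : (\int[P]_w (y (traj eps 0 w))%:E <= V%:E)%E.

Let Y (w : T) (i : nat) : R := y (traj eps i w).

Let iY (i : nat) : P.-integrable setT (EFin \o (Y^~ i)).
Proof. exact: (integrable_traj stat i my y0 yV).1. Qed.

Let EY (i : nat) : \int[P]_w Y w i <= V.
Proof. exact: (integrable_traj stat i my y0 yV).2. Qed.

Let runset (l : R) n : set S :=
  \bigcup_(m in [set: 'I_n]) [set f | l * m.+1%:R < \sum_(0 <= i < m.+1) y (shiftseq i f)].

Let mrunset l n : measurable (runset l n).
Proof.
apply: fin_bigcup_measurable => [|m _]; first exact: finite_finset.
have mf : measurable_fun setT (fun f : S => \sum_(0 <= i < m.+1) y (shiftseq i f)).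
  by apply: measurable_sum => i; apply: measurableT_comp my (measurable_shiftseq _).
have := mf measurableT `]l * m.+1%:R, +oo[%classic (measurable_itv _).
rewrite setTI; congr measurable.
by apply/seteqP; split => f /=; rewrite in_itv /= andbT.
Qed.

Let run_aboveE l n k : [set w | run_above (Y w) l n k] = traj eps k @^-1` runset l n.
Proof.
have E w m : \sum_(0 <= i < m.+1) y (shiftseq i (traj eps k w)) =
    \sum_(k <= i < k + m.+1) Y w i.
  have -> : \sum_(k <= i < k + m.+1) Y w i = \sum_(0 <= i < m.+1) Y w (i + k).
    by rewrite -{1}[k]add0n big_addn addKn.
  by apply: eq_bigr => i _; rewrite shiftseq_traj /Y addnC PoszD.
apply/seteqP; split => w /=.
  by move=> /existsP[m hm]; exists m => //=; rewrite E.
by move=> [m _ /=]; rewrite E => hm; apply/existsP; exists m.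
Qed.

Lemma measurable_run_above l n k : measurable [set w | run_above (Y w) l n k].
Proof.
rewrite run_aboveE -[X in measurable X]setTI.
exact: (measurable_traj stat) _ _ (mrunset l n).
Qed.

(** The covering inequality is integrated over [n] consecutive starting points, which by
    stationarity all have the same probability of being high. Runs of length at most [n] from these
    points stay within [2 * n] terms, whence the factor 2. *)
Lemma prb_run_above (l : R) n : 0 < l -> prb P [set w | run_above (Y w) l n 1] <= 2 * V / l.
Proof.
move=> l0; rewrite ler_pdivlMr //.
have V0 : 0 <= V.
  by rewrite -lee_fin; apply: le_trans yV; apply: integral_ge0 => w _; rewrite lee_fin.
case: n => [|n].
  have -> : [set w | run_above (Y w) l 0 1] = set0.
    by apply/seteqP; split => // w /existsP[[]].
  by rewrite /prb measure0 mul0r mulr_ge0.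
set A := [set w | _].
have ind k : \int[P]_w (run_above (Y w) l n.+1 k)%:R = prb P A.
  rewrite /Rintegral /prb; congr fine.
  transitivity (\int[P]_w (\1_[set w | run_above (Y w) l n.+1 k] w)%:E)%E.
    by apply: eq_integral => w _; rewrite indicE mem_setE.
  rewrite integral_indic ?setIT //; last exact: measurable_run_above.
  rewrite /A !run_aboveE.
  transitivity (P (traj eps 0 @^-1` runset l n.+1)); first exact: (traj_stationary stat).
  by symmetry; exact: (traj_stationary stat).
have ii k : P.-integrable setT (EFin \o fun w => (run_above (Y w) l n.+1 k)%:R).
  have -> : (fun w => (run_above (Y w) l n.+1 k)%:R) =
     (\1_[set w | run_above (Y w) l n.+1 k] : T -> R).
    by apply/funext => w; rewrite indicE mem_setE.
  by apply: integrable_indic; exact: measurable_run_above.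
pose b w : R := \sum_(1 <= k < n.+2) (run_above (Y w) l n.+1 k)%:R.
have ib : P.-integrable setT (EFin \o b) by exact: integrable_bigsum.
have h : \int[P]_w (l * b w) <= \int[P]_w \sum_(1 <= i < n.+2 + n.+1) Y w i.
  apply: le_Rintegral => //.
  - exact: integrable_scale.
  - exact: integrable_bigsum.
  - by move=> w _; apply: run_above_covering => //; [move=> i; exact: y0|exact: ltW].
move: h; rewrite RintegralZl // /b.
rewrite !Rintegral_sum //; under eq_bigr do rewrite ind.
rewrite sumr_const_nat subn1 /= => h.
have h2 : \sum_(1 <= i < n.+2 + n.+1) \int[P]_w Y w i <= (2 * n.+1)%:R * V.
  apply: (@le_trans _ _ (\sum_(1 <= i < n.+2 + n.+1) V)); first exact: ler_sum.
  rewrite sumr_const_nat -[leLHS]mulr_natl; apply: ler_wpM2r => //.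
  by rewrite ler_nat; lia.
have := le_trans h h2; rewrite -[prb P A *+ _]mulr_natl natrM.
have n0 : (0 : R) < n.+1%:R by rewrite ltr0n.
move=> h3; rewrite -(ler_pM2l n0); lra.
Qed.

(** The bound on runs of bounded length does not depend on the length, so continuity from below
    removes the restriction. The sums start at 1 because the entries of the data matrix are the
    terms of index 1 to [n * N]. *)
Lemma maximal_inequality (l : R) : 0 < l ->
  let A := [set w | exists n, l * n.+1%:R < \sum_(1 <= i < n.+2) y (traj eps i w)] in
  measurable A /\ prb P A <= 2 * V / l.
Proof.
move=> l0 A.
pose F n := [set w | run_above (Y w) l n 1].
have mF n : measurable (F n) by exact: measurable_run_above.
have EA : A = \bigcup_n F n.
  apply/seteqP; split => w.
    by move=> [n hn]; exists n.+1 => //; apply/existsP; exists ord_max.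
  by move=> [n _ /existsP[m hm]]; exists m.
have mA : measurable A by rewrite EA; apply: bigcupT_measurable.
split => //; rewrite -lee_fin prbK //.
have ndF : nondecreasing_seq F.
  move=> m n mn; apply/subsetPset => w /existsP[i hi]; apply/existsP.
  by exists (widen_ord mn i).
have cv := nondecreasing_cvg_mu (mu := P) mF (bigcupT_measurable F mF) ndF.
rewrite EA -(cvg_lim _ cv) //; apply: lime_le; first by apply/cvg_ex; eexists; exact: cv.
by apply: nearW => n /=; rewrite -prbK // lee_fin prb_run_above.
Qed.
End maximal_inequality.

(** * Approximation by finitely many coordinates *)

Section window_approximation.
Context {d : measure_display} {T : measurableType d} {R : realType}.
Variable P : probability T R.
Variable eps : int -> T -> R.
Hypothesis stat : strictly_stationary P eps.
Local Notation S := (g_sigma_algebraType (@cylinder_sets R)).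

Definition window_sets (m : nat) : set (set S) :=
  [set C | exists (l : int) (B : set R), [/\ (absz l <= m)%N, measurable B &
     C = [set f | B (f l)]]].

Lemma window_sets_measurable m C : <<s window_sets m >> C -> measurable (C : set S).
Proof.
by apply: sub_sigma_algebra2 => _ [l [B [_ mB ->]]]; exists l, B.
Qed.

Lemma window_sets_le m n C : (m <= n)%N -> <<s window_sets m >> C -> <<s window_sets n >> C.
Proof.
move=> mn; apply: sub_sigma_algebra2 => _ [l [B [lm mB ->]]].
by exists l, B; split => //; exact: leq_trans mn.
Qed.

(** Reading a window around time [k] uses only the noise within distance [m] of [k]; this places
    codes in the past or future sigma-algebras. *)
Lemma sigma_gen_window (I : set int) k m C : (forall l, (absz l <= m)%N -> I (k + l)) ->
  <<s window_sets m >> C -> sigma_gen eps I (traj eps k @^-1` C).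
Proof.
move=> hI; move: C.
pose Q := [set C : set S | sigma_gen eps I (traj eps k @^-1` C)].
apply: (@smallest_sub _ _ _ Q).
  split; rewrite /Q /=.
  - by rewrite preimage_set0; exact: sigma_algebra0.
  - by move=> A hA; exact: (sigma_algebraCD hA).
  - by move=> A hA; rewrite preimage_bigcup; exact: sigma_algebra_bigcup.
move=> _ [l [B [lm mB ->]]]; apply: sub_sigma_algebra.
by exists (k + l); split; [exact: hI|exists B].
Qed.

Lemma sigma_gen_measurable (I : set int) : sigma_gen eps I `<=` measurable.
Proof.
apply: smallest_sub; first exact: sigma_algebra_measurable.
move=> _ [l [_ [B [mB ->]]]]; rewrite -[X in measurable X]setTI.
by apply: stat.1.
Qed.

Let nu (C : set S) : R := prb P (traj eps 0 @^-1` C).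

Let mpre (C : set S) : measurable C -> measurable (traj eps 0 @^-1` C).
Proof.
by move=> mC; rewrite -[X in measurable X]setTI; exact: (measurable_traj stat).
Qed.

Lemma prbU (A B : set T) : measurable A -> measurable B ->
  prb P (A `|` B) <= prb P A + prb P B.
Proof.
move=> mA mB; rewrite -lee_fin EFinD !prbK //; last exact: measurableU.
exact: measureU2.
Qed.

Let nuD (A B : set S) : measurable A -> measurable B -> A `<=` B -> nu A <= nu B.
Proof. by move=> mA mB AB; apply: prb_le; [exact: mpre|exact: mpre|move=> w; exact: AB]. Qed.

Let nuU (A B : set S) : measurable A -> measurable B -> nu (A `|` B) <= nu A + nu B.
Proof. by move=> mA mB; rewrite /nu preimage_setU; apply: prbU; exact: mpre. Qed.

Definition symdiff (A B : set S) := (A `\` B) `|` (B `\` A).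

Lemma measurable_symdiff A B : measurable A -> measurable B -> measurable (symdiff A B).
Proof. by move=> mA mB; apply: measurableU; exact: measurableD. Qed.

(** The measurable sets that can be approximated form a sigma-algebra containing the cylinders.
    Complements leave the symmetric difference unchanged, and a countable union is first cut to a
    finite one by continuity from above. *)
Lemma window_approximation_set (C : set S) (e : R) : measurable C -> 0 < e ->
  exists m C', <<s window_sets m >> C' /\ prb P (traj eps 0 @^-1` symdiff C C') <= e.
Proof.
move=> + e0; move: e e0.
pose Q := [set C : set S | measurable C /\ forall e, 0 < e ->
  exists m C', <<s window_sets m >> C' /\ nu (symdiff C C') <= e].
suff h : measurable `<=` Q by move=> e e0 mC; have [_] := h _ mC; apply.
have nu0 : nu set0 = 0 by rewrite /nu preimage_set0 /prb measure0.
have symC (A B : set S) : symdiff (setT `\` A) (setT `\` B) = symdiff A B.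
  rewrite /symdiff /setU /setD; apply/seteqP; split => x /=;
  by have := EM (A x); have := EM (B x); tauto.
have Q0 : Q set0.
  split => // e e0; exists 0, set0; split; first exact: sigma_algebra0.
  by rewrite /symdiff !setD0 setU0 nu0 ltW.
have QU A B : Q A -> Q B -> Q (A `|` B).
  move=> [mA hA] [mB hB]; split; first exact: measurableU.
  move=> e e0; have e2 : 0 < e / 2 by rewrite divr_gt0.
  have [m1 [A' [wA' nA']]] := hA _ e2; have [m2 [B' [wB' nB']]] := hB _ e2.
  have mA' := window_sets_measurable wA'; have mB' := window_sets_measurable wB'.
  exists (maxn m1 m2), (A' `|` B'); split.
    apply: (@measurableU _ (g_sigma_algebraType (window_sets (maxn m1 m2)))).
      by apply: window_sets_le wA'; exact: leq_maxl.
    by apply: window_sets_le wB'; exact: leq_maxr.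
  apply: (@le_trans _ _ (nu (symdiff A A' `|` symdiff B B'))).
    apply: nuD.
    - by apply: measurable_symdiff; exact: measurableU.
    - by apply: measurableU; exact: measurable_symdiff.
    - move=> x [[[h|h] /not_orP[n1 n2]]|[[h|h] /not_orP[n1 n2]]].
      + by left; left.
      + by right; left.
      + by left; right.
      + by right; right.
  apply: le_trans (nuU _ _) _; [exact: measurable_symdiff|exact: measurable_symdiff|].
  by apply: le_trans (lerD nA' nB') _; rewrite -splitr.
have QUU (A : (set S)^nat) : (forall n, Q (A n)) -> Q (\bigcup_k A k).
  move=> hA.
  have mA n : measurable (A n) by have [] := hA n.
  have mU : measurable (\bigcup_k A k) by apply: bigcupT_measurable.
  split => // e e0; have e2 : 0 < e / 2 by rewrite divr_gt0.
  pose U n := \big[setU/set0]_(i < n) A i.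
  have QUn n : Q (U n).
    rewrite /U; elim: n => [|n IH]; first by rewrite big_ord0.
    by rewrite big_ord_recr /=; apply: QU.
  have mUn n : measurable (U n) by have [] := QUn n.
  pose F n := traj eps 0 @^-1` ((\bigcup_k A k) `\` U n).
  have mF n : measurable (F n) by apply: mpre; exact: measurableD.
  have capF : \bigcap_n F n = set0.
    apply/seteqP; split => // w h; have [[k _ Akw] _] := h 0 I.
    have [_] := h k.+1 I; apply; rewrite /U big_ord_recr /=; by right.
  have cv : P (F n) @[n --> \oo] --> (0 : \bar R)%E.
    rewrite -(measure0 P) -capF; apply: nonincreasing_cvg_mu => //.
    - by rewrite (le_lt_trans (probability_le1 P _)) // ltry.
    - by rewrite capF.
    - move=> m n mn; apply/subsetPset => w [h1 h2]; split => // h3; apply: h2.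
      by have := @subset_bigsetU _ A _ _ mn; apply.
  have [n hn] : exists n, prb P (F n) <= e / 2.
    have /fine_cvgP[_ cv'] : P (F n) @[n --> \oo] --> (0 : R)%:E by exact: cv.
    have /cvgrPdist_le /(_ _ e2) [n _ hn] := cv'.
    exists n; have := hn n (leqnn n); rewrite /= sub0r normrN ger0_norm //.
    exact: prb_ge0.
  have [m [C' [wC' nC']]] := (QUn n).2 _ e2.
  have mC' := window_sets_measurable wC'.
  exists m, C'; split => //.
  apply: (@le_trans _ _ (nu (((\bigcup_k A k) `\` U n) `|` symdiff (U n) C'))).
    apply: nuD.
    - exact: measurable_symdiff.
    - by apply: measurableU; [exact: measurableD|exact: measurable_symdiff].
    - move=> x [[h1 h2]|[h1 h2]].
        by have [hU|hU] := pselect (U n x); [right; left|left].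
      right; right; split => // h3; apply: h2; move: h3.
      by rewrite /U -bigcup_mkord => -[i _ hi]; exists i.
  apply: le_trans (nuU _ _) _; [exact: measurableD|exact: measurable_symdiff|].
  by apply: le_trans (lerD hn nC') _; rewrite -splitr.
apply: smallest_sub.
  split => //.
    move=> A [mA hA]; split; first exact: measurableD.
    move=> e e0; have [m [A' [wA' nA']]] := hA _ e0.
    by exists m, (setT `\` A'); split; [exact: sigma_algebraCD|rewrite symC].
move=> _ [l [B [mB ->]]]; split; first by apply: sub_sigma_algebra; exists l, B.
move=> e e0; exists (absz l), [set f | B (f l)]; split.
  by apply: sub_sigma_algebra; exists l, B.
by rewrite /symdiff !setDv setU0 nu0 ltW.
Qed.
End window_approximation.

(** * Quantization and approximation in mean square *)

Section L2_approximation.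
Context {R : realType}.

Lemma sqrrB_le (a b c : R) : (b - c) ^+ 2 <= 2 * (b - a) ^+ 2 + 2 * (a - c) ^+ 2.
Proof.
rewrite -subr_ge0; have -> : 2 * (b - a) ^+ 2 + 2 * (a - c) ^+ 2 - (b - c) ^+ 2 =
  (b + c - 2 * a) ^+ 2 by ring.
exact: sqr_ge0.
Qed.

Definition level (n i : nat) (x : R) : bool := i%:R <= (x + n%:R) * n%:R < i.+1%:R.

(** The interval from [- n] to [n] is cut into [2 * n ^ 2] cells of width [1 / n], each represented
    by its left end. Outside it no level is active and the value is 0, so the error there is the
    tail of [x ^ 2]. *)
Definition quantize (n : nat) (x : R) : R :=
  \sum_(i < 2 * n ^ 2) (i%:R / n%:R - n%:R) * (level n i x)%:R.

Lemma quantize_bound n (x : R) : (0 < n)%N ->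
  (x - quantize n x) ^+ 2 <= n%:R^-1 ^+ 2 + x ^+ 2 * (n%:R <= `|x|)%R%:R.
Proof.
move=> n0; have n0' : (0 : R) < n%:R by rewrite ltr0n.
have [/andP[xl xr]|out] := boolP (- n%:R <= x < n%:R); last first.
  have -> : quantize n x = 0.
    rewrite /quantize big1 // => i _.
    suff -> : level n i x = false by rewrite mulr0.
    apply/negbTE; apply: contra out => /andP[h1 h2].
    have i1 : (i.+1%:R : R) <= 2 * n%:R * n%:R.
      rewrite -!natrM ler_nat -mulnA mulnn; exact: (ltn_ord i).
    have i0 : (0 : R) <= i%:R by rewrite ler0n.
    apply/andP; split.
      rewrite -[x](addrK n%:R) lerBrDr addNr -(pmulr_lge0 _ n0').
      exact: le_trans i0 h1.
    have : (x + n%:R) * n%:R < 2 * n%:R * n%:R by apply: lt_le_trans h2 i1.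
    by rewrite ltr_pM2r //; lra.
  have -> : (n%:R <= `|x|) = true.
    apply/negbNE/negP; rewrite -ltNge ltr_norml => /andP[h1 h2].
    by move/negP: out; apply; rewrite h2 (ltW h1).
  by rewrite subr0 mulr1 lerDr sqr_ge0.
set u := (x + n%:R) * n%:R.
have u0 : 0 <= u by apply: mulr_ge0; [lra|exact: ltW].
pose i0 := Num.truncn u.
have /andP[hi1 hi2] : i0%:R <= u < i0.+1%:R by exact: truncn_itv.
have i0lt : (i0 < 2 * n ^ 2)%N.
  rewrite -(ltr_nat R); apply: le_lt_trans hi1 _.
  rewrite natrM natrX expr2 mulrA ltr_pM2r //; lra.
have -> : quantize n x = i0%:R / n%:R - n%:R.
  rewrite /quantize (bigD1 (Ordinal i0lt)) //= big1.
    by rewrite /level -/u hi1 hi2 mulr1 addr0.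
  move=> i ii0; suff -> : level n i x = false by rewrite mulr0.
  apply/negbTE; apply: contra ii0 => /andP[h1 h2]; apply/eqP/val_inj => /=.
  have a1 : (i%:R : R) < i0.+1%:R by apply: le_lt_trans h1 hi2.
  have a2 : (i0%:R : R) < i.+1%:R by apply: le_lt_trans hi1 h2.
  by move: a1 a2; rewrite !ltr_nat; lia.
have -> : x - (i0%:R / n%:R - n%:R) = (u - i0%:R) / n%:R.
  by rewrite /u; field; rewrite gt_eqF.
rewrite exprMn; apply: (@le_trans _ _ (n%:R^-1 ^+ 2)).
  rewrite -[leRHS]mul1r; apply: ler_wpM2r; first exact: sqr_ge0.
  rewrite -[leRHS](expr1n _ 2); apply: lerXn2r; rewrite ?nnegrE ?ler01 ?subr_ge0 //.
  by move: hi2; rewrite -natr1; lra.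
by rewrite lerDl mulr_ge0 ?sqr_ge0.
Qed.

Context {d : measure_display} {T : measurableType d}.
Variable P : probability T R.

Lemma square_tail (X : T -> R) (e : R) : measurable_fun setT X ->
  (\int[P]_w (X w ^+ 2)%:E < +oo)%E -> 0 < e ->
  exists n0, forall n, (n0 <= n)%N ->
   P.-integrable setT (EFin \o (fun w => X w ^+ 2 * (n%:R <= `|X w|)%R%:R)) /\
   \int[P]_w (X w ^+ 2 * (n%:R <= `|X w|)%R%:R) <= e.
Proof.
move=> mX X2 e0.
pose f_ (n : nat) w := (X w ^+ 2 * (n%:R <= `|X w|)%R%:R)%:E.
have iX2 : P.-integrable setT (EFin \o (fun w => X w ^+ 2)).
  apply/integrableP; split; first exact/measurable_EFinP/measurable_funX.
  rewrite (eq_integral (fun w => (X w ^+ 2)%:E)) // => w _ /=.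
  by rewrite ger0_norm ?sqr_ge0.
have mf_ n : measurable_fun setT (f_ n).
  apply/measurable_EFinP; apply: measurable_funM; first exact: measurable_funX.
  have -> : (fun w => (n%:R <= `|X w|)%R%:R) =
     (\1_[set w | n%:R <= `|X w|] : T -> R).
    by apply/funext => w; rewrite indicE mem_setE.
  apply: measurable_indic.
  have mN : measurable_fun setT (Num.norm \o X) by apply: measurableT_comp.
  have := mN measurableT `[n%:R, +oo[%classic (measurable_itv _).
  rewrite setTI; congr measurable.
  by apply/seteqP; split => w /=; rewrite in_itv /= andbT.
have b_ n w : (`|f_ n w| <= (X w ^+ 2)%:E)%E.
  rewrite /f_ /= lee_fin normrM ger0_norm ?sqr_ge0 //.
  by case: (n%:R <= _); rewrite ?normr1 ?mulr1 // normr0 mulr0 sqr_ge0.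
have c_ w : f_ ^~ w @ \oo --> 0%E.
  apply: cvg_near_cst; exists (Num.truncn `|X w|).+1 => //= n /= hn.
  rewrite /f_; suff -> : (n%:R <= `|X w|) = false by rewrite mulr0.
  apply/negbTE; rewrite -ltNge; apply: lt_le_trans (truncnS_gt _) _.
  by rewrite ler_nat.
have [_ _ cv] := @dominated_convergence _ T R P setT measurableT f_ (cst 0%E)
  (EFin \o (fun w => X w ^+ 2)) mf_ (measurable_cst _) (aeW _ (fun w _ => c_ w)) iX2
  (aeW _ (fun w n _ => b_ n w)).
rewrite integral0 in cv.
have /fine_cvgP[_ cv'] : (\int[P]_w f_ n w)%E @[n --> \oo] --> (0 : R)%:E by exact: cv.
have /cvgrPdist_le /(_ _ e0) [n0 _ hn] := cv'.
exists n0 => n nn; split.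
  apply: le_integrable iX2 => //; first exact: mf_.
  move=> w _; apply: le_trans (b_ n w) _.
  by rewrite /= ger0_norm ?sqr_ge0.
have := hn n nn; rewrite /= sub0r normrN; apply: le_trans.
exact: ler_norm.
Qed.

Variable eps : int -> T -> R.
Hypothesis stat : strictly_stationary P eps.
Local Notation S := (g_sigma_algebraType (@cylinder_sets R)).

(** Level sets replaced by approximations need not remain disjoint, so the code records membership
    in each of them rather than a single level. *)
Definition window_code {r : nat} (C : 'I_r -> set S) (f : S) : {ffun 'I_r -> bool} :=
  [ffun i => `[< C i f >]].

Lemma window_approximation_L2 (g : S -> R) (e : R) : measurable_fun setT g ->
  (\int[P]_w (g (traj eps 0 w) ^+ 2)%:E < +oo)%E -> 0 < e ->
  exists (r m : nat) (C : 'I_r -> set S) (v : {ffun 'I_r -> bool} -> R),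
    (forall i, <<s window_sets m >> (C i)) /\
    (\int[P]_w ((g (traj eps 0 w) - v (window_code C (traj eps 0 w))) ^+ 2)%:E <= e%:E)%E.
Proof.
move=> mg g2 e0; pose X w := g (traj eps 0 w).
have mX : measurable_fun setT X by exact: (measurable_traj_comp stat).
(* Quantization step and tail each contribute [2 * (e / 8)]; the remaining [e / 2] is for the
   approximation of the level sets. *)
have e8 : 0 < e / 8 by rewrite divr_gt0.
have [n0 hn0] := square_tail mX g2 e8.
have [n [n_gt0 nn hn]] : exists n, [/\ (0 < n)%N, (n0 <= n)%N & (n%:R^-1 ^+ 2 : R) <= e / 8].
  pose k := (Num.truncn (8 / e)).+1.
  have k0 : (0 : R) < k%:R by rewrite ltr0n.
  exists (maxn n0 k); split; rewrite ?leq_maxl ?leq_max ?ltnS ?orbT //.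
  have hk : (k%:R : R) <= (maxn n0 k)%:R by rewrite ler_nat leq_maxr.
  have m0 : (0 : R) < (maxn n0 k)%:R by apply: lt_le_trans hk.
  have m1 : (1 : R) <= (maxn n0 k)%:R by rewrite ler1n leq_max orbT.
  rewrite expr2; apply: (@le_trans _ _ ((maxn n0 k)%:R^-1)).
    by rewrite -[leRHS]mulr1; apply: ler_wpM2l; rewrite ?invr_ge0 ?(ltW m0) // invf_le1.
  have -> : e / 8 = (8 / e)^-1 by rewrite invf_div.
  rewrite lef_pV2 ?posrE ?divr_gt0 //; apply: le_trans hk.
  by apply: ltW; exact: truncnS_gt.
have [iX tX] := hn0 n nn.
pose r := (2 * n ^ 2)%N.
pose c (i : 'I_r) : R := i%:R / n%:R - n%:R.
pose W : R := \sum_i `|c i|.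
have W0 : 0 <= W by apply: sumr_ge0.
pose D (i : 'I_r) : set S := [set f | level n i (g f)].
have mD i : measurable (D i).
  have ml : measurable [set x : R | level n i x].
    have mu : measurable_fun setT (fun x : R => (x + n%:R) * n%:R).
      by apply: measurable_funM => //; apply: measurable_funD.
    have := mu measurableT `[i%:R, i.+1%:R[%classic (measurable_itv _).
    by rewrite setTI.
  by have := mg measurableT _ ml; rewrite setTI.
(* Chosen so that [r] symmetric differences, each with weight [2 * W ^ 2], cost at most [e / 2]; the
   added units keep the denominator positive. *)
pose e' := e / (4 * (W ^+ 2 + 1) * r.+1%:R).
have den0 : 0 < 4 * (W ^+ 2 + 1) * r.+1%:R.
  by rewrite !mulr_gt0 // ltr_wpDl ?sqr_ge0.
have e'0 : 0 < e' by rewrite divr_gt0.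
have ch i : exists p : nat * set S, <<s window_sets p.1 >> p.2 /\
    prb P (traj eps 0 @^-1` symdiff (D i) p.2) <= e'.
  by have [m [C' h]] := window_approximation_set stat (mD i) e'0; exists (m, C').
have [p hp] := choice ch.
pose C i := (p i).2; pose m := \max_i (p i).1.
have wC i : <<s window_sets m >> (C i).
  by apply: window_sets_le (hp i).1; exact: leq_bigmax.
have mC i : measurable (C i) by apply: window_sets_measurable (wC i).
pose v (x : {ffun 'I_r -> bool}) : R := \sum_i c i * (x i)%:R.
exists r, m, C, v; split => //.
pose h w := v (window_code C (traj eps 0 w)).
pose Dl i := traj eps 0 @^-1` symdiff (D i) (C i).
have mDl i : measurable (Dl i).
  rewrite -[X in measurable X]setTI; apply: (measurable_traj stat) => //.
  exact: measurable_symdiff.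
pose U w := 2 * n%:R^-1 ^+ 2 + (2 * (X w ^+ 2 * (n%:R <= `|X w|)%R%:R)
   + \sum_i 2 * W ^+ 2 * \1_(Dl i) w).
have hU w : (X w - h w) ^+ 2 <= U w.
  have h1 := @quantize_bound n (X w) n_gt0.
  (* Outside all the symmetric differences the two sums coincide; inside one of them they differ by
     at most [W]. *)
  have h2 : (quantize n (X w) - h w) ^+ 2 <= \sum_i W ^+ 2 * \1_(Dl i) w.
    have E : quantize n (X w) - h w = \sum_i c i * ((level n i (X w))%:R - (`[< C i (traj eps 0 w) >])%:R).
      rewrite /quantize /h /v -sumrB; apply: eq_bigr => i _.
      by rewrite ffunE mulrBr.
    have b (i : 'I_r) : `|(level n i (X w))%:R - (`[< C i (traj eps 0 w) >])%:R| = \1_(Dl i) w :> R.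
      rewrite indicE; have [hC|hC] := pselect (C i (traj eps 0 w)).
        rewrite (asboolT hC); case: (boolP (level n i (X w))) => hl.
          by rewrite subrr normr0 memNset //= => -[[_ []]|[_ []]].
        by rewrite sub0r normrN normr1 mem_set //; right; split => //; exact/negP.
      rewrite (asboolF hC); case: (boolP (level n i (X w))) => hl.
        by rewrite subr0 normr1 mem_set //; left.
      rewrite subr0 normr0 memNset //= => -[[hD _]|[hC' _]] //.
      by move: hD; rewrite /D /= (negPf hl).
    have [/existsP[i hi]|no] := boolP [exists i, w \in Dl i].
      apply: (@le_trans _ _ (W ^+ 2)).
        rewrite -real_normK ?num_real //; apply: lerXn2r; rewrite ?nnegrE //.
        rewrite E; apply: le_trans (ler_norm_sum _ _ _) _; apply: ler_sum => k _.
        rewrite normrM b -[leRHS]mulr1; apply: ler_wpM2l => //.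
      rewrite (bigD1 i) //= indicE hi mulr1 lerDl; apply: sumr_ge0 => k _.
      by rewrite mulr_ge0 ?sqr_ge0.
    rewrite E big1 ?expr0n /=.
      by apply: sumr_ge0 => k _; rewrite mulr_ge0 ?sqr_ge0.
    move=> i _; have /eqP := b i; rewrite indicE.
    have -> : (w \in Dl i) = false.
      by apply/negbTE; apply: contra no => hh; apply/existsP; exists i.
    by rewrite normr_eq0 => /eqP ->; rewrite mulr0.
  have h3 : (X w - h w) ^+ 2 <= 2 * (X w - quantize n (X w)) ^+ 2 + 2 * (quantize n (X w) - h w) ^+ 2.
    exact: sqrrB_le.
  apply: le_trans h3 _; rewrite /U.
  have -> : \sum_i 2 * W ^+ 2 * \1_(Dl i) w = 2 * \sum_i W ^+ 2 * \1_(Dl i) w.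
    by rewrite mulr_sumr; apply: eq_bigr => i _; rewrite mulrA.
  lra.
have iD i : P.-integrable setT (EFin \o (fun w => 2 * W ^+ 2 * \1_(Dl i) w)).
  by apply: integrable_scale; exact: integrable_indic.
have i2 : P.-integrable setT (EFin \o (fun w => 2 * (X w ^+ 2 * (n%:R <= `|X w|)%R%:R))).
  exact: integrable_scale.
have i3 : P.-integrable setT (EFin \o (fun w => \sum_i 2 * W ^+ 2 * \1_(Dl i) w)).
  exact: integrable_bigsum.
have i4 := integrable_add i2 i3.
have i5 : P.-integrable setT (EFin \o cst (2 * n%:R^-1 ^+ 2)).
  exact: finite_measure_integrable_cst.
have iU : P.-integrable setT (EFin \o U) := integrable_add i5 i4.
have mh : measurable_fun setT h.
  rewrite /h /v; apply: measurable_sum => i; apply: measurable_funM => //.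
  have -> : (fun w => (window_code C (traj eps 0 w) i)%:R) =
     (\1_(traj eps 0 @^-1` C i) : T -> R).
    by apply/funext => w; rewrite ffunE indicE /in_mem /= /in_set.
  apply: measurable_indic; rewrite -[X in measurable X]setTI.
  exact: (measurable_traj stat).
apply: (@le_trans _ _ (\int[P]_w (U w)%:E)%E).
  apply: ge0_le_integral => //.
  - by move=> w _; rewrite lee_fin sqr_ge0.
  - apply/measurable_EFinP/measurable_funX.
    exact: (measurable_funB mX mh).
  - by have /integrableP[] := iU.
  - by move=> w _; rewrite lee_fin; exact: hU.
have -> : (\int[P]_w (U w)%:E)%E = (\int[P]_w U w)%:E.
  by rewrite /Rintegral fineK //; exact: (integrable_fin_num _ iU).
rewrite lee_fin /U (RintegralD _ i5 i4) // (RintegralD _ i2 i3) //.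
rewrite Rintegral_probability_cst RintegralZl // Rintegral_sum //.
have h3 : \sum_i \int[P]_w (2 * W ^+ 2 * \1_(Dl i) w) <= e / 2.
  apply: (@le_trans _ _ (\sum_(i < r) 2 * W ^+ 2 * e')).
    apply: ler_sum => i _; rewrite RintegralZl //; last exact: integrable_indic.
    apply: ler_wpM2l; first by rewrite mulr_ge0 ?sqr_ge0.
    by rewrite /Rintegral integral_indic // setIT; exact: (hp i).2.
  rewrite sumr_const card_ord -[leLHS]mulr_natr /e'.
  have -> (x y : R) : 2 * W ^+ 2 * (x / y) * r%:R = 2 * x * (W ^+ 2 * r%:R) / y.
    by move: y^-1 => ?; ring.
  rewrite ler_pdivrMr //.
  have r1 : (r%:R : R) <= r.+1%:R by rewrite ler_nat.
  have -> : e / 2 * (4 * (W ^+ 2 + 1) * r.+1%:R) = 2 * e * ((W ^+ 2 + 1) * r.+1%:R) by field.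
  apply: ler_wpM2l; first by rewrite mulr_ge0 // ltW.
  by apply: ler_pM; rewrite ?sqr_ge0 // lerDl.
by move: hn tX h3; lra.
Qed.
End L2_approximation.

(** * Mixing coefficients and dyadic summation *)

Section beta_mixing_lemmas.
Context {d : measure_display} {T : measurableType d} {R : realType}.
Variable P : probability T R.
Local Open Scope ereal_scope.

Lemma beta_coef_le (F F' G G' : set (set T)) : F `<=` F' -> G `<=` G' ->
  beta_coef P F G <= beta_coef P F' G'.
Proof.
move=> FF' GG'; rewrite /beta_coef; apply: lee_wpmul2l; first by rewrite lee_fin invr_ge0.
apply: le_ereal_sup => r [m [n [A [B [[hA A1] [hB B1] ->]]]]].
exists m, n, A, B; split => //; split => // i; [exact/FF'/hA|exact/GG'/hB].
Qed.

Lemma beta_coef_ge0 (F G : set (set T)) : F setT -> G setT -> 0 <= beta_coef P F G.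
Proof.
move=> FT GT; rewrite /beta_coef; apply: mule_ge0; first by rewrite lee_fin invr_ge0.
have one (H : set (set T)) : H setT -> finite_partition H (fun=> setT : set T) (m := 1).
  move=> HT; split => //; split.
    by apply/seteqP; split => // w _; exists ord0.
  by move=> i j; rewrite !ord1.
apply: (@le_trans _ _ (\sum_(i < 1) \sum_(j < 1)
  `|fine (P (setT `&` setT)) - fine (P setT) * fine (P setT)|)%R%:E).
  by rewrite lee_fin; apply: sumr_ge0 => i _; apply: sumr_ge0.
apply: ereal_sup_ubound; exists 1%N, 1%N, (fun=> setT), (fun=> setT).
by split => //; exact: one.
Qed.

Variable eps : int -> T -> R.

Lemma sigma_gen_setT I : sigma_gen eps I setT.
Proof.
have := @sigma_algebraCD _ setT _ _ (@sigma_algebra0 _ setT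
  [set A | exists l, I l /\ exists B : set R, measurable B /\ A = eps l @^-1` B]).
by rewrite setD0.
Qed.

Lemma sigma_gen_le I J : I `<=` J -> sigma_gen eps I `<=` sigma_gen eps J.
Proof. by move=> IJ; apply: sub_sigma_algebra2 => A [l [/IJ Jl h]]; exists l. Qed.

Lemma beta_mixing_ge0 n : 0 <= beta_mixing P eps n.
Proof.
rewrite /beta_mixing; case: ifP => // _.
apply: (@le_trans _ _ (beta_coef P (sigma_gen eps [set l | (l <= 0)%R])
                           (sigma_gen eps [set l | (0 + n%:Z <= l)%R]))).
  by apply: beta_coef_ge0; exact: sigma_gen_setT.
by apply: ereal_sup_ubound; exists 0%R.
Qed.

Lemma beta_coef_le_mixing n k : (0 < n)%N ->
  beta_coef P (sigma_gen eps [set l | (l <= k)%R])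
              (sigma_gen eps [set l | (k + n%:Z <= l)%R]) <= beta_mixing P eps n.
Proof.
move=> n0; rewrite /beta_mixing gtn_eqF //.
by apply: ereal_sup_ubound; exists k.
Qed.

Lemma beta_mixing_anti m n : (0 < m)%N -> (m <= n)%N ->
  beta_mixing P eps n <= beta_mixing P eps m.
Proof.
move=> m0 mn; rewrite {1}/beta_mixing gtn_eqF ?(leq_trans m0) //.
apply: ge_ereal_sup => _ [k _ <-].
apply: le_trans (beta_coef_le_mixing k m0); apply: beta_coef_le => //.
apply: sigma_gen_le => l /=; apply: le_trans.
by rewrite lerD2l lez_nat.
Qed.
End beta_mixing_lemmas.

(** * Dyadic comparison with the weighted mixing series *)

Section dyadic_summation.
Context {R : realType}.

Lemma dyadic_sum (f v : nat -> R) (s0 : nat) (B : R) :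
  (forall n, 0 <= f n) ->
  (forall n, (2 ^ s0 <= n)%N -> f n <= v (trunc_log 2 n)) ->
  (forall S, \sum_(s0 <= s < S) 2 ^+ s * v s <= B) ->
  forall m, \sum_(2 ^ s0 <= n < m) f n <= B.
Proof.
move=> f0 fv hB m.
have h S : (s0 <= S)%N -> \sum_(2 ^ s0 <= n < 2 ^ S) f n <= \sum_(s0 <= s < S) 2 ^+ s * v s.
  elim: S => [|S IH]; first by rewrite leqn0 => /eqP ->; rewrite !big_geq.
  rewrite leq_eqVlt => /predU1P[->|]; first by rewrite !big_geq.
  rewrite ltnS => sS; rewrite big_nat_recr //=.
  rewrite (@big_cat_nat _ _ _ (2 ^ S)%N) //=; try by rewrite leq_exp2l.
  apply: lerD; first exact: IH.
  apply: (@le_trans _ _ (\sum_(2 ^ S <= n < 2 ^ S.+1) v S)).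
    rewrite big_nat [leRHS]big_nat; apply: ler_sum => n /andP[h1 h2].
    have -> : S = trunc_log 2 n by rewrite (@trunc_log_eq 2 S n) // h1.
    by apply: fv; apply: leq_trans h1; rewrite leq_exp2l.
  rewrite sumr_const_nat -[leLHS]mulr_natl.
  have -> : (2 ^ S.+1 - 2 ^ S = 2 ^ S)%N by rewrite expnS mul2n -addnn addnK.
  by rewrite natrX.
apply: le_trans (hB (s0 + m)%N).
apply: le_trans (h _ (leq_addr _ _)).
have [mle|mgt] := leqP m (2 ^ s0).
  by rewrite big_geq // sumr_ge0.
rewrite [leRHS](@big_cat_nat _ _ _ m) ?lerDl ?sumr_ge0 //=; first exact: ltnW.
apply: leq_trans (ltnW (ltn_expl m (ltnSn 1))) _.
by rewrite leq_exp2l // leq_addl.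
Qed.

Lemma ln2_ge : 2^-1 <= ln (2 : R).
Proof.
rewrite -ler_expR lnK ?posrE //.
apply: le_trans (expR_le_quadratic (lexx _)) _; lra.
Qed.

Lemma ln_expn_ge (r u : nat) : (2 ^ r <= u)%N -> r%:R / 2 <= ln (u%:R : R).
Proof.
move=> h; apply: (@le_trans _ _ (ln ((2 ^ r)%:R : R))).
  rewrite natrX lnXn // -[leRHS]mulr_natl; apply: ler_wpM2l => //; exact: ln2_ge.
have p : (0 : R) < (2 ^ r)%:R by rewrite ltr0n expn_gt0.
by rewrite ler_ln ?posrE ?ler_nat //; apply: lt_le_trans p _; rewrite ler_nat.
Qed.

Definition weight (alpha : R) (n : nat) : R :=
  (ln (n%:R : R)) `^ (3 * alpha / 2) * (n%:R : R) `^ (- (2^-1)).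

Lemma weight_ge (alpha : R) (r u : nat) : 1 < alpha -> (2 <= r)%N ->
  (2 ^ r <= u < 2 ^ r.+1)%N ->
  Num.sqrt ((r%:R / 2) ^+ 3 / (2 ^+ r.+1)) <= weight alpha u.
Proof.
move=> a1 r2 /andP[u1 u2].
have h1 := ln_expn_ge u1.
(* The logarithm is at least [r / 2], hence at least 1, so lowering the exponent from
   [3 * alpha / 2] to [3 / 2] only decreases the power. *)
have r1 : (1 : R) <= r%:R / 2 by rewrite ler_pdivlMr // mul1r ler_nat.
have r0 : (0 : R) <= r%:R / 2 by apply: le_trans r1.
have u0 : (0 : R) < u%:R by rewrite ltr0n (leq_trans _ u1) // expn_gt0.
rewrite sqrtrM ?exprn_ge0 // /weight; apply: ler_pM; rewrite ?sqrtr_ge0 //.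
  apply: (@le_trans _ _ ((r%:R / 2) `^ (3 / 2))).
    by rewrite powRrM powR_mulrn // powR12_sqrt ?exprn_ge0.
  apply: (@le_trans _ _ ((ln (u%:R : R)) `^ (3 / 2))).
    by apply: ge0_ler_powR; rewrite ?nnegrE ?divr_ge0 // (le_trans r0).
  apply: ler_powR; first exact: le_trans h1.
  by rewrite ler_pM2r ?invr_gt0 //; lra.
rewrite powRN powR12_sqrt ?(ltW u0) // sqrtrV ?exprn_ge0 //.
rewrite lef_pV2 ?posrE ?sqrtr_gt0 ?exprn_gt0 //.
by apply: ler_wsqrtr; rewrite -natrX ler_nat ltnW.
Qed.

Variable b : nat -> R.
Hypothesis b0 : forall n, 0 <= b n.
Hypothesis b_anti : forall m n, (2 <= m)%N -> (m <= n)%N -> b n <= b m.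
Variables (alpha M : R).
Hypothesis alpha1 : 1 < alpha.
Hypothesis b_sum : forall n, \sum_(1 <= u < n) weight alpha u * b u <= M.

Let blk r := \sum_(2 ^ r <= u < 2 ^ r.+1) weight alpha u * b u.

Let weight_ge0 n : 0 <= weight alpha n.
Proof. by rewrite mulr_ge0 ?powR_ge0. Qed.

Let blk_ge0 r : 0 <= blk r.
Proof. by apply: sumr_ge0 => u _; rewrite mulr_ge0. Qed.

Let blk_sum r : \sum_(0 <= i < r) blk i <= M.
Proof.
have -> : \sum_(0 <= i < r) blk i = \sum_(1 <= u < 2 ^ r) weight alpha u * b u.
  elim: r => [|r IH]; first by rewrite !big_geq.
  rewrite big_nat_recr //= IH.
  by rewrite -(@big_cat_nat _ _ _ (2 ^ r)%N) ?expn_gt0 // leq_exp2l.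
exact: b_sum.
Qed.

Let blk_lower r : (2 <= r)%N ->
  2 ^+ r * Num.sqrt ((r%:R / 2) ^+ 3 / (2 ^+ r.+1)) * b (2 ^ r.+1) <= blk r.
Proof.
move=> r2.
apply: (@le_trans _ _ (\sum_(2 ^ r <= u < 2 ^ r.+1)
   Num.sqrt ((r%:R / 2) ^+ 3 / (2 ^+ r.+1)) * b (2 ^ r.+1))).
  rewrite sumr_const_nat -[leRHS]mulr_natl.
  have -> : (2 ^ r.+1 - 2 ^ r = 2 ^ r)%N by rewrite expnS mul2n -addnn addnK.
  by rewrite natrX mulrA.
rewrite big_nat [leRHS]big_nat; apply: ler_sum => u hu.
apply: ler_pM; rewrite ?sqrtr_ge0 ?weight_ge //.
have /andP[u1 u2] := hu; apply: b_anti; last exact: ltnW.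
by apply: leq_trans u1; rewrite -{1}(expn1 2) leq_exp2l // ltnW.
Qed.

(* For [2 ^ s <= n < 2 ^ s.+1] there will be [2 ^ (a + tau s)] blocks of columns, of order
   [log n], separated by gaps of length at least [2 ^ (rexp e s).+1], of order [n^2 / log n]. *)
Definition tau (s : nat) : nat := trunc_log 2 s.
Definition rexp (e s : nat) : nat := (2 * s - tau s - e.+1)%N.

Lemma tau_bounds s : (0 < s)%N -> (2 ^ tau s <= s < 2 ^ (tau s).+1)%N.
Proof. by move=> s0; exact: trunc_log_bounds. Qed.

(** From [s] to [s.+1], [2 * s] gains two and [tau s] at most one. Strict growth makes different
    scales use different dyadic blocks of the mixing series. *)
Lemma rexp_increasing e s : (0 < s)%N -> (tau s + e.+1 <= s)%N ->
  (rexp e s < rexp e s.+1)%N.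
Proof.
move=> s0 hs.
have t1 : (tau s.+1 <= (tau s).+1)%N.
  rewrite -ltnS -(@ltn_exp2l 2) //.
  have /andP[_ h1] := tau_bounds s0.
  have /andP[h2 _] := tau_bounds (ltn0Sn s).
  apply: leq_ltn_trans h2 _; apply: leq_ltn_trans h1 _.
  by rewrite ltn_exp2l.
by rewrite /rexp; lia.
Qed.

(** For [r = rexp e s], [2 ^ r] is of order [4 ^ s / s] and [r >= s], so [2 ^ (r / 2) * r ^ (3 / 2)]
    is at least of order [2 ^ s * s]. The terms are thus dominated by dyadic blocks of the weighted
    series, and no block is used twice. *)
Lemma dyadic_beta_sum (a e s0 : nat) : (2 <= s0)%N ->
  (forall s, (s0 <= s)%N -> (tau s + e.+1 <= s)%N) ->
  forall S, \sum_(s0 <= s < S) 2 ^+ s * (2 ^+ (a + tau s) * b (2 ^ (rexp e s).+1)) <=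
    2 ^+ (a + e + 4) * M.
Proof.
move=> s02 hs S.
have M0 : 0 <= M by have := b_sum 0; rewrite big_geq.
have [Sle|sS] := leqP S s0; first by rewrite big_geq // mulr_ge0.
apply: (@le_trans _ _ (\sum_(s0 <= s < S) 2 ^+ (a + e + 4) * blk (rexp e s))).
  rewrite big_nat [leRHS]big_nat; apply: ler_sum => s /andP[ss _].
  have s_gt0 : (0 < s)%N by apply: leq_trans ss; apply: leq_trans s02.
  have hss := hs _ ss.
  have rs : (s <= rexp e s)%N by rewrite /rexp; lia.
  have r2 : (2 <= rexp e s)%N by apply: leq_trans rs; exact: leq_trans ss.
  apply: (@le_trans _ _ (2 ^+ (a + e + 4) * (2 ^+ rexp e s *
     Num.sqrt (((rexp e s)%:R / 2) ^+ 3 / (2 ^+ (rexp e s).+1)) * b (2 ^ (rexp e s).+1)))); last first.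
    by apply: ler_wpM2l; [exact: exprn_ge0|exact: blk_lower].
  rewrite !mulrA; apply: ler_wpM2r => //.
  set r := rexp e s in rs r2 *.
  set q := Num.sqrt _.
  have q0 : 0 <= q by exact: sqrtr_ge0.
  (* Squaring removes the square root and leaves powers of two together with
     [2 ^ (3 * tau s) <= r ^ 3]. *)
  rewrite -ler_sqr ?nnegrE ?mulr_ge0 ?exprn_ge0 //.
  rewrite [leRHS]exprMn /q sqr_sqrtr ?divr_ge0 ?exprn_ge0 //.
  have Er : (2 * s = r + tau s + e.+1)%N by rewrite /r /rexp; lia.
  have s3 : (2 : R) ^+ (3 * tau s) <= r%:R ^+ 3.
    rewrite mulnC exprM; apply: lerXn2r; rewrite ?nnegrE ?exprn_ge0 //.
    rewrite -natrX ler_nat; apply: leq_trans rs.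
    by have /andP[] := tau_bounds s_gt0.
  have -> : (2 ^+ s * 2 ^+ (a + tau s)) ^+ 2 =
      2 ^+ (2 * a + r + e.+1) * 2 ^+ (3 * tau s) :> R.
    by rewrite -!exprD -exprM; congr (_ ^+ _); lia.
  have -> : (2 ^+ (a + e + 4) * 2 ^+ r) ^+ 2 * ((r%:R / 2) ^+ 3 / 2 ^+ r.+1) =
     2 ^+ (2 * a + 2 * e + r + 4) * r%:R ^+ 3 :> R.
    have -> : (2 ^+ (a + e + 4) * 2 ^+ r) ^+ 2 = 2 ^+ (2 * a + 2 * e + r + 4) * (2 ^+ r.+1 * 2 ^+ 3) :> R.
      by rewrite -!exprD -exprM; congr (_ ^+ _); lia.
    rewrite exprMn exprVn; field.
    by rewrite expf_neq0 // pnatr_eq0.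
  apply: ler_pM => //; rewrite ?exprn_ge0 //.
  by rewrite ler_eXn2l ?ltr1n //; lia.
rewrite -mulr_sumr; apply: ler_wpM2l; first exact: exprn_ge0.
apply: le_trans (blk_sum (rexp e S)).
elim: S sS => [//|S IH]; rewrite ltnS leq_eqVlt => /predU1P[<-|sS].
  rewrite big_nat1 [leRHS](@big_cat_nat _ _ _ (rexp e s0)) //=; last first.
    by apply: ltnW; apply: rexp_increasing; [exact: ltnW|exact: hs].
  have lt : (rexp e s0 < rexp e s0.+1)%N.
    by apply: rexp_increasing; [exact: ltnW|exact: hs].
  rewrite [X in _ + X]big_ltn // addrCA lerDl addr_ge0 ?sumr_ge0 //.
have lt : (rexp e S < rexp e S.+1)%N.
  apply: rexp_increasing; last by apply: hs; exact: ltnW.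
  by apply: leq_trans (ltnW sS); exact: ltnW.
rewrite big_nat_recr /=; last exact: ltnW.
rewrite [leRHS](@big_cat_nat _ _ _ (rexp e S)) //=; last exact: ltnW.
apply: lerD; first exact: IH.
by rewrite big_ltn // lerDl sumr_ge0.
Qed.
End dyadic_summation.

(** * Tail bound for matrices with finitely many values *)

Section column_counting.
Context {R : realType}.

Lemma sum_nat_blocks (V : nmodType) (f : nat -> V) (K p : nat) :
  \sum_(0 <= u < K * p) f u = \sum_(0 <= i < K) \sum_(0 <= t < p) f (i * p + t)%N.
Proof.
elim: K => [|K IH]; first by rewrite mul0n !big_geq.
rewrite big_nat_recr //= -IH (@big_cat_nat _ _ _ (K * p)%N) //=; last first.
  by rewrite leq_mul2r leqnSn orbT.
congr (_ + _); rewrite -{1}[(K * p)%N]add0n big_addn mulSn addnK.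
by apply: eq_bigr => t _; rewrite addnC.
Qed.

Lemma count_block (n p i : nat) : (0 < p)%N ->
  \sum_(j < n) ((j %/ p == i)%N%:R : R) <= p%:R.
Proof.
move=> p0; rewrite -(big_mkord xpredT (fun j => ((j %/ p == i)%N%:R : R))).
set f := (fun j : nat => ((j %/ p == i)%N%:R : R)).
have le : (n <= (n + i).+1 * p)%N.
  apply: leq_trans (leq_pmulr _ p0); exact: leq_trans (leq_addr i n) (leqnSn _).
apply: (@le_trans _ _ (\sum_(0 <= j < (n + i).+1 * p) f j)).
  by rewrite [leRHS](@big_cat_nat _ _ _ n) //= lerDl sumr_ge0.
have hi : i \in index_iota 0 (n + i).+1 by rewrite mem_index_iota ltnS leq_addl.
rewrite sum_nat_blocks (bigD1_seq i hi (iota_uniq _ _)) /=.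
rewrite [X in _ + X]big1_seq ?addr0 => [|k /andP[ki _]]; last first.
  rewrite big_nat big1 // => t /andP[_ tp].
  by rewrite /f divnMDl // divn_small // addn0 (negPf ki).
apply: (@le_trans _ _ (\sum_(0 <= t < p) (1 : R))).
  by apply: ler_sum => t _; rewrite /f; case: (_ == _).
by rewrite sumr_const_nat subn0.
Qed.

(* Each of the [K] blocks has [p] columns, the last [q] of which form the gap. *)
Definition kept (K p q j : nat) : bool := (j %/ p < K)%N && (j %% p < p - q)%N.

(** The gaps account for [K * q] columns, and fewer than [K] columns are left over after the last
    block. *)
Lemma count_removed (n K p q : nat) : (0 < p)%N -> (q <= p)%N -> (K * p <= n)%N ->
  (n < K * p + K)%N ->
  \sum_(j < n) ((~~ kept K p q j)%:R : R) <= K%:R * q%:R + K%:R.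
Proof.
move=> p0 qp Kn nK.
rewrite -(big_mkord xpredT (fun j => ((~~ kept K p q j)%:R : R))).
rewrite (@big_cat_nat _ _ _ (K * p)%N) //=; apply: lerD.
  rewrite sum_nat_blocks big_nat.
  apply: (@le_trans _ _ (\sum_(0 <= i < K | (0 <= i < K)%N) (q%:R : R))); last first.
    by rewrite -big_nat sumr_const_nat subn0 mulr_natl.
  apply: ler_sum => i /andP[_ iK].
  rewrite (@big_cat_nat _ _ _ (p - q)%N) //= ?leq_subr //.
  rewrite [X in X + _]big_nat big1 ?add0r; last first.
    move=> t /andP[_ tp]; have tp' : (t < p)%N by apply: leq_trans tp (leq_subr _ _).
    by rewrite /kept divnMDl // divn_small // addn0 iK modnMDl modn_small // tp.
  apply: (@le_trans _ _ (\sum_(p - q <= t < p) (1 : R))).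
    by apply: ler_sum => t _; case: (~~ _).
  by rewrite sumr_const_nat subKn.
apply: (@le_trans _ _ (\sum_(K * p <= t < n) (1 : R))).
  by apply: ler_sum => t _; case: (~~ _).
by rewrite sumr_const_nat ler_nat; lia.
Qed.

Lemma deviation_transfer (A B EA EB e r : R) : `|A - B| <= r -> `|EA - EB| <= e / 2 ->
  2 * r <= e -> 3 * e <= `|A - EA| -> 2 * e <= `|B - EB|.
Proof.
move=> h1 h2 h3 h4.
have : `|A - EA| <= `|A - B| + (`|B - EB| + `|EA - EB|).
  have -> : A - EA = (A - B) + ((B - EB) - (EA - EB)) by ring.
  apply: le_trans (ler_normD _ _) _; rewrite lerD2l; exact: ler_normB.
lra.
Qed.

(** Column [j] covers the times [j * N + 1] to [j * N + N]. A window may reach [m] beyond a block on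
    either side of a gap, so of its [q * N] time units the gap loses [2 * m]. *)
Lemma block_index_le (i k p q N m j l : nat) (t : int) : (i < k)%N -> (j %/ p)%N = i ->
  (j %% p < p - q)%N -> (l < N)%N -> (absz t <= m)%N ->
  (j * N + l + 1)%N%:Z + t <= (k * p * N)%N%:Z - (q * N)%N%:Z + m%:Z.
Proof.
move=> ik ji jq lN tm.
have jle : (j.+1 + q <= k * p)%N.
  have ej := divn_eq j p; rewrite ji in ej.
  have : (i.+1 * p <= k * p)%N by rewrite leq_mul2r ik orbT.
  move: jq ej; rewrite mulSn; move: (i * p)%N (k * p)%N (j %% p)%N => a b c; clear; lia.
have : ((j.+1 + q) * N <= k * p * N)%N by rewrite leq_mul2r jle orbT.
rewrite mulnDl mulSn; move: lN tm; move: (k * p * N)%N (q * N)%N (j * N)%N; clear; lia.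
Qed.

Lemma block_index_ge (k p q N m j l g : nat) (t : int) : (j %/ p)%N = k ->
  (absz t <= m)%N -> (g + 2 * m <= q * N + 1)%N ->
  (k * p * N)%N%:Z - (q * N)%N%:Z + m%:Z + g%:Z <= (j * N + l + 1)%N%:Z + t.
Proof.
move=> jk tm gap; have kpj : (k * p <= j)%N by rewrite -jk leq_trunc_div.
have : (k * p * N <= j * N)%N by rewrite leq_mul2r kpj orbT.
move: tm gap; move: (k * p * N)%N (q * N)%N (j * N)%N; clear; lia.
Qed.
End column_counting.

(** * Tail bound by blocks of columns *)

Section code_matrix.
Context {d : measure_display} {T : measurableType d} {R : realType}.
Variable P : probability T R.
Variable eps : int -> T -> R.
Hypothesis stat : strictly_stationary P eps.
Context {F : finType}.
Variables (x0 : F) (Z : nat -> T -> F) (m : nat).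
Hypothesis Z_window : forall (k : nat) (I : set int),
  (forall l : int, (absz l <= m)%N -> I (k%:Z + l)) ->
  forall x, sigma_gen eps I (Z k @^-1` [set x]).
Variables (v : F -> R) (V : R).
Hypothesis v_le : forall x, `|v x| <= V.
(* [part] stands for the real or the imaginary part. *)
Variables (z : R[i]) (part : R[i] -> R).
Hypothesis z_gt0 : 0 < complex.Im z.
Hypothesis partB : forall x y, part (x - y) = part x - part y.
Hypothesis part_le : forall x r, cbounded x r -> `|part x| <= r.

Lemma sigma_gen_bigcap (I : set int) (J : finType) (A : J -> set T) :
  (forall j, sigma_gen eps I (A j)) -> sigma_gen eps I (\bigcap_(j in [set: J]) A j).
Proof.
move=> h; apply: (@fin_bigcap_measurable _ (g_sigma_algebraType
  [set A | exists l, I l /\ exists B : set R, measurable B /\ A = eps l @^-1` B])).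
  exact: finite_finset.
by move=> j _; exact: h.
Qed.

Let Z_fibers k : fibers_measurable (Z k).
Proof.
move=> x; apply: (sigma_gen_measurable stat (I := setT)).
exact: Z_window.
Qed.

Variables (N n : nat).
Hypothesis N_gt0 : (0 < N)%N.

Definition code_matrix (w : T) : 'M[R]_(N, n) :=
  \matrix_(i < N, j < n) v (Z (j * N + i + 1)%N w).

Let G : finType := {ffun 'I_n * 'I_N -> F}.
Let code (w : T) : G := [ffun jl : 'I_n * 'I_N => Z (jl.1 * N + jl.2 + 1)%N w].

Let code_fibers : fibers_measurable code.
Proof.
move=> a; have -> : code @^-1` [set a] =
    \bigcap_(jl in [set: 'I_n * 'I_N]) (Z (jl.1 * N + jl.2 + 1)%N @^-1` [set a jl]).
  apply/seteqP; split => w /=; first by move=> <- jl _ /=; rewrite ffunE.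
  by move=> h; apply/ffunP => jl; rewrite ffunE; exact: (h jl).
by apply: fin_bigcap_measurable => [|jl _]; [exact: finite_finset|exact: Z_fibers].
Qed.

Let codeE w : code_matrix w = \matrix_(i < N, j < n) v (code w (j, i)).
Proof. by apply/matrixP => i j; rewrite !mxE ffunE. Qed.

Lemma measurable_code_event (phi : 'M[R]_(N, n) -> bool) :
  measurable [set w | phi (code_matrix w)].
Proof.
have -> : [set w | phi (code_matrix w)] =
    [set w | phi (\matrix_(i < N, j < n) v (code w (j, i)))].
  by apply/funext => w /=; rewrite codeE.
exact: (measurable_finite_event (fun a : G => phi (\matrix_(i < N, j < n) v (a (j, i))))).
Qed.

Lemma integrable_code_matrix (phi : 'M[R]_(N, n) -> R) :
  P.-integrable setT (EFin \o (fun w => phi (code_matrix w))).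
Proof.
have -> : (fun w => phi (code_matrix w)) =
   (fun w => phi (\matrix_(i < N, j < n) v (code w (j, i)))).
  by apply/funext => w; rewrite codeE.
exact: (integrable_finite_valued P
  (fun a : G => phi (\matrix_(i < N, j < n) v (a (j, i)))) code_fibers).
Qed.

Variables (K p q : nat).
Hypothesis K_gt0 : (0 < K)%N.
Hypothesis p_gt0 : (0 < p)%N.
Hypothesis qp : (q <= p)%N.
Hypothesis Kp_le : (K * p <= n)%N.
Hypothesis Kp_gt : (n < K * p + K)%N.

Let n_gt0 : (0 < n)%N.
Proof. by apply: leq_trans Kp_le; rewrite muln_gt0 K_gt0. Qed.

(** A block is stored as a full array with [x0] elsewhere, so that all blocks are letters of one
    finite alphabet. *)
Let block (i : nat) (w : T) : G :=
  [ffun jl : 'I_n * 'I_N => if ((jl.1 %/ p == i) && (jl.1 %% p < p - q))%N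
              then Z (jl.1 * N + jl.2 + 1)%N w else x0].

Let g0 : G := [ffun=> x0].

(** Defined for every sequence of letters, since the product law also charges sequences that no
    outcome produces. Columns in gaps or after the last block are set to zero. *)
Let blocks_matrix (s : seq G) : 'M[R]_(N, n) :=
  \matrix_(i < N, j < n) if kept K p q j then v (nth g0 s (j %/ p) (j, i)) else 0.

Let blocks_matrixE w i j : blocks_matrix (mkseq (block^~ w) K) i j =
  if kept K p q j then code_matrix w i j else 0.
Proof.
rewrite !mxE; case: ifP => // /andP[h1 h2].
by rewrite nth_mkseq // ffunE /= eqxx h2.
Qed.

Let V_ge0 : 0 <= V.
Proof. exact: le_trans (normr_ge0 _) (v_le x0). Qed.

Let sq_le (x : R) : `|x| <= V -> x ^+ 2 <= V ^+ 2.
Proof. by move=> h; rewrite -real_normK ?num_real //; apply: lerXn2r; rewrite ?nnegrE. Qed.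

Let y2 := complex.Im z ^+ 2.
Let y2_gt0 : 0 < y2. Proof. by rewrite exprn_gt0. Qed.

Let S (X : 'M[R]_(N, n)) : R := part (stieltjes (gram X) z).

Let S_le X : `|S X| <= (complex.Im z)^-1.
Proof. by apply: part_le; exact: stieltjes_bounded. Qed.

Let S_change (X Y : 'M[R]_(N, n)) (J : pred 'I_n) (c : R) : 0 <= c ->
  (forall i j, ~~ J j -> X i j = Y i j) ->
  (forall i j, J j -> X i j ^+ 2 + Y i j ^+ 2 <= c) ->
  `|S X - S Y| <= (\sum_(j < n) ((J j)%:R : R)) / n%:R * (c / y2).
Proof.
move=> c0 h hc; rewrite /S -partB; apply: part_le.
apply: cbounded_le (stieltjes_change_columns z_gt0 h).
have Nn0 : (N%:R : R) != 0 by rewrite pnatr_eq0 -lt0n.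
apply: (@le_trans _ _ ((N%:R * n%:R)^-1 * \sum_(j < n) (J j)%:R * (N%:R * c / y2))).
  apply: ler_wpM2l; first by rewrite invr_ge0 mulr_ge0.
  rewrite big_mkcond /=; apply: ler_sum => j _; case: (boolP (J j)) => Jj; last by rewrite mul0r.
  rewrite mul1r ler_pM2r ?invr_gt0 //.
  apply: (@le_trans _ _ (\sum_(i < N) c)); first by apply: ler_sum => i _; exact: hc.
  by rewrite sumr_const card_ord mulr_natl.
rewrite -mulr_suml le_eqVlt; apply/orP; left; apply/eqP.
field; rewrite Nn0 pnatr_eq0 -lt0n n_gt0 /=.
by rewrite gt_eqF.
Qed.

Let c0 : R := 2 * V ^+ 2 / y2.

(** A block holds at most [p <= n / K] of the [n] columns, so one letter moves the transform by a
    fraction [1 / K] of the bound for a change of all columns. *)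
Let blocks_differences :
  bounded_differences K (fun s => S (blocks_matrix s)) (c0 / K%:R).
Proof.
move=> s1 a b s2 hs.
have K0 : (0 : R) < K%:R by rewrite ltr0n.
have n0 : (0 : R) < n%:R by rewrite ltr0n.
have le2 (s s' : seq G) i j : blocks_matrix s i j ^+ 2 + blocks_matrix s' i j ^+ 2 <= 2 * V ^+ 2.
  have h (t : seq G) : blocks_matrix t i j ^+ 2 <= V ^+ 2.
    by rewrite mxE; case: ifP => _; [exact: sq_le|rewrite expr0n /= sqr_ge0].
  by have := h s; have := h s'; lra.
apply: le_trans (S_change (J := fun j => (j %/ p == size s1)%N) (c := 2 * V ^+ 2) _ _ _) _ => //.
- by rewrite mulr_ge0 ?sqr_ge0.
- move=> i j hj; rewrite !mxE; case: ifP => // _; rewrite !nth_cat.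
  case: ltnP => // le; have /subnSK <- : (size s1 < j %/ p)%N by rewrite ltn_neqAle eq_sym hj.
  by [].
rewrite -/c0 mulrC; apply: ler_wpM2l; first by rewrite divr_ge0 ?mulr_ge0 ?sqr_ge0 // ltW.
apply: (@le_trans _ _ (p%:R / n%:R)).
  by rewrite ler_pM2r ?invr_gt0 //; exact: count_block.
rewrite ler_pdivrMr // mulrC ler_pdivlMr // -natrM ler_nat mulnC; exact: Kp_le.
Qed.

Let removal w : `|S (code_matrix w) - S (blocks_matrix (mkseq (block^~ w) K))| <=
  (K%:R * q%:R + K%:R) / n%:R * (V ^+ 2 / y2).
Proof.
have n0 : (0 : R) < n%:R by rewrite ltr0n.
apply: le_trans (S_change (J := fun j => ~~ kept K p q j) (c := V ^+ 2) _ _ _) _ => //.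
- exact: sqr_ge0.
- by move=> i j; rewrite negbK blocks_matrixE => ->.
- move=> i j; rewrite blocks_matrixE => /negPf ->; rewrite expr0n addr0 mxE.
  exact: sq_le.
apply: ler_wpM2r; first by rewrite divr_ge0 ?sqr_ge0 // ltW.
by rewrite ler_pM2r ?invr_gt0 //; exact: count_removed.
Qed.

Let block_fiber i (I : set int) :
  (forall (j l : nat) (t : int), (j %/ p)%N = i -> (j %% p < p - q)%N -> (l < N)%N ->
     (absz t <= m)%N -> I ((j * N + l + 1)%N%:Z + t)) ->
  forall a, sigma_gen eps I (block i @^-1` [set a]).
Proof.
move=> hI a; have -> : block i @^-1` [set a] = \bigcap_(jl in [set: 'I_n * 'I_N])
    [set w | block i w jl = a jl].
  apply/seteqP; split => w /=; first by move=> <-.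
  by move=> h; apply/ffunP => jl; exact: (h jl).
apply: sigma_gen_bigcap => -[j l].
case: (boolP ((j %/ p == i) && (j %% p < p - q))%N) => h.
  have -> : [set w | block i w (j, l) = a (j, l)] =
     Z (j * N + l + 1)%N @^-1` [set a (j, l)].
    by apply/seteqP; split => w /=; rewrite ffunE /= h.
  have /andP[/eqP h1 h2] := h.
  by apply: Z_window => t tm; apply: hI.
have -> : [set w | block i w (j, l) = a (j, l)] = [set w | x0 = a (j, l)].
  by apply/seteqP; split => w /=; rewrite ffunE /= (negPf h).
have [e|ne] := pselect (x0 = a (j, l)).
  have -> : [set w : T | x0 = a (j, l)] = setT by apply/seteqP; split.
  exact: sigma_gen_setT.
have -> : [set w : T | x0 = a (j, l)] = set0 by apply/seteqP; split.
exact: sigma_algebra0.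
Qed.

(** An upper bound for the times that the first [k] blocks see through their windows. *)
Let cut (k : nat) : int := (k * p * N)%N%:Z - (q * N)%N%:Z + m%:Z.

Lemma code_matrix_tail (g : nat) (b e eta : R) :
  (0 < g)%N -> (g + 2 * m <= q * N + 1)%N ->
  (beta_mixing P eps g <= b%:E)%E -> 0 <= b -> 0 < e -> 0 <= eta ->
  eta * c0 <= 2^-1 -> 2 * eta * c0 ^+ 2 <= e / 2 ->
  2 * ((K%:R * q%:R + K%:R) / n%:R * (V ^+ 2 / y2)) <= e ->
  prb P [set w | 3 * e <= `|S (code_matrix w) - \int[P]_w S (code_matrix w)|] <=
  2 * expR (- (eta * e / 2 * K%:R)) + (2 + 2 / (complex.Im z * e)) * (K%:R * b).
Proof.
move=> g0' gap hb b_ge0 e_gt0 eta0 h1 h2 h3.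
have K0 : (0 : R) < K%:R by rewrite ltr0n.
have ye : 0 < complex.Im z * e by rewrite mulr_gt0.
have Kb : 0 <= K%:R * b by rewrite mulr_ge0 // ltW.
have mev : measurable [set w | 3 * e <= `|S (code_matrix w) - \int[P]_w S (code_matrix w)|].
  exact: (measurable_code_event (fun X => 3 * e <= `|S X - _|)).
(* When the mixing error is too large to compare the means, the last term of the bound already
   exceeds 1. *)
have [hs|hl] := leP (K%:R * (2 * b * (complex.Im z)^-1)) e; last first.
  apply: (@le_trans _ _ 1).
    by rewrite -lee_fin prbK // probability_le1.
  apply: (@le_trans _ _ (2 / (complex.Im z * e) * (K%:R * b))).
    rewrite mulrAC ler_pdivlMr // mul1r.
    have : e * complex.Im z <= K%:R * (2 * b * (complex.Im z)^-1) * complex.Im z.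
      by rewrite ler_pM2r // ltW.
    have -> : K%:R * (2 * b * (complex.Im z)^-1) * complex.Im z = 2 * (K%:R * b).
      by field; rewrite gt_eqF.
    by rewrite mulrC.
  rewrite [X in _ <= _ + X]mulrDl addrA lerDr addr_ge0 // ?mulr_ge0 // expR_ge0 //.
have c0_ge0 : 0 <= c0 by rewrite divr_ge0 ?mulr_ge0 ?sqr_ge0 // ltW.
have past_f k : (k < K)%N -> forall s : k.-tuple G,
    sigma_gen eps [set l | l <= cut k] [set w | mkseq (block^~ w) k = s].
  move=> kK s.
  have -> : [set w | mkseq (block^~ w) k = s] =
      \bigcap_(i in [set: 'I_k]) (block i @^-1` [set tnth s i]).
    apply/seteqP; split => w /= h.
      by move=> i _ /=; rewrite (tnth_nth g0) -h nth_mkseq.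
    apply: (@eq_from_nth _ g0); rewrite size_mkseq ?size_tuple // => i ik.
    by rewrite nth_mkseq //; have := h (Ordinal ik) I; rewrite /= (tnth_nth g0).
  apply: sigma_gen_bigcap => i; apply: block_fiber => j l t ji jq lN tm /=.
  exact: block_index_le (ltn_ord i) ji jq lN tm.
have fut_f k a : sigma_gen eps [set l | cut k + g%:Z <= l] (block k @^-1` [set a]).
  apply: block_fiber => j l t jk jq lN tm /=.
  exact: block_index_ge jk tm gap.
have bet k : (k < K)%N -> (beta_coef P (sigma_gen eps [set l | (l <= cut k)%R])
   (sigma_gen eps [set l | (cut k + g%:Z <= l)%R]) <= b%:E)%E.
  by move=> _; apply: le_trans hb; exact: beta_coef_le_mixing.
(* With Laplace parameter [eta * K] and differences [c0 / K] the exponent is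
   [eta * K * (2 * eta * c0 ^ 2 - e)], linear in the number of blocks. *)
have h4 := @blocks_concentration _ T R P G block K b
  (fun k => sigma_gen eps [set l | l <= cut k])
  (fun k => sigma_gen eps [set l | cut k + g%:Z <= l])
  (fun k => sigma_gen_measurable stat (I := _))
  (fun k => sigma_gen_measurable stat (I := _)) past_f fut_f bet
  (fun s => S (blocks_matrix s)) (complex.Im z)^-1 (c0 / K%:R) (eta * K%:R) e.
have yV : 0 <= (complex.Im z)^-1 by rewrite invr_ge0 ltW.
have {h4} h4 := h4 yV b_ge0 (mulr_ge0 eta0 (ltW K0)) (divr_ge0 c0_ge0 (ltW K0)).
have lc : eta * K%:R * (c0 / K%:R) = eta * c0 by field; rewrite gt_eqF.
have {h4} h4 : prb P [set w | 2 * e <= `|S (blocks_matrix (mkseq (block^~ w) K)) -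
      \int[P]_w S (blocks_matrix (mkseq (block^~ w) K))|] <=
   2 * expR (K%:R * (2 * (eta * K%:R) ^+ 2 * (c0 / K%:R) ^+ 2) - eta * K%:R * e) + K%:R * (2 * b).
  by apply: h4 => //; rewrite lc.
(* The thinned matrix as a function of [code_matrix w] alone, to which the finite-valued
   measurability and integrability lemmas apply. *)
pose bm w : 'M[R]_(N, n) := \matrix_(i, j) if kept K p q j then code_matrix w i j else 0.
have bmE w : blocks_matrix (mkseq (block^~ w) K) = bm w.
  by apply/matrixP => i j; rewrite blocks_matrixE [RHS]mxE.
have ib : P.-integrable setT (EFin \o (fun w => S (blocks_matrix (mkseq (block^~ w) K)))).
  have -> : (fun w => S (blocks_matrix (mkseq (block^~ w) K))) = (fun w => S (bm w)).
    by apply/funext => w; rewrite bmE.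
  exact: (integrable_code_matrix (fun X => S (\matrix_(i, j) if kept K p q j then X i j else 0))).
have ic : P.-integrable setT (EFin \o (fun w => S (code_matrix w))).
  exact: integrable_code_matrix.
have Ediff : `|\int[P]_w S (code_matrix w) -
    \int[P]_w S (blocks_matrix (mkseq (block^~ w) K))| <= e / 2.
  rewrite -RintegralB //; apply: le_trans (le_normr_Rintegral _ _) _ => //.
    exact: (integrableB measurableT ic ib).
  rewrite -[leRHS](Rintegral_probability_cst P); apply: le_Rintegral => //.
  - by have := integrable_norm (integrableB measurableT ic ib).
  - exact: finite_measure_integrable_cst.
  - by move=> w _; apply: le_trans (removal w) _; move: h3; lra.
apply: (@le_trans _ _ (prb P [set w | 2 * e <= `|S (blocks_matrix (mkseq (block^~ w) K)) -
      \int[P]_w S (blocks_matrix (mkseq (block^~ w) K))|])).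
  apply: (prb_le P mev).
    have -> : [set w | 2 * e <= `|S (blocks_matrix (mkseq (block^~ w) K)) -
      \int[P]_w S (blocks_matrix (mkseq (block^~ w) K))|] =
      [set w | 2 * e <= `|S (bm w) -
      \int[P]_w S (blocks_matrix (mkseq (block^~ w) K))|].
      by apply/funext => w /=; rewrite bmE.
    exact: (measurable_code_event (fun X => 2 * e <=
      `|S (\matrix_(i, j) if kept K p q j then X i j else 0) - _|)).
  by move=> w /= hw; exact: deviation_transfer (removal w) Ediff h3 hw.
apply: le_trans h4 _; apply: lerD.
  apply: ler_wpM2l => //; rewrite ler_expR.
  have -> : K%:R * (2 * (eta * K%:R) ^+ 2 * (c0 / K%:R) ^+ 2) - eta * K%:R * e =
     eta * K%:R * (2 * eta * c0 ^+ 2 - e) by field; rewrite gt_eqF.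
  have : eta * K%:R * (2 * eta * c0 ^+ 2 - e) <= eta * K%:R * (- (e / 2)).
    by apply: ler_wpM2l; [exact: mulr_ge0|lra].
  lra.
have : 0 <= 2 / (complex.Im z * e) * (K%:R * b) by rewrite mulr_ge0 // divr_ge0 // ltW.
by lra.
Qed.
End code_matrix.

(** * Almost sure convergence for matrices with finitely many values *)

Section borel_cantelli.
Context {d : measure_display} {T : measurableType d} {R : realType}.
Variable P : probability T R.

Lemma ae_not_lim_sup (F : nat -> set T) (n0 : nat) (B : R) : (forall n, measurable (F n)) ->
  (forall m, \sum_(n0 <= n < m) prb P (F n) <= B) ->
  {ae P, forall w, exists n, forall j, (n <= j)%N -> ~ F j w}.
Proof.
move=> mF hB.
have s_fin : (\sum_(n <oo) P (F n) < +oo)%E.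
  apply: (@le_lt_trans _ _ (n0%:R + B)%:E); last exact: ltry.
  apply: lime_le; first by apply: is_cvg_nneseries => n _ _; exact: measure_ge0.
  apply: nearW => m.
  have -> : (\sum_(0 <= n < m) P (F n) = (\sum_(0 <= n < m) prb P (F n))%:E)%E.
    by rewrite -sumEFin; apply: eq_bigr => n _; rewrite prbK.
  rewrite lee_fin.
  have pr1 n : prb P (F n) <= 1 by rewrite -lee_fin prbK // probability_le1.
  have n0le k : \sum_(0 <= n < k) prb P (F n) <= k%:R.
    apply: (@le_trans _ _ (\sum_(0 <= n < k) (1 : R))); first exact: ler_sum.
    by rewrite sumr_const_nat subn0.
  have B0 : 0 <= B by have := hB 0%N; rewrite big_geq.
  have [mn|nm] := leqP m n0.
    by apply: le_trans (n0le m) _; rewrite -[leLHS]addr0; apply: lerD => //; rewrite ler_nat.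
  rewrite (@big_cat_nat _ _ _ n0) //=; last exact: ltnW.
  exact: lerD.
have z := lim_sup_set_cvg0 mF s_fin.
exists (lim_sup_set F); split => //.
  by apply: bigcap_measurable => // k _; exact: bigcup_measurable.
move=> w /= hw k _; apply: contrapT => hk; apply: hw; exists k => j kj Fj.
by apply: hk; exists j.
Qed.

Lemma ae_cvg0 (D : nat -> T -> R) :
  (forall e, 0 < e -> forall n, measurable [set w | e <= `|D n w|]) ->
  (forall e, 0 < e -> exists (n0 : nat) (B : R), forall m,
     \sum_(n0 <= n < m) prb P [set w | e <= `|D n w|] <= B) ->
  {ae P, forall w, D^~ w @ \oo --> 0}.
Proof.
move=> mD hD.
have h k : {ae P, forall w, exists n, forall j, (n <= j)%N ->
    ~ [set w | k.+1%:R^-1 <= `|D j w|] w}.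
  have k0 : (0 : R) < k.+1%:R^-1 by rewrite invr_gt0.
  have [n0 [B hB]] := hD _ k0.
  by apply: ae_not_lim_sup hB => n; exact: mD.
have := ae_foralln h; apply: filterS => w hw.
apply/cvgrPdist_lt => e e0.
pose k := Num.truncn e^-1.
have ke : k.+1%:R^-1 < e.
  rewrite -[ltRHS]invrK ltf_pV2 ?posrE ?invr_gt0 //; exact: truncnS_gt.
have [n hn] := hw k; exists n => // j /= nj.
rewrite sub0r normrN; apply: lt_trans ke; rewrite ltNge; apply/negP.
exact: hn.
Qed.
End borel_cantelli.

Section code_matrix_convergence.
Context {d : measure_display} {T : measurableType d} {R : realType}.
Variable P : probability T R.
Variable eps : int -> T -> R.
Hypothesis stat : strictly_stationary P eps.
Variables (alpha : R).
Hypothesis alpha1 : 1 < alpha.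
Hypothesis mixing : (\sum_(1 <= n <oo)
        (((ln (n%:R : R)) `^ (3 * alpha / 2) * (n%:R : R) `^ (- (2^-1)))%:E
          * beta_mixing P eps n) < +oo)%E.

Let b n : R := fine (beta_mixing P eps n).

Let b_ge0 n : 0 <= b n.
Proof. by rewrite fine_ge0 // beta_mixing_ge0. Qed.

Let term_ge0 n : (0 <= (weight alpha n)%:E * beta_mixing P eps n)%E.
Proof. by rewrite mule_ge0 ?beta_mixing_ge0 // lee_fin mulr_ge0 ?powR_ge0. Qed.

Let partial_sum n : (\sum_(1 <= u < n) (weight alpha u)%:E * beta_mixing P eps u < +oo)%E.
Proof.
apply: le_lt_trans mixing.
exact: (@nneseries_lim_ge R (fun u => (weight alpha u)%:E * beta_mixing P eps u)%E xpredT 1 n).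
Qed.

(** An infinite term with positive weight would make a partial sum of the series infinite. The
    weight is positive only from 2 on, because [ln 1 = 0]. *)
Let bE n : (2 <= n)%N -> beta_mixing P eps n = (b n)%:E.
Proof.
move=> n2; rewrite fineK // ge0_fin_numE ?beta_mixing_ge0 //.
have w0 : 0 < weight alpha n.
  have n0 : (0 : R) < n%:R by rewrite ltr0n; exact: ltnW.
  by rewrite mulr_gt0 // powR_gt0 // ln_gt0 // ltr1n.
have := partial_sum n.+1; rewrite big_nat_recr /=; last exact: ltnW.
move=> h; rewrite ltey; apply/negP => /eqP e; move: h; rewrite e.
rewrite gt0_muley ?lte_fin // addey ?ltxx //.
rewrite gt_eqF // (lt_le_trans ltNy0) //.
by apply: sume_ge0.
Qed.

Let b_anti m n : (2 <= m)%N -> (m <= n)%N -> b n <= b m.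
Proof.
move=> m2 mn; rewrite -lee_fin -!bE //; last exact: leq_trans mn.
by apply: beta_mixing_anti => //; exact: ltnW.
Qed.

Let b_sum : exists M : R, forall n, \sum_(1 <= u < n) weight alpha u * b u <= M.
Proof.
pose S := (\sum_(1 <= n <oo) ((weight alpha n)%:E * beta_mixing P eps n))%E.
have S0 : (0 <= S)%E by apply: nneseries_ge0 => n _ _; exact: term_ge0.
have Sfin : S \is a fin_num by rewrite ge0_fin_numE.
exists (fine S) => n; rewrite -lee_fin fineK //.
apply: le_trans (@nneseries_lim_ge R
  (fun u => (weight alpha u)%:E * beta_mixing P eps u)%E xpredT 1 n _) => //.
rewrite -sumEFin le_eqVlt; apply/orP; left; apply/eqP.
rewrite big_nat [RHS]big_nat; apply: eq_bigr => u /andP[u1 _].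
have [u2|] := leqP 2 u; first by rewrite EFinM bE.
rewrite ltnS => ule; have -> : u = 1%N by apply/eqP; rewrite eqn_leq ule.
have -> : weight alpha 1 = 0 :> R.
  rewrite /weight ln1 powR0 ?mul0r // gt_eqF // divr_gt0 // mulr_gt0 //.
  exact: lt_trans alpha1.
by rewrite mul0r mul0e.
Qed.

(** Constants are rounded up to powers of two, so that block counts and gap lengths are compared
    through their exponents. *)
Lemma pow2_ge (x : R) : exists a : nat, x <= 2 ^+ a.
Proof.
exists (Num.truncn x).+1; apply: le_trans (ltW (truncnS_gt x)) _.
by rewrite -natrX ler_nat ltnW // ltn_expl.
Qed.

Lemma expn2_linear A s : (2 * A + 1 <= s)%N -> (2 ^ A * s <= 2 ^ s)%N.
Proof.
move=> h; have -> : (2 ^ s = 2 ^ A * 2 ^ (s - A))%N by rewrite -expnD subnKC //; lia.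
rewrite leq_mul2l; apply/orP; right.
have t2 t : (0 < t)%N -> (2 * t <= 2 ^ t)%N.
  by case: t => // t _; rewrite expnS leq_mul2l /= ltn_expl.
by apply: leq_trans (t2 (s - A)%N _); lia.
Qed.

Lemma sum_half_le s0 S : \sum_(s0 <= s < S) 2 ^+ s * (4 ^+ s)^-1 <= (2 : R).
Proof.
have E s : 2 ^+ s * (4 ^+ s)^-1 = (2^-1 : R) ^+ s.
  rewrite -exprVn -exprMn; congr (_ ^+ _); apply: (@mulIf _ 4); first by rewrite pnatr_eq0.
  by rewrite mulfVK ?pnatr_eq0 //; lra.
under eq_bigr do rewrite E.
have tot n : \sum_(0 <= s < n) (2^-1 : R) ^+ s = 2 - 2 * 2^-1 ^+ n.
  elim: n => [|n IH]; first by rewrite big_geq // expr0; ring.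
  by rewrite big_nat_recr //= IH exprS; field.
have [le|lt] := leqP S s0; first by rewrite big_geq.
apply: (@le_trans _ _ (\sum_(0 <= s < S) (2^-1 : R) ^+ s)).
  rewrite [leRHS](@big_cat_nat _ _ _ s0) //=; last exact: ltnW.
  by rewrite lerDr sumr_ge0.
by rewrite tot lerBlDr lerDl mulr_ge0 // exprn_ge0.
Qed.

Variable N : nat -> nat.
Variable c : R.
Hypothesis N_gt0 : forall n, (0 < N n)%N.
Hypothesis c_gt0 : 0 < c.
Hypothesis N_cvg : (fun n : nat => ((N n)%:R / n%:R : R)) @ \oo --> c.

Let N_lower : exists e2 n1 : nat, forall n, (n1 <= n)%N -> (n <= N n * 2 ^ e2)%N.
Proof.
have c2 : 0 < c / 2 by rewrite divr_gt0.
have [e2 he2] := pow2_ge (c / 2)^-1.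
have /cvgrPdist_lt /(_ _ c2) [n1 _ hn] := N_cvg.
exists e2, n1.+1 => n n1n.
have := hn n (ltnW n1n) => /= h.
have n0 : (0 : R) < n%:R by rewrite ltr0n; exact: leq_trans n1n.
have hc : c / 2 <= (N n)%:R / n%:R.
  by move: h; rewrite ltr_norml => /andP[_]; move: ((N n)%:R / n%:R) => x; lra.
rewrite -(ler_nat R) natrM natrX.
have h1 : c / 2 * n%:R <= (N n)%:R by rewrite -ler_pdivlMr.
have h2 : 1 <= c / 2 * 2 ^+ e2.
  by rewrite -[leLHS](mulfV (lt0r_neq0 c2)) ler_pM2l.
apply: (@le_trans _ _ ((c / 2 * n%:R) * 2 ^+ e2)).
  by rewrite mulrAC -[leLHS]mul1r ler_pM2r.
by apply: ler_wpM2r => //; exact: exprn_ge0.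
Qed.

Context {F : finType}.
Variables (x0 : F) (Z : nat -> T -> F) (m : nat).
Hypothesis Z_window : forall (k : nat) (I : set int),
  (forall l : int, (absz l <= m)%N -> I (k%:Z + l)) ->
  forall x, sigma_gen eps I (Z k @^-1` [set x]).
Variables (v : F -> R) (z : R[i]) (part : R[i] -> R).
Hypothesis z_gt0 : 0 < complex.Im z.
Hypothesis partB : forall x y, part (x - y) = part x - part y.
Hypothesis part_le : forall x r, cbounded x r -> `|part x| <= r.

Let S n w : R := part (stieltjes (gram (code_matrix Z v (N n) n w)) z).

Lemma code_matrix_tail_summable (e : R) : 0 < e ->
  exists (n0 : nat) (B : R), forall k,
    \sum_(n0 <= n < k) prb P [set w | 3 * e <= `|S n w - \int[P]_w S n w|] <= B.
Proof.
move=> e0; have [V hV] := finite_bounded v.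
have V0 : 0 <= V := le_trans (normr_ge0 _) (hV x0).
set y2 := complex.Im z ^+ 2.
have y20 : 0 < y2 by rewrite exprn_gt0.
pose c0 := 2 * V ^+ 2 / y2.
have c00 : 0 <= c0 by rewrite divr_ge0 ?mulr_ge0 ?sqr_ge0 // ltW.
(* Each of the first two terms gives one of the two smallness conditions on [eta]; the last keeps
   [Dn] positive. *)
pose Dn := 2 * c0 + 4 * c0 ^+ 2 / e + 1.
have f0 : 0 <= 4 * c0 ^+ 2 / e by apply: divr_ge0; [apply: mulr_ge0 => //; exact: sqr_ge0|exact: ltW].
have D0 : 0 < Dn by rewrite /Dn; lra.
pose eta := Dn^-1.
have eta0 : 0 < eta by rewrite invr_gt0.
have h1 : eta * c0 <= 2^-1.
  by rewrite mulrC ler_pdivrMr //; move: f0 c00; rewrite /Dn; lra.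
have h2 : 2 * eta * c0 ^+ 2 <= e / 2.
  rewrite mulrAC ler_pdivrMr //.
  have : 4 * c0 ^+ 2 / e <= Dn by rewrite /Dn; lra.
  by rewrite ler_pdivrMr //; lra.
pose kappa := eta * e / 2.
have ka0 : 0 < kappa by rewrite /kappa divr_gt0 // mulr_gt0.
(* With [K = 2 ^ (a + tau s)] this yields [kappa * K >= 4 * 2 ^ tau s >= 2 * s], so the exponential
   is at most [4 ^ - s], which beats the [2 ^ s] values of [n] at scale [s]. *)
have [a ha] := pow2_ge (4 / kappa).
(* The gaps take a fraction about [2 ^ - e1] of the columns; this makes twice the cost of removing
   them at most [e]. *)
have [e1 he1] := pow2_ge (4 * (V ^+ 2 / y2) / e).
have [e2 [n1 hN]] := N_lower.
have [M hM] := b_sum.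
pose ee := (a + e1 + e2 + 2)%N.
(* From this scale on, [2 ^ s] dominates [s] times each constant needed, exceeds the threshold [n1]
   for [N], and leaves room for the windows. *)
pose s0 := (2 * (a + e1 + ee + 1) + 1 + 2 * m + n1 + 2)%N.
have lin s A : (s0 <= s)%N -> (A <= a + e1 + ee + 1)%N -> (2 ^ A * s <= 2 ^ s)%N.
  by move=> hs hA; apply: expn2_linear; move: hs hA; rewrite /s0; clear; lia.
have tauee s : (s0 <= s)%N -> (tau s + ee.+1 <= s)%N.
  move=> hs; rewrite -(@leq_exp2l 2) // expnD mulnC.
  have s_gt0 : (0 < s)%N by move: hs; rewrite /s0; clear; lia.
  apply: leq_trans (lin s ee.+1 hs _); last by clear; lia.
  by rewrite leq_mul2l; have /andP[-> _] := tau_bounds s_gt0; rewrite orbT.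
pose C2 := 2 + 2 / (complex.Im z * e).
have C20 : 0 <= C2 by rewrite addr_ge0 // divr_ge0 // mulr_ge0 // ltW.
pose u s : R := 2 * (4 ^+ s)^-1 + C2 * (2 ^+ (a + tau s) * b (2 ^ (rexp ee s).+1)).
exists (2 ^ s0)%N, (4 + C2 * (2 ^+ (a + ee + 4) * M)).
apply: (dyadic_sum (v := u)).
- by move=> n; exact: prb_ge0.
- move=> n hn; set s := trunc_log 2 n.
  have n_gt0 : (0 < n)%N by apply: leq_trans hn; rewrite expn_gt0.
  have /andP[sn ns] : (2 ^ s <= n < 2 ^ s.+1)%N by exact: trunc_log_bounds.
  have ss : (s0 <= s)%N by apply: trunc_log_max.
  have s_gt0 : (0 < s)%N by apply: leq_trans ss; rewrite /s0; clear; lia.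
  have /andP[t1 t2] := tau_bounds s_gt0.
  pose K := (2 ^ (a + tau s))%N.
  have K_gt0 : (0 < K)%N by rewrite expn_gt0.
  have KD : (K * 2 ^ e1 <= n)%N.
    apply: leq_trans sn; apply: leq_trans (lin s (a + e1)%N ss _); last by clear; lia.
    by rewrite /K -expnD addnAC expnD leq_mul2l t1 orbT.
  have Kn : (K <= n)%N by apply: leq_trans KD; rewrite leq_pmulr // expn_gt0.
  pose p := (n %/ K)%N; pose q := (n %/ (K * 2 ^ e1))%N.
  have p_gt0 : (0 < p)%N by rewrite divn_gt0.
  have qp : (q <= p)%N by apply: leq_div2l => //; rewrite leq_pmulr // expn_gt0.
  have Kp : (K * p <= n)%N by rewrite mulnC leq_trunc_div.
  have Kp' : (n < K * p + K)%N.
    by have := ltn_ceil n K_gt0; rewrite mulSn mulnC addnC.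
  have hqN : (2 ^ (2 * s) <= q * N n * 2 ^ (a + tau s + e1 + e2 + 1))%N.
    have q_gt0 : (0 < q)%N by rewrite divn_gt0 // muln_gt0 K_gt0 expn_gt0.
    have D_gt0 : (0 < K * 2 ^ e1)%N by rewrite muln_gt0 K_gt0 expn_gt0.
    have nq : (n <= q * (2 * (K * 2 ^ e1)))%N.
      have := ltn_ceil n D_gt0; rewrite -/q mulSn => h; apply: leq_trans (ltnW h) _.
      by rewrite mul2n -addnn mulnDr leq_add2r leq_pmull.
    have nN : (n <= N n * 2 ^ e2)%N.
      apply: hN; apply: leq_trans hn; apply: leq_trans (ltnW (ltn_expl s0 (ltnSn 1))).
      by rewrite /s0; clear; lia.
    have -> : (2 ^ (2 * s) = 2 ^ s * 2 ^ s)%N by rewrite mul2n -addnn expnD.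
    apply: leq_trans (leq_mul (leq_trans sn nq) (leq_trans sn nN)) _.
    rewrite /K !expnD expn1; apply: eq_leq.
    by move: (2 ^ a)%N (2 ^ tau s)%N (2 ^ e1)%N (2 ^ e2)%N (N n) (q); clear; lia.
  (* The constant [ee] is large enough that [q * N n] is at least twice the required gap; the spare
     half contains the [2 * m] lost to the windows. *)
  have gap : (2 ^ (rexp ee s).+1 + 2 * m <= q * N n + 1)%N.
    have hx := tauee s ss.
    pose x := (rexp ee s).+1.
    have Ex : (2 * s = x.+1 + (a + tau s + e1 + e2 + 1))%N.
      by move: hx; rewrite /x /rexp /ee; clear; lia.
    have sx : (s <= x)%N by move: hx; rewrite /x /rexp; clear; lia.
    have qx : (2 ^ x.+1 <= q * N n)%N.
      by move: hqN; rewrite Ex expnD leq_pmul2r // expn_gt0.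
    have mx : (2 * m <= 2 ^ x)%N.
      apply: leq_trans (ltnW (ltn_expl x (ltnSn 1))); apply: leq_trans sx.
      by apply: leq_trans ss; rewrite /s0; clear; lia.
    by move: qx mx; rewrite -/x expnS; clear; lia.
  have g2 : (2 <= 2 ^ (rexp ee s).+1)%N by rewrite -{1}(expn1 2) leq_exp2l.
  have n0 : (0 : R) < n%:R by rewrite ltr0n.
  have rem : 2 * ((K%:R * q%:R + K%:R) / n%:R * (V ^+ 2 / y2)) <= e.
    have k1 : (K%:R * q%:R + K%:R) / n%:R <= 2 * (2 ^+ e1)^-1 :> R.
      rewrite ler_pdivrMr // mulrAC ler_pdivlMr ?exprn_gt0 //.
      rewrite mulrDl -!natrX -!natrM -natrD ler_nat.
      have a1 : (K * q * 2 ^ e1 <= n)%N by rewrite mulnAC mulnC leq_trunc_div.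
      by rewrite mul2n -addnn; exact: leq_add.
    have w0 : 0 <= V ^+ 2 / y2 by rewrite divr_ge0 ?sqr_ge0 // ltW.
    have e10 : (0 : R) < 2 ^+ e1 by rewrite exprn_gt0.
    have := ler_wpM2r w0 k1.
    have : 4 * (V ^+ 2 / y2) / 2 ^+ e1 <= e.
      by rewrite ler_pdivrMr // [e * _]mulrC -ler_pdivrMr.
    by move: (V ^+ 2 / y2) ((K%:R * q%:R + K%:R) / n%:R) (2 ^+ e1)^-1 => x1 x2 x3; lra.
  apply: le_trans (code_matrix_tail stat x0 Z_window hV z_gt0 partB part_le (N_gt0 n)
    K_gt0 p_gt0 qp Kp Kp' _ gap _ (b_ge0 _) e0 (ltW eta0) h1 h2 rem) _.
  + by rewrite expn_gt0.
  + by rewrite bE.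
  rewrite /u -/C2; apply: lerD.
    apply: ler_wpM2l => //.
    have ks : 2 * s%:R <= kappa * K%:R.
      have ka : 4 <= kappa * 2 ^+ a by rewrite mulrC -ler_pdivrMr.
      have ts : (s%:R : R) <= 2 * 2 ^+ tau s by rewrite -exprS -natrX ler_nat ltnW.
      rewrite /K natrX exprD mulrA.
      apply: (@le_trans _ _ (4 * 2 ^+ tau s)); first by move: ts; lra.
      by apply: ler_wpM2r => //; exact: exprn_ge0.
    apply: (@le_trans _ _ (expR (- (2 * s%:R)))).
      by rewrite ler_expR lerN2.
    rewrite expRN lef_pV2 ?posrE ?exprn_gt0 ?expR_gt0 //.
    rewrite -natrM -[(2 * s)%N%:R]mulr1 expRM_natl.
    have e2' : (2 : R) <= expR 1 by have := expR_ge1Dx (1 : R).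
    rewrite exprM; apply: lerXn2r; rewrite ?nnegrE ?exprn_ge0 ?expR_ge0 //.
    have -> : (4 : R) = 2 ^+ 2 by ring.
    by apply: lerXn2r; rewrite ?nnegrE ?expR_ge0.
  by rewrite /K natrX.
- move=> S'.
  have -> : \sum_(s0 <= s < S') 2 ^+ s * u s = 2 * (\sum_(s0 <= s < S') 2 ^+ s * (4 ^+ s)^-1) +
     C2 * (\sum_(s0 <= s < S') 2 ^+ s * (2 ^+ (a + tau s) * b (2 ^ (rexp ee s).+1))).
    rewrite !mulr_sumr -big_split /=; apply: eq_bigr => s _.
    by rewrite /u mulrDr !(mulrCA (2 ^+ s)).
  apply: lerD.
    by have := sum_half_le s0 S'; lra.
  apply: ler_wpM2l => //.
  apply: (dyadic_beta_sum b_ge0 b_anti alpha1 hM) => //.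
  by rewrite /s0; clear; lia.
Qed.

Lemma code_matrix_ae : {ae P, forall w, (fun n => S n w - \int[P]_w S n w) @ \oo --> 0}.
Proof.
apply: ae_cvg0.
  move=> e e0 n.
  exact: (measurable_code_event stat Z_window v (n := n)
    (fun X => e <= `|part (stieltjes (gram X) z) - _|)).
move=> e e0; have e3 : 0 < e / 3 by rewrite divr_gt0.
have [n0 [B hB]] := code_matrix_tail_summable e3.
exists n0, B => k; apply: le_trans (hB k).
have -> : 3 * (e / 3) = e by field.
by [].
Qed.
End code_matrix_convergence.

(** * The general case *)

Section measurable_stieltjes.
Context {d : measure_display} {T : measurableType d} {R : realType}.

Definition cmeasurable (f : T -> R[i]) : Prop :=
  measurable_fun setT (fun w => complex.Re (f w)) /\
  measurable_fun setT (fun w => complex.Im (f w)).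

Lemma cmeasurable_cst (x : R[i]) : cmeasurable (fun=> x).
Proof. by split; exact: measurable_cst. Qed.

Lemma cmeasurable_real (f : T -> R) : measurable_fun setT f ->
  cmeasurable (fun w => ((f w)%:C)%C).
Proof. by move=> mf; split => //; exact: measurable_cst. Qed.

Lemma cmeasurableD f g : cmeasurable f -> cmeasurable g ->
  cmeasurable (fun w => f w + g w).
Proof.
move=> [f1 f2] [g1 g2]; split.
  by under eq_fun do rewrite ReD; exact: measurable_funD.
by under eq_fun do rewrite ImD; exact: measurable_funD.
Qed.

Lemma cmeasurableM f g : cmeasurable f -> cmeasurable g ->
  cmeasurable (fun w => f w * g w).
Proof.
move=> [f1 f2] [g1 g2]; split.
  under eq_fun do rewrite ReM.
  by apply: measurable_funB; exact: measurable_funM.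
under eq_fun do rewrite ImM.
by apply: measurable_funD; exact: measurable_funM.
Qed.

Lemma cmeasurableV f : cmeasurable f -> cmeasurable (fun w => (f w)^-1).
Proof.
move=> [f1 f2].
pose n2 w := complex.Re (f w) ^+ 2 + complex.Im (f w) ^+ 2.
have mn : measurable_fun setT (fun w => (n2 w)^-1).
  (* As a real power, the inverse is measurable also across the points where [n2] vanishes. *)
  have -> : (fun w => (n2 w)^-1) = (fun w => n2 w `^ (-1)).
    by apply/funext => w; rewrite powR_inv1 // addr_ge0 ?sqr_ge0.
  have mn2 : measurable_fun setT n2 by apply: measurable_funD; exact: measurable_funX.
  exact: (measurableT_comp (measurable_powR (-1)) mn2).
split.
  have -> : (fun w => complex.Re (f w)^-1) = (fun w => complex.Re (f w) * (n2 w)^-1).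
    by apply/funext => w; rewrite /n2; case: (f w).
  exact: measurable_funM.
have -> : (fun w => complex.Im (f w)^-1) = (fun w => (- 1) * (complex.Im (f w) * (n2 w)^-1)).
  by apply/funext => w; rewrite /n2 mulN1r; case: (f w).
by apply: measurable_funM => //; exact: measurable_funM.
Qed.

Lemma cmeasurable_sum (I : Type) (s : seq I) (f : I -> T -> R[i]) :
  (forall i, cmeasurable (f i)) -> cmeasurable (fun w => \sum_(i <- s) f i w).
Proof.
move=> h; elim: s => [|i s IH].
  by under eq_fun do rewrite big_nil; exact: cmeasurable_cst.
by under eq_fun do rewrite big_cons; exact: cmeasurableD.
Qed.

Lemma cmeasurable_prod (I : Type) (s : seq I) (f : I -> T -> R[i]) :
  (forall i, cmeasurable (f i)) -> cmeasurable (fun w => \prod_(i <- s) f i w).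
Proof.
move=> h; elim: s => [|i s IH].
  by under eq_fun do rewrite big_nil; exact: cmeasurable_cst.
by under eq_fun do rewrite big_cons; exact: cmeasurableM.
Qed.

Lemma cmeasurable_det n (M : T -> 'M[R[i]]_n) :
  (forall i j, cmeasurable (fun w => M w i j)) -> cmeasurable (fun w => \det (M w)).
Proof.
move=> h; apply: cmeasurable_sum => s; apply: cmeasurableM; first exact: cmeasurable_cst.
by apply: cmeasurable_prod.
Qed.

(** By the adjugate formula the trace of the resolvent is a rational function of the matrix
    entries. *)
Lemma cmeasurable_stieltjes (N n : nat) (X : T -> 'M[R]_(N, n)) (z : R[i]) :
  0 < complex.Im z -> (forall i j, measurable_fun setT (fun w => X w i j)) ->
  cmeasurable (fun w => stieltjes (gram (X w)) z).
Proof.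
move=> z0 mX; apply: cmeasurableM; first exact: cmeasurable_cst.
pose M w := cmx (gram (X w)) - z%:M.
have mM i j : cmeasurable (fun w => M w i j).
  have -> : (fun w => M w i j) = (fun w => (((gram (X w)) i j)%:C)%C - @scalar_mx _ N z i j).
    by apply/funext => w; rewrite !mxE.
  apply: cmeasurableD; last exact: cmeasurable_cst.
  apply: cmeasurable_real.
  have -> : (fun w => gram (X w) i j) = (fun w => n%:R^-1 * \sum_k X w i k * X w j k).
    apply/funext => w; rewrite !mxE; congr (_ * _); apply: eq_bigr => k _.
    by rewrite !mxE.
  apply: measurable_funM => //; apply: measurable_sum => k.
  exact: measurable_funM.
have -> : (fun w => \tr (invmx (M w))) =
   (fun w => (\det (M w))^-1 * \sum_i cofactor (M w) i i).
  apply/funext => w; rewrite /invmx resolvent_unit ?gram_sym // linearZ /=.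
  by congr (_ * _); apply: eq_bigr => i _; rewrite mxE.
apply: cmeasurableM; first by apply: cmeasurableV; exact: cmeasurable_det.
apply: cmeasurable_sum => i; apply: cmeasurableM; first exact: cmeasurable_cst.
apply: cmeasurable_det => k l.
by have -> : (fun w => row' i (col' i (M w)) k l) = (fun w => M w (lift i k) (lift i l));
  [apply/funext => w; rewrite !mxE|exact: mM].
Qed.
End measurable_stieltjes.

(** * Passage from finite-valued to general entries *)

Section part_convergence.
Context {d : measure_display} {T : measurableType d} {R : realType}.
Variable P : probability T R.
Variable eps : int -> T -> R.
Hypothesis stat : strictly_stationary P eps.
Variable alpha : R.
Hypothesis alpha1 : 1 < alpha.
Hypothesis mixing : (\sum_(1 <= n <oo)
        (((ln (n%:R : R)) `^ (3 * alpha / 2) * (n%:R : R) `^ (- (2^-1)))%:E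
          * beta_mixing P eps n) < +oo)%E.
Variable N : nat -> nat.
Variable c : R.
Hypothesis N_gt0 : forall n, (0 < N n)%N.
Hypothesis c_gt0 : 0 < c.
Hypothesis N_cvg : (fun n : nat => ((N n)%:R / n%:R : R)) @ \oo --> c.
Variables (z : R[i]) (part : R[i] -> R).
Hypothesis z_gt0 : 0 < complex.Im z.
Hypothesis partB : forall x y, part (x - y) = part x - part y.
Hypothesis part_le : forall x r, cbounded x r -> `|part x| <= r.
Hypothesis partM : forall f : T -> R[i], cmeasurable f ->
  measurable_fun setT (fun w => part (f w)).

Local Notation S := (g_sigma_algebraType (@cylinder_sets R)).
Variable g : S -> R.
Hypothesis mg : measurable_fun setT g.
Hypothesis g2 : (\int[P]_w (g (traj eps 0 w) ^+ 2)%:E < +oo)%E.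

Let mtx (h : S -> R) n w : 'M[R]_(N n, n) := data_matrix (shift_process h eps) (N n) n w.
Let St h n w : R := part (stieltjes (gram (mtx h n w)) z).

Let mSt h n : measurable_fun setT h -> measurable_fun setT (St h n).
Proof.
move=> mh; apply: partM; apply: cmeasurable_stieltjes => // i j.
under eq_fun do rewrite mxE.
exact: (measurable_traj_comp stat).
Qed.

Let iSt h n : measurable_fun setT h -> P.-integrable setT (EFin \o St h n).
Proof.
move=> mh; apply: (integrable_bounded P (M := (complex.Im z)^-1)); first exact: mSt.
by move=> w; apply: part_le; apply: stieltjes_bounded.
Qed.

Let sigma2 : R := fine (\int[P]_w (g (traj eps 0 w) ^+ 2)%:E)%E.

Let sigma2_ge0 : 0 <= sigma2.
Proof. by rewrite fine_ge0 // integral_ge0 // => w _; rewrite lee_fin sqr_ge0. Qed.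

Let g2E : (\int[P]_w (g (traj eps 0 w) ^+ 2)%:E = sigma2%:E)%E.
Proof.
by rewrite fineK // ge0_fin_numE // integral_ge0 // => w _; rewrite lee_fin sqr_ge0.
Qed.

Lemma sum_data_matrix (f : nat -> R) (a n : nat) :
  \sum_(j < n) \sum_(i < a) f (j * a + i + 1)%N = \sum_(1 <= u < (n * a).+1) f u.
Proof.
have -> : \sum_(1 <= u < (n * a).+1) f u = \sum_(0 <= u < n * a) f (u + 1)%N.
  by rewrite -[X in \sum_(X <= _ < _) _]add0n big_addn subn1.
rewrite sum_nat_blocks big_mkord.
by apply: eq_bigr => j _; rewrite big_mkord.
Qed.

Section one_step.
Variables (h : S -> R).
Hypothesis mh : measurable_fun setT h.
Variable D : R.
Hypothesis hD : (\int[P]_w ((g (traj eps 0 w) - h (traj eps 0 w)) ^+ 2)%:E <= D%:E)%E.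

Let G2 w (k : nat) := g (traj eps k w) ^+ 2.
Let H2 w (k : nat) := (g (traj eps k w) - h (traj eps k w)) ^+ 2.

Let avg (f : T -> nat -> R) n w : R :=
  ((N n)%:R * n%:R)^-1 * \sum_(1 <= u < (n * N n).+1) f w u.

Let St_diff n w s : 0 < s <= 1 ->
  `|St g n w - St h n w| <= 2 * complex.Im z ^- 2 * (s * avg G2 n w + s^-1 * avg H2 n w).
Proof.
move=> s01; rewrite /St -partB; apply: part_le.
have := stieltjes_lipschitz (mtx g n w) (mtx h n w) z_gt0 s01.
have -> : \sum_j \sum_i (mtx g n w) i j ^+ 2 = \sum_(1 <= u < (n * N n).+1) G2 w u.
  rewrite -sum_data_matrix; apply: eq_bigr => j _; apply: eq_bigr => i _.
  by rewrite mxE.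
have -> : \sum_j \sum_i ((mtx g n w) i j - (mtx h n w) i j) ^+ 2 =
    \sum_(1 <= u < (n * N n).+1) H2 w u.
  rewrite -sum_data_matrix; apply: eq_bigr => j _; apply: eq_bigr => i _.
  by rewrite !mxE.
by [].
Qed.

Let Nn_gt0 n : (0 < n)%N -> (0 : R) < (N n)%:R * n%:R.
Proof. by move=> n0; rewrite mulr_gt0 ?ltr0n. Qed.

Let avg_le (f : T -> nat -> R) (l : R) n w : (0 < n)%N ->
  (forall k, \sum_(1 <= u < k.+2) f w u <= l * k.+1%:R) -> avg f n w <= l.
Proof.
move=> n0 hl; rewrite /avg mulrC ler_pdivrMr ?Nn_gt0 // -natrM.
have : (0 < n * N n)%N by rewrite muln_gt0 n0 N_gt0.
by rewrite [(N n * n)%N]mulnC; case: (n * N n)%N.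
Qed.

Let mG : measurable_fun setT (fun f : S => g f ^+ 2).
Proof. exact: measurable_funX. Qed.

Let mH : measurable_fun setT (fun f : S => (g f - h f) ^+ 2).
Proof. by apply: measurable_funX; exact: measurable_funB. Qed.

(** One event serves all [n]: outside it, averages over any number of terms stay below the two
    levels. *)
Let exceptional (l1 l2 : R) : set T :=
  [set w | exists n, l1 * n.+1%:R < \sum_(1 <= i < n.+2) G2 w i] `|`
  [set w | exists n, l2 * n.+1%:R < \sum_(1 <= i < n.+2) H2 w i].

Lemma exceptional_small (l1 l2 : R) : 0 < l1 -> 0 < l2 ->
  measurable (exceptional l1 l2) /\
  prb P (exceptional l1 l2) <= 2 * sigma2 / l1 + 2 * D / l2.
Proof.
move=> l10 l20.
have V1 : (\int[P]_w (g (traj eps 0 w) ^+ 2)%:E <= sigma2%:E)%E by rewrite g2E.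
have [m1 p1] := maximal_inequality stat mG (fun f => sqr_ge0 (g f)) V1 l10.
have [m2 p2] := maximal_inequality stat mH (fun f => sqr_ge0 (g f - h f)) hD l20.
split; first exact: measurableU.
by apply: le_trans (prbU P m1 m2) _; exact: lerD.
Qed.

Lemma St_diff_off_exceptional (l1 l2 s : R) n w : (0 < n)%N -> 0 < s <= 1 ->
  ~ exceptional l1 l2 w ->
  `|St g n w - St h n w| <= 2 * complex.Im z ^- 2 * (s * l1 + s^-1 * l2).
Proof.
move=> n0 s01 /not_orP[h1 h2]; have /andP[s0 _] := s01.
have y0 : 0 <= 2 * complex.Im z ^- 2 by rewrite mulr_ge0 // invr_ge0 sqr_ge0.
apply: le_trans (St_diff n w s01) _; apply: ler_wpM2l => //; apply: lerD.
  apply: ler_wpM2l; first exact: ltW.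
  apply: avg_le => // k; rewrite leNgt; apply/negP => hk; apply: h1; by exists k.
apply: ler_wpM2l; first by rewrite invr_ge0 ltW.
apply: avg_le => // k; rewrite leNgt; apply/negP => hk; apply: h2; by exists k.
Qed.

Let avg_mean (y : S -> R) (V : R) n : (0 < n)%N -> measurable_fun setT y ->
  (forall f, 0 <= y f) -> (\int[P]_w (y (traj eps 0 w))%:E <= V%:E)%E ->
  P.-integrable setT (EFin \o avg (fun w (k : nat) => y (traj eps k w)) n) /\
  \int[P]_w avg (fun w (k : nat) => y (traj eps k w)) n w <= V.
Proof.
move=> n0 my y0 yV.
have i1 (k : nat) := (integrable_traj stat k my y0 yV).1.
have i2 := integrable_bigsum (index_iota 1 (n * N n).+1) i1.
split; first exact: integrable_scale.
rewrite RintegralZl // mulrC ler_pdivrMr ?Nn_gt0 // Rintegral_sum //.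
apply: (@le_trans _ _ (\sum_(1 <= u < (n * N n).+1) V)).
  by apply: ler_sum => k _; exact: (integrable_traj stat k my y0 yV).2.
by rewrite sumr_const_nat subn1 /= -[leLHS]mulr_natr -natrM mulnC.
Qed.

Lemma mean_St_diff s n : (0 < n)%N -> 0 < s <= 1 ->
  `|\int[P]_w St g n w - \int[P]_w St h n w| <=
  2 * complex.Im z ^- 2 * (s * sigma2 + s^-1 * D).
Proof.
move=> n0 s01; have /andP[s0 _] := s01.
have y0 : 0 <= 2 * complex.Im z ^- 2 by rewrite mulr_ge0 // invr_ge0 sqr_ge0.
have V1 : (\int[P]_w (g (traj eps 0 w) ^+ 2)%:E <= sigma2%:E)%E by rewrite g2E.
have [i1 m1] := avg_mean n0 mG (fun f => sqr_ge0 (g f)) V1.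
have [i2 m2] := avg_mean n0 mH (fun f => sqr_ge0 (g f - h f)) hD.
have ig := iSt n mg; have ih := iSt n mh.
have igh := integrableB measurableT ig ih.
rewrite -RintegralB //; apply: le_trans (le_normr_Rintegral _ _) _ => //.
have i1' := integrable_scale s i1; have i2' := integrable_scale s^-1 i2.
have i3 := integrable_add i1' i2'.
apply: (@le_trans _ _ (\int[P]_w (2 * complex.Im z ^- 2 * (s * avg G2 n w + s^-1 * avg H2 n w)))).
  apply: le_Rintegral => //.
  - by have := integrable_norm igh.
  - exact: integrable_scale.
  - by move=> w _; exact: St_diff.
rewrite RintegralZl //; apply: ler_wpM2l => //.
rewrite (RintegralD measurableT i1' i2').
rewrite (RintegralZl s measurableT i1) (RintegralZl s^-1 measurableT i2); apply: lerD.
  by apply: ler_wpM2l => //; exact: ltW.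
by apply: ler_wpM2l => //; rewrite invr_ge0 ltW.
Qed.
End one_step.

Lemma window_code_fibers r (C : 'I_r -> set S) m (k : int) (I : set int) x :
  (forall i, <<s window_sets m >> (C i)) -> (forall l, (absz l <= m)%N -> I (k + l)) ->
  sigma_gen eps I ((fun w => window_code C (traj eps k w)) @^-1` [set x]).
Proof.
move=> wC hI; have -> : (fun w => window_code C (traj eps k w)) @^-1` [set x] =
    \bigcap_(i in [set: 'I_r]) [set w | window_code C (traj eps k w) i = x i].
  apply/seteqP; split => w /=; first by move=> <-.
  by move=> hh; apply/ffunP => i; exact: (hh i).
apply: sigma_gen_bigcap => i.
have sC : sigma_gen eps I (traj eps k @^-1` C i) by apply: sigma_gen_window hI (wC i).
case: (boolP (x i)) => xi.
  have -> : [set w | window_code C (traj eps k w) i = true] = traj eps k @^-1` C i; last exact: sC.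
  by apply/seteqP; split => w /=; rewrite ffunE => /asboolP.
have -> : [set w | window_code C (traj eps k w) i = false] = setT `\` (traj eps k @^-1` C i).
  apply/seteqP; split => w /=; rewrite ffunE.
    by move=> hf; split => // /asboolP; rewrite hf.
  by move=> [_ hn]; exact: asboolF.
exact: sigma_algebraCD.
Qed.

Lemma approximation_step (j : nat) : exists p : (nat -> T -> R) * set T,
  [/\ measurable p.2, prb P p.2 <= (2 * sigma2 + 2) / 2 ^+ j,
   {ae P, forall w, (fun n => p.1 n w - \int[P]_w p.1 n w) @ \oo --> 0},
   (forall w n, ~ p.2 w -> (0 < n)%N ->
     `|St g n w - p.1 n w| <= 4 * complex.Im z ^- 2 / 2 ^+ j) &
   (forall n, (0 < n)%N -> `|\int[P]_w St g n w - \int[P]_w p.1 n w| <=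
      2 * complex.Im z ^- 2 * (sigma2 + 1) / 2 ^+ j)].
Proof.
(* The powers of [t] below balance the errors. With mean square error [t ^ 4], levels [t^-1] and
   [t ^ 3], and Lipschitz weight [t ^ 2], the exceptional probability, the pathwise error and the
   error in the mean are all of order [t]. *)
pose t : R := (2 ^+ j)^-1.
have t0 : 0 < t by rewrite invr_gt0 exprn_gt0.
have t1 : t <= 1 by rewrite invf_le1 ?exprn_gt0 // exprn_ege1 // ler1n.
have D0 : 0 < t ^+ 4 by rewrite exprn_gt0.
have [r [m [C [v [wC hv]]]]] := window_approximation_L2 stat mg g2 D0.
pose h (f : S) := v (window_code C f).
have mh : measurable_fun setT h.
  have fC : fibers_measurable (window_code C : S -> _).
    move=> x; have -> : window_code C @^-1` [set x] =
        \bigcap_(i in [set: 'I_r]) [set f | window_code C f i = x i].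
      apply/seteqP; split => f /=; first by move=> <-.
      by move=> hh; apply/ffunP => i; exact: (hh i).
    apply: fin_bigcap_measurable => [|i _]; first exact: finite_finset.
    have mC : measurable (C i : set S) by apply: window_sets_measurable (wC i).
    case: (boolP (x i)) => xi.
      have -> : [set f | window_code C f i = true] = C i; last exact: mC.
      by apply/seteqP; split => f /=; rewrite ffunE => /asboolP.
    have -> : [set f | window_code C f i = false] = ~` C i; last exact: measurableC.
    apply/seteqP; split => f /=; rewrite ffunE; last by move=> hn; exact: asboolF.
    by move=> hf /asboolP; rewrite hf.
  exact: measurable_finite_valued.
have l1 : 0 < t^-1 by rewrite invr_gt0.
have l2 : 0 < t ^+ 3 by rewrite exprn_gt0.
have s01 : 0 < t ^+ 2 <= 1 by rewrite exprn_gt0 //= exprn_ile1 // ltW.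
have tne : t != 0 by rewrite gt_eqF.
pose Z (k : nat) w := window_code C (traj eps k w).
have [mA pA] := exceptional_small mh hv l1 l2.
have y0 : 0 <= 2 * complex.Im z ^- 2 by rewrite mulr_ge0 // invr_ge0 sqr_ge0.
exists (St h, [set w | exists n, t^-1 * n.+1%:R < \sum_(1 <= i < n.+2) g (traj eps i w) ^+ 2] `|`
  [set w | exists n, t ^+ 3 * n.+1%:R <
    \sum_(1 <= i < n.+2) (g (traj eps i w) - h (traj eps i w)) ^+ 2]); split => /=.
- exact: mA.
- apply: le_trans pA _; rewrite -/t.
  by have -> : 2 * sigma2 / t^-1 + 2 * t ^+ 4 / t ^+ 3 = (2 * sigma2 + 2) * t by field.
- have E n w : St h n w = part (stieltjes (gram (code_matrix Z v (N n) n w)) z).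
    have M : mtx h n w = code_matrix Z v (N n) n w by apply/matrixP => i k; rewrite !mxE.
    by rewrite /St M.
  have -> : St h = (fun n w => part (stieltjes (gram (code_matrix Z v (N n) n w)) z)).
    by apply/funext => n; apply/funext => w; exact: E.
  exact: (code_matrix_ae stat alpha1 mixing N_gt0 c_gt0 N_cvg [ffun=> false] (Z := Z) (m := m)
    (fun k I hI x => window_code_fibers x wC hI) v z_gt0 partB part_le).
- move=> w n nA n0.
  apply: le_trans (St_diff_off_exceptional n0 s01 nA) _; rewrite -/t.
  have -> : t ^+ 2 / t + (t ^+ 2)^-1 * t ^+ 3 = 2 * t by field.
  by rewrite le_eqVlt; apply/orP; left; apply/eqP; ring.
- move=> n n0; apply: le_trans (mean_St_diff mh hv n0 s01) _; rewrite -/t -[leRHS]mulrA.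
  apply: ler_wpM2l => //.
  have -> : (t ^+ 2)^-1 * t ^+ 4 = t ^+ 2 by field.
  rewrite mulrDl mul1r; have t2 : t ^+ 2 <= t by rewrite expr2 -[leRHS]mulr1 ler_pM2l.
  by apply: lerD => //; rewrite mulrC; apply: ler_wpM2l.
Qed.

(** Almost every path lies in only finitely many exceptional events and satisfies the convergence
    for every approximation. Given [e], a single good approximation is fixed for that path before
    [n] tends to infinity. *)
Lemma part_convergence :
  {ae P, forall w, (fun n => St g n w - \int[P]_w St g n w) @ \oo --> 0}.
Proof.
have [p hp] := choice approximation_step.
have bc : {ae P, forall w, exists n, forall j, (n <= j)%N -> ~ (p j).2 w}.
  apply: (@ae_not_lim_sup _ _ _ P (fun j => (p j).2) 0 ((2 * sigma2 + 2) * 2)).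
    by move=> j; have [] := hp j.
  move=> k; apply: (@le_trans _ _ (\sum_(0 <= j < k) (2 * sigma2 + 2) * (2 ^+ j * (4 ^+ j)^-1))).
    apply: ler_sum => j _; have [_ + _ _ _] := hp j; move/le_trans; apply.
    have -> : (2 ^+ j * (4 ^+ j)^-1 = (2 ^+ j)^-1 :> R).
      have -> : (4 : R) = 2 * 2 by ring.
      by rewrite exprMn invfM mulrA divff ?mul1r // expf_neq0.
    by [].
  rewrite -mulr_sumr; apply: ler_wpM2l; last exact: sum_half_le.
  by rewrite addr_ge0 // mulr_ge0.
have cv : {ae P, forall w j, (fun n => (p j).1 n w - \int[P]_w (p j).1 n w) @ \oo --> 0}.
  by apply: ae_foralln => j; have [] := hp j.
apply: filterS2 bc cv => w [j0 hj0] cv.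
pose CC := 4 * complex.Im z ^- 2 + 2 * complex.Im z ^- 2 * (sigma2 + 1).
apply/cvgrPdist_lt => e e0.
have [j1 hj1] := pow2_ge (2 * CC / e).
(* Past [j0] the path avoids the exceptional events; past [j1] the pathwise error and the error in
   the mean total at most [e / 2]. *)
pose j := (j0 + j1)%N.
have CCe : CC / 2 ^+ j <= e / 2.
  have p0 : (0 : R) < 2 ^+ j by rewrite exprn_gt0.
  rewrite ler_pdivrMr //.
  have : 2 * CC / e <= 2 ^+ j.
    by apply: le_trans hj1 _; rewrite ler_eXn2l ?ltr1n // leq_addl.
  by rewrite ler_pdivrMr //; lra.
have [_ _ _ h1 h2] := hp j.
have e2 : 0 < e / 2 by rewrite divr_gt0.
have /cvgrPdist_lt /(_ _ e2) [n1 _ hn1] := cv j.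
exists n1.+1 => // n /= nn; have n0 : (0 < n)%N by apply: leq_trans nn.
have := hn1 n (ltnW nn); rewrite /= !sub0r !normrN => h3.
have := h1 w n (hj0 j (leq_addr _ _)) n0; have := h2 n n0.
move: CCe h3; rewrite /CC mulrDl.
move: (St g n w) ((p j).1 n w) (\int[P]_w St g n w) (\int[P]_w (p j).1 n w) => A B EA EB.
move: (4 * _ / _) (2 * _ * _ / _) => u1 u2 hu h3 h4 h5.
have -> : A - EA = (A - B) + ((B - EB) - (EA - EB)) by ring.
apply: le_lt_trans (ler_normD _ _) _.
have : `|B - EB - (EA - EB)| <= `|B - EB| + `|EA - EB| by exact: ler_normB.
lra.
Qed.
End part_convergence.

Theorem theorem2p1 (d : measure_display) (T : measurableType d) (R : realType)
  (P : probability T R) (eps : int -> T -> R) (g : (int -> R) -> R)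
  (N : nat -> nat) (c : R) :
  strictly_stationary P eps ->
  product_measurable g ->
  (forall k, P.-integrable setT (EFin \o shift_process g eps k)) ->
  (forall k, 'E_P[shift_process g eps k] = 0)%E ->
  (forall k, 'E_P[fun w => (shift_process g eps k w ^+ 2)%R] < +oo)%E ->
  (forall n, (0 < N n)%N) ->
  0 < c ->
  (fun n : nat => ((N n)%:R / n%:R : R)) @ \oo --> c ->
  (exists alpha : R, 1 < alpha /\
     (\sum_(1 <= n <oo)
        (((ln (n%:R : R)) `^ (3 * alpha / 2) * (n%:R : R) `^ (- (2^-1)))%:E
          * beta_mixing P eps n) < +oo)%E) ->
  forall z : R[i], 0 < complex.Im z ->
  {ae P, forall w,
     let D := fun n => (stieltjes (B_matrix (shift_process g eps) (N n) n w) z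
                        - cexpectation P (fun w' =>
                            stieltjes (B_matrix (shift_process g eps) (N n) n w') z)) in
     (fun n : nat => complex.Re (D n)) @ \oo --> 0 /\
     (fun n : nat => complex.Im (D n)) @ \oo --> 0}.
Proof.
move=> stat /product_measurableP mg _ _ g2 N_gt0 c_gt0 N_cvg [alpha [alpha1 mixing]] z z_gt0.
have {}g2 : (\int[P]_w (g (traj eps 0 w) ^+ 2)%:E < +oo)%E.
  by have := g2 0; rewrite unlock.
have BRe (x y : R[i]) : complex.Re (x - y) = complex.Re x - complex.Re y by rewrite ReD ReN.
have BIm (x y : R[i]) : complex.Im (x - y) = complex.Im x - complex.Im y by rewrite ImD ImN.
have hRe := part_convergence stat alpha1 mixing N_gt0 c_gt0 N_cvg z_gt0 BRe
  (fun x r h => h.1) (fun f h => h.1) mg g2.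
have hIm := part_convergence stat alpha1 mixing N_gt0 c_gt0 N_cvg z_gt0 BIm
  (fun x r h => h.2) (fun f h => h.2) mg g2.
pose B n w := stieltjes (gram (data_matrix (shift_process g eps) (N n) n w)) z.
pose D n w := B n w - cexpectation P (B n).
apply: filterS2 hRe hIm => w hRe hIm; split.
  have E : (fun n => complex.Re (B n w) - \int[P]_w0 complex.Re (B n w0)) =
      (fun n => complex.Re (D n w)).
    by apply/funext => n; rewrite /D BRe /cexpectation /= unlock.
  have {}hRe : (fun n => complex.Re (B n w) - \int[P]_w0 complex.Re (B n w0)) @ \oo --> 0.
    exact: hRe.
  by rewrite E in hRe.
have E : (fun n => complex.Im (B n w) - \int[P]_w0 complex.Im (B n w0)) =
    (fun n => complex.Im (D n w)).
  by apply/funext => n; rewrite /D BIm /cexpectation /= unlock.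
have {}hIm : (fun n => complex.Im (B n w) - \int[P]_w0 complex.Im (B n w0)) @ \oo --> 0.
  exact: hIm.
by rewrite E in hIm.
Qed.
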